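(* Let $X$ be a $\mathfrak S\times\mathfrak S^{op}$-module, $P$ a TraP and $\varphi:X\to P$ a morphism of $\mathfrak S\times\mathfrak S^{op}$-modules. There exists a unique TraP morphism $\Phi:\mathbf{PGr}(X)\to P$ such that $\Phi\circ\iota=\varphi$, where $\iota:X\to\mathbf{PGr}(X)$ sends $x\in X(k,l)$ to the planar $X$-decorated graph $PG_{k,l}$ whose unique vertex is decorated by $x$. In other words, $\mathbf{PGr}(X)$ is the free TraP generated by the $\mathfrak S\times\mathfrak S^{op}$-module $X$.
   Context: A $\mathfrak S\times\mathfrak S^{op}$-module is a family $X=(X(k,l))_{k,l\ge0}$ of vector spaces, each $X(k,l)$ a $\mathfrak S_l\times\mathfrak S_k^{op}$-module; morphisms are families of equivariant linear maps. $[n]=\{1,\dots,n\}$. Graphs. A graph is a tuple $G=(V(G),E(G),I(G),O(G),IO(G),L(G),s,t,\alpha,\beta)$ with finite sets $V(G)$ (vertices), $E(G)$ (internal edges), $I(G)$ (input), $O(G)$ (output), $IO(G)$ (input-output edges), $L(G)$ (loops), $s:E(G)\sqcup O(G)\to V(G)$, $t:E(G)\sqcup I(G)\to V(G)$, bijections $\alpha:I(G)\sqcup IO(G)\to[i(G)]$, $\beta:O(G)\sqcup IO(G)\to[o(G)]$ ($i(G)=|I|+|IO|$, $o(G)=|O|+|IO|$). For $v\in V(G)$, $I(v)=\{e\in I(G)\sqcup E(G):t(e)=v\}$, $O(v)=\{e\in O(G)\sqcup E(G):s(e)=v\}$, $i(v)=|I(v)|$, $o(v)=|O(v)|$. A planar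 graph carries a total order on each $I(v)$ and $O(v)$ (preserved by isomorphisms). $\mathbf{PGr}(X)(k,l)=\bigoplus_{G}\mathbb K G\otimes\bigotimes_{v\in V(G)}X(i(v),o(v))$, the sum over isoclasses of planar graphs with $i(G)=k$, $o(G)=l$ (orders identify $I(v)$, $O(v)$ with $[i(v)]$, $[o(v)]$). $PG_{k,l}$: one vertex, input edges $1..k$, output edges $1..l$, ordered increasingly, nothing else. TraP structure on $\mathbf{PGr}(X)$ (decorations are carried along/tensored; orders at vertices are preserved, a glued edge taking the position of the edges it replaces): $\sigma\cdot G$ replaces $\beta$ by $\sigma\circ\beta$, $G\cdot\tau$ replaces $\alpha$ by $\tau^{-1}\circ\alpha$; $G*G'$ is the disjoint union with indices of $G'$ shifted by $i(G)$, resp. $o(G)$. Partial trace $t_{i,j}(G)$ ($e_i=\alpha^{-1}(i)$, $f_j=\beta^{-1}(j)$) glues $e_i$ to $f_j$: input+output gives an internal edge from $s(f_j)$ to $t(e_i)$; input-output $e_i$ + output $f_j$ gives an output edge with source $s(f_j)$ and index $\beta(e_i)$; input $e_i$ + input-output $f_j$ gives an input edge with target $t(e_i)$ and index $\alpha(f_j)$; two distinct input-output edges give an input-output edge with indices $\alpha(f_j)$, $\beta(e_i)$; $e_i=f_j$ gives a loop; then input indices $>i$ and output indices $>j$ decrease by $1$. TraP. A TraP is a family $P=(P(k,l))_{k,l\ge0}$ of vector spaces such that: (1) each $P(k,l)$ is a $\mathfrak S_l\times\mathfrak S_k^{op}$-module; (2) a horizontal concatenation $*:P(k,l)\otimes P(k',l')\to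 P(k+k',l+l')$, associative with unit $I_0\in P(0,0)$, with $(\sigma\cdot p\cdot\tau)*(\sigma'\cdot p'\cdot\tau')=(\sigma\otimes\sigma')\cdot(p*p')\cdot(\tau\otimes\tau')$ and $c_{l,l'}\cdot(p*p')=(p'*p)\cdot c_{k,k'}$ ($\alpha\otimes\beta$ is $\alpha$ on $[m]$ and $i\mapsto\beta(i-m)+m$ for $i>m$; $c_{m,n}(i)=i+n$ for $i\le m$, $i-m$ for $i>m$); (3) linear maps $t_{i,j}:P(k,l)\to P(k-1,l-1)$ ($k,l\ge1$, $i\in[k]$, $j\in[l]$) with: (a) for $i'\in[k-1]$, $j'\in[l-1]$: $t_{i',j'}t_{i,j}=t_{i-1,j-1}t_{i',j'}$ if $i'<i,j'<j$; $=t_{i,j-1}t_{i'+1,j'}$ if $i'\ge i,j'<j$; $=t_{i-1,j}t_{i',j'+1}$ if $i'<i,j'\ge j$; $=t_{i,j}t_{i'+1,j'+1}$ if $i'\ge i,j'\ge j$; (b) $t_{i,j}(\sigma\cdot p\cdot\tau)=\sigma_j\cdot t_{\tau(i),\sigma^{-1}(j)}(p)\cdot\tau_i$, $\alpha_p\in\mathfrak S_{n-1}$ having word obtained from $\alpha(1)\cdots\alpha(n)$ by deleting the letter $p$ and subtracting $1$ from letters $>p$; (c) for $p\in P(k,l)$: $t_{i,j}(p*p')=t_{i,j}(p)*p'$ if $i\le k,j\le l$, $=p*t_{i-k,j-l}(p')$ if $i>k,j>l$; (d) there is $I\in P(1,1)$ with $t_{1,j}(I*p)=(1,\dots,j-1)\cdot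 p$ ($j\ge2$), $t_{i,1}(I*p)=p\cdot(1,\dots,i-1)^{-1}$ ($i\ge2$), $t_{k+1,j}(p*I)=(j,\dots,l)^{-1}\cdot p$ ($j\le l$), $t_{i,l+1}(p*I)=p\cdot(i,\dots,k)$ ($i\le k$). A TraP morphism is a family of linear maps commuting with the actions, $*$ and all $t_{i,j}$.
   Formalization: TraP morphisms are also required to preserve the units I_0 and I (otherwise 0 breaks uniqueness for X=0), and in axiom (b) the permutation acting on the right is τ with the letter τ(i), not i, deleted (the literal form fails in PGr(X)). *)

(* Defs.v *)
From HB Require Import structures.
From mathcomp Require Import boolp freeg.
From mathcomp Require Import all_boot all_order all_algebra all_fingroup.

Set Implicit Arguments.
Unset Strict Implicit.
Unset Printing Implicit Defensive.

Import GRing.Theory.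
Local Open Scope ring_scope.

Definition sum_map A B A' B' (f : A -> A') (g : B -> B') (x : A + B) :
    A' + B' :=
  match x with inl a => inl (f a) | inr b => inr (g b) end.

Lemma inj_surj_bij (A : finType) (B : eqType) (f : A -> B) :
  injective f -> (forall y, exists x, f x = y) -> bijective f.
Proof.
move=> fI fS; have cf y : y \in codom f.
  by case: (fS y) => x <-; exact: codom_f.
exists (fun y => iinv (cf y)) => [x|y]; last exact: f_iinv.
by apply: fI; rewrite f_iinv.
Qed.

Lemma bij_surj A B (f : A -> B) : bijective f -> forall y, exists x, f x = y.
Proof. by case=> g _ gK y; exists (g y). Qed.

Definition bij_inv (A : finType) (B : eqType) (f : A -> B) (fb : bijective f)
    (y : B) : A :=
  iinv (let: ex_intro x fx := bij_surj fb y in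
        eq_ind _ (fun z => z \in codom f) (codom_f f x) _ fx).

Lemma bij_invK (A : finType) (B : eqType) (f : A -> B) (fb : bijective f) y :
  f (bij_inv fb y) = y.
Proof. exact: f_iinv. Qed.

(* A family of total orders on the fibres of f, encoded as one partial order
   whose comparable elements are those with the same image. *)
Definition fibre_order (A : Type) (V : eqType) (f : A -> V) (r : rel A) :=
  [/\ reflexive r, antisymmetric r, transitive r
    & forall x y, (r x y || r y x) = (f x == f y)].

(* The finite sets of a graph live in Set: a record quantifying over finType
   would be too large to generate a free lmodType. *)
Record finS : Type := FinS { finS_sort :> Set; finS_class : Finite finS_sort }.
HB.instance Definition _ (A : finS) : Finite (finS_sort A) := finS_class A.

Notation "[ 'finS' 'of' T ]" := (FinS (Finite.on T%type))
  (at level 0, format "[ 'finS'  'of'  T ]").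

(* A copy of 'I_n in Set. *)
Record ordS (n : nat) : Set := OrdS { ordS_val : nat; ordSP : (ordS_val < n)%N }.
Definition ordI n (x : ordS n) : 'I_n := Ordinal (ordSP x).
Definition Iord n (x : 'I_n) : ordS n := OrdS (ltn_ord x).
Lemma ordIK n : cancel (@ordI n) (@Iord n).
Proof. by case=> x hx; rewrite /Iord /=; congr OrdS; apply: bool_irrelevance. Qed.
Lemma IordK n : cancel (@Iord n) (@ordI n).
Proof. by move=> x; apply: val_inj. Qed.
HB.instance Definition _ n := Finite.copy (ordS n) (can_type (@ordIK n)).

Section Perm.

Definition perm_tens_fun m n (s : 'S_m) (t : 'S_n) (x : 'I_(m + n)) : 'I_(m + n) :=
  unsplit (sum_map s t (split x)).

Lemma perm_tens_inj m n (s : 'S_m) (t : 'S_n) : injective (perm_tens_fun s t).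
Proof.
move=> x y /(can_inj unsplitK) h; apply: (can_inj splitK).
by case: (split x) (split y) h => a [] b //= [] /perm_inj ->.
Qed.

Definition perm_tens m n (s : 'S_m) (t : 'S_n) : 'S_(m + n) :=
  perm (@perm_tens_inj m n s t).

(* c_{m,n} sends i to i + n if i < m and to i - m otherwise (indices from 0). *)
Definition perm_braid_fun m n (x : 'I_(m + n)) : 'I_(m + n) :=
  cast_ord (addnC n m)
    (match split x with inl a => rshift n a | inr b => lshift m b end).

Lemma perm_braid_inj m n : injective (@perm_braid_fun m n).
Proof.
move=> x y /cast_ord_inj h; apply: (can_inj splitK).
case: (split x) (split y) h => a [] b /eqP.
- by rewrite eq_rshift => /eqP ->.
- by rewrite eq_rlshift.
- by rewrite eq_lrshift.
- by rewrite eq_lshift => /eqP ->.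
Qed.

Definition perm_braid m n : 'S_(m + n) := perm (@perm_braid_inj m n).

Definition drop_ord n (i j : 'I_n.+1) (h : i != j) : 'I_n := s2val (unlift_some h).

Lemma lift_drop n (i j : 'I_n.+1) (h : i != j) : lift i (drop_ord h) = j.
Proof. by rewrite /drop_ord; case: (unlift_some h). Qed.

Lemma drop_irr n (i j : 'I_n.+1) (h h' : i != j) : drop_ord h = drop_ord h'.
Proof. by apply: (@lift_inj _ i); rewrite !lift_drop. Qed.

Lemma perm_del_ne n (s : 'S_n.+1) (p : 'I_n.+1) (x : 'I_n) :
  p != s (lift ((s^-1)%g p) x).
Proof.
by apply/eqP => h; have := neq_lift ((s^-1)%g p) x; rewrite {1}h permK eqxx.
Qed.

Definition perm_del_fun n (s : 'S_n.+1) (p : 'I_n.+1) (x : 'I_n) : 'I_n :=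
  drop_ord (perm_del_ne s p x).

Lemma perm_del_inj n (s : 'S_n.+1) p : injective (perm_del_fun s p).
Proof.
by move=> x y /(congr1 (lift p)); rewrite !lift_drop => /perm_inj/lift_inj.
Qed.

(* The word of perm_del s p is that of s with the letter p deleted and the
   letters greater than p decreased by 1. *)
Definition perm_del n (s : 'S_n.+1) (p : 'I_n.+1) : 'S_n :=
  perm (@perm_del_inj n s p).

Lemma perm_delE n (s : 'S_n.+1) p : lift_perm ((s^-1)%g p) p (perm_del s p) = s.
Proof.
apply/permP => x; case: (unliftP ((s^-1)%g p) x) => [y ->|->].
  by rewrite lift_perm_lift permE lift_drop.
by rewrite lift_perm_id permKV.
Qed.

(* The cycle (a, a+1, ..., b), for a <= b: see cycE. *)
Definition cyc n (a b : 'I_n.+1) : 'S_n.+1 := lift_perm b a 1%g.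

Lemma cycE n (a b x : 'I_n.+1) : (a <= b)%N ->
  cyc a b x = (if (a <= x < b)%N then x.+1 else if x == b then a else x) :> nat.
Proof.
move=> ab; case: (unliftP b x) => [y ->|->]; last first.
  by rewrite lift_perm_id ltnn andbF eqxx.
rewrite lift_perm_lift perm1 [lift b y == b]eq_sym (negPf (neq_lift b y)) /= /bump.
case: (leqP b y) => by_ /=.
  by rewrite (leq_trans ab by_) add1n ltnNge (leq_trans by_ (leqnSn y)) andbF.
by rewrite add0n by_ andbT; case: (leqP a y).
Qed.

End Perm.

(* In MathComp (s * t)%g applies s first: the composite s \o t is (t * s)%g. *)

Record ssdata (K : fieldType) := SSData {
  ss_car :> nat -> nat -> lmodType K;
  actl : forall k l, 'S_l -> ss_car k l -> ss_car k l;
  actr : forall k l, ss_car k l -> 'S_k -> ss_car k l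
}.

Definition castP (K : fieldType) (X : ssdata K) k l k' l'
    (e : (k = k') * (l = l')) (x : X k l) : X k' l' :=
  ecast l0 (X k' l0) e.2 (ecast k0 (X k0 l) e.1 x).

Record is_ssmod (K : fieldType) (X : ssdata K) : Prop := IsSSMod {
  actl_linear : forall k l (s : 'S_l), linear (actl s : X k l -> X k l);
  actr_linear : forall k l (t : 'S_k), linear (fun x : X k l => actr x t);
  actl1 : forall k l (x : X k l), actl 1%g x = x;
  actlM : forall k l (s s' : 'S_l) (x : X k l),
    actl (s' * s)%g x = actl s (actl s' x);
  actr1 : forall k l (x : X k l), actr x 1%g = x;
  actrM : forall k l (t t' : 'S_k) (x : X k l),
    actr x (t' * t)%g = actr (actr x t) t';
  actlr : forall k l (s : 'S_l) (t : 'S_k) (x : X k l),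
    actl s (actr x t) = actr (actl s x) t
}.

Record ssmod (K : fieldType) := SSMod {
  ssmod_data :> ssdata K;
  ssmodP : is_ssmod ssmod_data
}.

Record ss_morphism (K : fieldType) (X Y : ssdata K)
    (f : forall k l, X k l -> Y k l) : Prop := SSMorphism {
  ssm_linear : forall k l, linear (f k l);
  ssm_actl : forall k l (s : 'S_l) (x : X k l), f k l (actl s x) = actl s (f k l x);
  ssm_actr : forall k l (x : X k l) (t : 'S_k), f k l (actr x t) = actr (f k l x) t
}.

(* Indices are numbered from 0. *)
Record trapdata (K : fieldType) := TrapData {
  trap_ss :> ssdata K;
  hcat : forall k l k' l',
    trap_ss k l -> trap_ss k' l' -> trap_ss (k + k')%N (l + l')%N;
  trap0 : trap_ss 0 0;
  trap1 : trap_ss 1 1;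
  ptr : forall k l, 'I_k.+1 -> 'I_l.+1 -> trap_ss k.+1 l.+1 -> trap_ss k l
}.
Arguments trap0 {K} t.
Arguments trap1 {K} t.

Record is_trap (K : fieldType) (P : trapdata K) : Prop := IsTrap {
  trap_ssmod : is_ssmod P;
  hcat_linearl : forall k l k' l' (q : P k' l'),
    linear ((@hcat K P k l k' l')^~ q);
  hcat_linearr : forall k l k' l' (p : P k l),
    linear (@hcat K P k l k' l' p);
  ptr_linear : forall k l (i : 'I_k.+1) (j : 'I_l.+1),
    linear (@ptr K P k l i j);
  hcatA : forall k l k' l' k'' l'' (p : P k l) (q : P k' l') (r : P k'' l''),
    hcat p (hcat q r) =
    castP (esym (addnA k k' k''), esym (addnA l l' l'')) (hcat (hcat p q) r);
  hcat0p : forall k l (p : P k l), hcat (trap0 P) p = p;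
  hcatp0 : forall k l (p : P k l),
    castP (addn0 k, addn0 l) (hcat p (trap0 P)) = p;
  hcat_equiv : forall k l k' l' (s : 'S_l) (t : 'S_k) (s' : 'S_l') (t' : 'S_k')
      (p : P k l) (p' : P k' l'),
    hcat (actr (actl s p) t) (actr (actl s' p') t') =
    actr (actl (perm_tens s s') (hcat p p')) (perm_tens t t');
  hcatC : forall k l k' l' (p : P k l) (p' : P k' l'),
    actl (perm_braid l l') (hcat p p') =
    actr (castP (addnC k' k, addnC l' l) (hcat p' p)) (perm_braid k k');
  ptr_ptr_ll : forall k l (i : 'I_k.+2) (j : 'I_l.+2) (i' : 'I_k.+1)
      (j' : 'I_l.+1) (p : P k.+2 l.+2), (i' < i)%N -> (j' < j)%N ->
    ptr i' j' (ptr i j p) =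
    ptr (inord i.-1) (inord j.-1) (ptr (inord i') (inord j') p);
  ptr_ptr_gl : forall k l (i : 'I_k.+2) (j : 'I_l.+2) (i' : 'I_k.+1)
      (j' : 'I_l.+1) (p : P k.+2 l.+2), (i <= i')%N -> (j' < j)%N ->
    ptr i' j' (ptr i j p) =
    ptr (inord i) (inord j.-1) (ptr (inord i'.+1) (inord j') p);
  ptr_ptr_lg : forall k l (i : 'I_k.+2) (j : 'I_l.+2) (i' : 'I_k.+1)
      (j' : 'I_l.+1) (p : P k.+2 l.+2), (i' < i)%N -> (j <= j')%N ->
    ptr i' j' (ptr i j p) =
    ptr (inord i.-1) (inord j) (ptr (inord i') (inord j'.+1) p);
  ptr_ptr_gg : forall k l (i : 'I_k.+2) (j : 'I_l.+2) (i' : 'I_k.+1)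
      (j' : 'I_l.+1) (p : P k.+2 l.+2), (i <= i')%N -> (j <= j')%N ->
    ptr i' j' (ptr i j p) =
    ptr (inord i) (inord j) (ptr (inord i'.+1) (inord j'.+1) p);
  (* On inputs it is the i-th letter of t, namely t i, that is deleted: this
     is the choice compatible with actrM. *)
  ptr_equiv : forall k l (i : 'I_k.+1) (j : 'I_l.+1) (s : 'S_l.+1) (t : 'S_k.+1)
      (p : P k.+1 l.+1),
    ptr i j (actr (actl s p) t) =
    actr (actl (perm_del s j) (ptr (t i) ((s^-1)%g j) p)) (perm_del t (t i));
  ptr_hcatl : forall k l k' l' (i : 'I_k.+1) (j : 'I_l.+1) (p : P k.+1 l.+1)
      (p' : P k' l'),
    ptr (lshift k' i : 'I_(k + k').+1) (lshift l' j : 'I_(l + l').+1) (hcat p p') =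
    hcat (ptr i j p) p';
  ptr_hcatr : forall k l k' l' (i : 'I_k'.+1) (j : 'I_l'.+1) (p : P k l)
      (p' : P k'.+1 l'.+1),
    ptr (cast_ord (addnS k k') (rshift k i)) (cast_ord (addnS l l') (rshift l j))
      (castP (addnS k k', addnS l l') (hcat p p')) =
    hcat p (ptr i j p');
  (* The output j (resp. input i) of p is lift ord0 j (resp. lift ord0 i) in
     trap1 * p and lift ord_max j (resp. lift ord_max i) in p * trap1. *)
  ptr_1hcat_out : forall k l (j : 'I_l.+1) (p : P k l.+1),
    ptr (ord0 : 'I_k.+1) (lift ord0 j) (hcat (trap1 P) p) = actl (cyc ord0 j) p;
  ptr_1hcat_in : forall k l (i : 'I_k.+1) (p : P k.+1 l),
    ptr (lift ord0 i) (ord0 : 'I_l.+1) (hcat (trap1 P) p) =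
    actr p (cyc ord0 i)^-1%g;
  ptr_hcat1_out : forall k l (j : 'I_l.+1) (p : P k l.+1),
    ptr ord_max (lift ord_max j) (castP (addn1 k, addn1 l.+1) (hcat p (trap1 P))) =
    actl (cyc j ord_max)^-1%g p;
  ptr_hcat1_in : forall k l (i : 'I_k.+1) (p : P k.+1 l),
    ptr (lift ord_max i) ord_max (castP (addn1 k.+1, addn1 l) (hcat p (trap1 P))) =
    actr p (cyc i ord_max)
}.

Record trap (K : fieldType) := Trap {
  trap_data :> trapdata K;
  trapP : is_trap trap_data
}.

(* The units trap0 and trap1 are part of the structure, hence preserved.
   Without this, morphisms out of a TraP would not be determined by their
   values on generators, e.g. 0 would extend the zero map on generators. *)
Record trap_morphism (K : fieldType) (P Q : trapdata K)
    (f : forall k l, P k l -> Q k l) : Prop := TrapMorphism {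
  trm_ss : ss_morphism f;
  trm_hcat : forall k l k' l' (p : P k l) (p' : P k' l'),
    f _ _ (hcat p p') = hcat (f _ _ p) (f _ _ p');
  trm_ptr : forall k l (i : 'I_k.+1) (j : 'I_l.+1) (p : P k.+1 l.+1),
    f _ _ (ptr i j p) = ptr i j (f _ _ p);
  trm0 : f _ _ (trap0 P) = trap0 Q;
  trm1 : f _ _ (trap1 P) = trap1 Q
}.

(* A planar graph with vertex set V and prescribed arities: ain v = i(v) and
   aout v = o(v).  Keeping the arities as a parameter lets the operations
   below preserve them on the nose, so that decorations need no transport.
   The total orders on the sets I(v) and O(v) are rin and rout. *)
Record pgraph (V : finS) (ain aout : V -> nat) (k l : nat) := PGraph {
  gE : finS;
  gI : finS;
  gO : finS;
  gIO : finS;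
  gL : finS;
  src : gE + gO -> V;
  tgt : gE + gI -> V;
  alpha : gI + gIO -> 'I_k;
  beta : gO + gIO -> 'I_l;
  rin : rel (gE + gI);
  rout : rel (gE + gO);
  alpha_bij : bijective alpha;
  beta_bij : bijective beta;
  rinP : fibre_order tgt rin;
  routP : fibre_order src rout;
  ainP : forall v, #|[pred e | tgt e == v]| = ain v;
  aoutP : forall v, #|[pred e | src e == v]| = aout v
}.
Arguments src {V ain aout k l} p.
Arguments tgt {V ain aout k l} p.
Arguments alpha {V ain aout k l} p.
Arguments beta {V ain aout k l} p.
Arguments rin {V ain aout k l} p.
Arguments rout {V ain aout k l} p.

(* rewire replaces the sets of edges of G, pulling back sources, targets and orders
   along bijections, and takes new indices. *)
Section Rewire.

Lemma fibre_order_pull A B (V : eqType) (f : B -> V) (r : rel B) (h : A -> B) :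
  injective h -> fibre_order f r -> fibre_order (f \o h) (relpre h r).
Proof.
move=> hI [rr ra rt rc]; split=> [x|x y|y x z|x y] /=.
- exact: rr.
- by move/ra/hI.
- exact: rt.
- exact: rc.
Qed.

Lemma card_pull (A B : finType) (V : eqType) (f : B -> V) (h : A -> B) v :
  bijective h -> #|[pred e | f (h e) == v]| = #|[pred e | f e == v]|.
Proof.
move=> hb; rewrite -(card_image (bij_inj hb)); apply: eq_card => y.
case: (hb) => g gK Kg; apply/imageP/idP => [[x hx ->] //|hy].
by exists (g y); rewrite ?Kg // inE Kg.
Qed.

Variables (V : finS) (ain aout : V -> nat) (k l k' l' : nat).
Variables (G : pgraph ain aout k l) (E I O IO L : finS).
Variables (hT : E + I -> gE G + gI G) (hS : E + O -> gE G + gO G).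
Variables (a : I + IO -> 'I_k') (b : O + IO -> 'I_l').
Hypotheses (hTb : bijective hT) (hSb : bijective hS).
Hypotheses (ab : bijective a) (bb : bijective b).

Definition rewire : pgraph ain aout k' l' :=
  @PGraph V ain aout k' l' E I O IO L (src G \o hS) (tgt G \o hT) a b
    (relpre hT (rin G)) (relpre hS (rout G)) ab bb
    (fibre_order_pull (bij_inj hTb) (rinP G))
    (fibre_order_pull (bij_inj hSb) (routP G))
    (fun v => etrans (card_pull _ v hTb) (ainP G v))
    (fun v => etrans (card_pull _ v hSb) (aoutP G v)).

End Rewire.

Section Act.
Variables (V : finS) (ain aout : V -> nat) (k l : nat).

Lemma bij_id A : bijective (@id A). Proof. by exists id. Qed.

Lemma perm_bijective n (s : 'S_n) : bijective s.
Proof. exact: injF_bij perm_inj. Qed.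

Definition pgraph_actl (s : 'S_l) (G : pgraph ain aout k l) : pgraph ain aout k l :=
  rewire (gL G) (bij_id _) (bij_id _) (alpha_bij G)
    (bij_comp (perm_bijective s) (beta_bij G)).

Definition pgraph_actr (G : pgraph ain aout k l) (t : 'S_k) : pgraph ain aout k l :=
  rewire (gL G) (bij_id _) (bij_id _)
    (bij_comp (perm_bijective t^-1%g) (alpha_bij G)) (beta_bij G).

End Act.

Definition sum_arity (V V' : Type) (m : V -> nat) (m' : V' -> nat) (v : V + V') :=
  match v with inl w => m w | inr w => m' w end.

Definition sum_rel A B (r : rel A) (r' : rel B) : rel (A + B) :=
  fun x y => match x, y with
             | inl a, inl b => r a b
             | inr a, inr b => r' a b
             | _, _ => false
             end.

Definition shuffle A A' B B' (x : (A + A') + (B + B')) : (A + B) + (A' + B') :=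
  match x with
  | inl (inl a) => inl (inl a)
  | inl (inr a) => inr (inl a)
  | inr (inl b) => inl (inr b)
  | inr (inr b) => inr (inr b)
  end.

Lemma shuffleK A A' B B' : cancel (@shuffle A A' B B') (@shuffle A B A' B').
Proof. by case=> [[]|[]]. Qed.

Lemma shuffle_bij A A' B B' : bijective (@shuffle A A' B B').
Proof. by exists (@shuffle A B A' B'); apply: shuffleK. Qed.

Lemma sum_map_bij A B A' B' (f : A -> A') (g : B -> B') :
  bijective f -> bijective g -> bijective (sum_map f g).
Proof.
case=> f' fK Kf [g' gK Kg]; exists (sum_map f' g') => -[] x /=.
- by rewrite fK.
- by rewrite gK.
- by rewrite Kf.
- by rewrite Kg.
Qed.

Lemma unsplit_bij m n : bijective (@unsplit m n).
Proof. by exists (@split m n); [exact: unsplitK | exact: splitK]. Qed.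

Lemma fibre_order_sum A A' (V V' : finS) (f : A -> V) (f' : A' -> V')
    (r : rel A) (r' : rel A') :
  fibre_order f r -> fibre_order f' r' ->
  fibre_order (sum_map f f' : _ -> [finS of V + V']) (sum_rel r r').
Proof.
move=> [rr ra rt rc] [rr' ra' rt' rc'].
split=> [[]x //=|[]x[]y //=|[]y[]x[]z //=|[]x[]y //=].
- by move/ra ->.
- by move/ra' ->.
- exact: rt.
- exact: rt'.
Qed.

Section Union.
Variables (V V' : finS) (ain aout : V -> nat) (ain' aout' : V' -> nat).
Variables (k l k' l' : nat) (G : pgraph ain aout k l) (G' : pgraph ain' aout' k' l').

Lemma card_sum (A A' : finType) (f : A -> V) (f' : A' -> V') (v : V + V') :
  #|[pred e | sum_map f f' e == v]| =
  sum_arity (fun w => #|[pred e | f e == w]|) (fun w => #|[pred e | f' e == w]|) v.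
Proof.
rewrite -!sum1_card big_sumType /=; case: v => w /=; rewrite -sum1_card.
  by rewrite addnC big1 // => i /eqP.
by rewrite big1 // => i /eqP.
Qed.

Let E := [finS of gE G + gE G'].
Let I := [finS of gI G + gI G'].
Let O := [finS of gO G + gO G'].

Let T (e : E + I) : [finS of V + V'] := sum_map (tgt G) (tgt G') (shuffle e).
Let S (e : E + O) : [finS of V + V'] := sum_map (src G) (src G') (shuffle e).

Lemma union_ainP v : #|[pred e | T e == v]| = sum_arity ain ain' v.
Proof.
rewrite (card_pull (sum_map (tgt G) (tgt G') : _ -> [finS of V + V']));
  last exact: shuffle_bij.
by rewrite card_sum; case: v => w /=; rewrite ainP.
Qed.

Lemma union_aoutP v : #|[pred e | S e == v]| = sum_arity aout aout' v.
Proof.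
rewrite (card_pull (sum_map (src G) (src G') : _ -> [finS of V + V']));
  last exact: shuffle_bij.
by rewrite card_sum; case: v => w /=; rewrite aoutP.
Qed.

Definition pgraph_union :
    @pgraph [finS of V + V'] (sum_arity ain ain') (sum_arity aout aout')
      (k + k') (l + l') :=
  @PGraph _ _ _ _ _
    E I O [finS of gIO G + gIO G'] [finS of gL G + gL G']
    S T
    (@unsplit k k' \o (sum_map (alpha G) (alpha G') \o @shuffle _ _ _ _))
    (@unsplit l l' \o (sum_map (beta G) (beta G') \o @shuffle _ _ _ _))
    (relpre (@shuffle _ _ _ _) (sum_rel (rin G) (rin G')))
    (relpre (@shuffle _ _ _ _) (sum_rel (rout G) (rout G')))
    (bij_comp (@unsplit_bij k k')
      (bij_comp (sum_map_bij (alpha_bij G) (alpha_bij G')) (@shuffle_bij _ _ _ _)))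
    (bij_comp (@unsplit_bij l l')
      (bij_comp (sum_map_bij (beta_bij G) (beta_bij G')) (@shuffle_bij _ _ _ _)))
    (fibre_order_pull (bij_inj (@shuffle_bij _ _ _ _))
      (fibre_order_sum (rinP G) (rinP G')))
    (fibre_order_pull (bij_inj (@shuffle_bij _ _ _ _))
      (fibre_order_sum (routP G) (routP G')))
    union_ainP union_aoutP.

End Union.

Definition vvv (x : void + void) : void := match x with inl v | inr v => v end.

Lemma fibre_order_vvv (r : rel (void + void)) :
  fibre_order (vvv : _ -> [finS of void]) r.
Proof. by split=> -[]. Qed.

Definition no_index n (x : void + void) : 'I_n := match vvv x with end.

Lemma no_index_bij : bijective (@no_index 0).
Proof.
exists (fun i : 'I_0 => match notF (ltn_ord i) return void + void with end).
  by case=> [[]|[]].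
by case.
Qed.

Definition pgraph0 : @pgraph [finS of void] (fun=> 0%N) (fun=> 0%N) 0 0 :=
  let V := [finS of void] in
  @PGraph V _ _ 0 0 V V V V V vvv vvv (@no_index 0) (@no_index 0)
    (fun _ _ => false) (fun _ _ => false) no_index_bij no_index_bij
    (fibre_order_vvv _) (fibre_order_vvv _)
    (fun v => match v with end) (fun v => match v with end).

Lemma strand_bij : bijective (fun _ : void + unit => ord0 : 'I_1).
Proof. by exists (fun=> inr tt) => [[[]|[]]|i]; rewrite ?ord1. Qed.

Definition pgraph1 : @pgraph [finS of void] (fun=> 0%N) (fun=> 0%N) 1 1 :=
  let V := [finS of void] in
  @PGraph V _ _ 1 1 V V V [finS of unit] V vvv vvv (fun=> ord0) (fun=> ord0)
    (fun _ _ => false) (fun _ _ => false) strand_bij strand_bij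
    (fibre_order_vvv _) (fibre_order_vvv _)
    (fun v => match v with end) (fun v => match v with end).

Definition void_sum n (x : void + ordS n) : 'I_n :=
  match x with inl v => match v with end | inr a => ordI a end.
Definition sum_void n (x : ordS n + void) : 'I_n :=
  match x with inl a => ordI a | inr v => match v with end end.

Lemma sum_void_bij n : bijective (@sum_void n).
Proof.
by exists (fun i => inl (Iord i)) => [[a|[]]|i] /=; rewrite ?ordIK ?IordK.
Qed.

Lemma void_sum_inj n : injective (@void_sum n).
Proof. by move=> [[]|a] [[]|b] /= /(can_inj (@ordIK n)) ->. Qed.

Lemma corolla_order n :
  fibre_order (fun=> tt : [finS of unit]) (relpre (@void_sum n) (fun i j => i <= j)%N).
Proof.
split=> [x|x y|y x z|x y] /=; first exact: leqnn.
- by move/anti_leq/val_inj/void_sum_inj.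
- exact: leq_trans.
- by rewrite leq_total eqxx.
Qed.

Lemma corolla_arity n (v : unit) : #|[pred e : void + ordS n | tt == v]| = n.
Proof.
have void_sum_bij : bijective (@void_sum n).
  apply: inj_surj_bij (@void_sum_inj n) _ => i.
  by exists (inr (Iord i)); rewrite /= IordK.
rewrite -[RHS](card_ord n) (bij_eq_card void_sum_bij).
by apply: eq_card => e; case: v.
Qed.

Definition pgraph_corolla k l : @pgraph [finS of unit] (fun=> k) (fun=> l) k l :=
  @PGraph [finS of unit] _ _ k l [finS of void] [finS of ordS k] [finS of ordS l]
    [finS of void] [finS of void] (fun=> tt) (fun=> tt)
    (@sum_void k) (@sum_void l)
    (relpre (@void_sum k) (fun i j => i <= j)%N)
    (relpre (@void_sum l) (fun i j => i <= j)%N)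
    (@sum_void_bij k) (@sum_void_bij l) (corolla_order k) (corolla_order l)
    (@corolla_arity k) (@corolla_arity l).

Section Drop.
Variables (A : finType) (n : nat) (f : A -> 'I_n.+1) (i : 'I_n.+1).
Hypothesis fi : forall x, i != f x.

Definition drop_index (x : A) : 'I_n := drop_ord (fi x).

Lemma drop_index_bij :
  injective f -> (forall j, i != j -> exists x, f x = j) -> bijective drop_index.
Proof.
move=> fI fS; apply: inj_surj_bij => [x y /(congr1 (lift i))|j].
  by rewrite !lift_drop => /fI.
have [x fx] := fS _ (neq_lift i j); exists x.
by apply: (@lift_inj _ i); rewrite lift_drop.
Qed.

End Drop.

Section Glue.
Variables (V : finS) (ain aout : V -> nat) (k l : nat).
Variable G : pgraph ain aout k.+1 l.+1.

Local Notation E := (gE G).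
Local Notation I := (gI G).
Local Notation O := (gO G).
Local Notation IO := (gIO G).
Local Notation L := (gL G).

Definition rest (A : finS) (a : A) : finS := [finS of {x : A | x != a}].

Lemma sum_map_inj A B A' B' (f : A -> A') (g : B -> B') :
  injective f -> injective g -> injective (sum_map f g).
Proof. by move=> fI gI [] x [] y //= [] => [/fI|/gI] ->. Qed.

Lemma val_rest (A : finS) (a y : A) : y != a -> exists x : rest a, val x = y.
Proof. by move=> h; exists (exist _ y h). Qed.

(* The input a meets the output b: they are replaced by the internal edge
   None, which takes the positions of a and b. *)
Section Internal.
Variables (a : I) (b : O).

Definition internal_old A (c : A) B (f : B -> A) (x : option E + B) : E + A :=
  match x with
  | inl (Some e) => inl e
  | inl None => inr c
  | inr y => inr (f y)
  end.

Lemma internal_old_bij (A : finS) (c : A) :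
  bijective (internal_old c (val : rest c -> A)).
Proof.
apply: inj_surj_bij => [[[e|]|x] [[e'|]|y] //=|[e|y]].
- by case=> ->.
- by case=> h; case/eqP: (valP y).
- by case=> h; case/eqP: (valP x).
- by case=> /val_inj ->.
- by exists (inl (Some e)).
- have [->|/val_rest [x <-]] := eqVneq y c; [by exists (inl None) | by exists (inr x)].
Qed.

Definition internal_alpha (x : rest a + IO) := alpha G (sum_map val id x).
Definition internal_beta (x : rest b + IO) := beta G (sum_map val id x).

Lemma internal_alpha_ne x : alpha G (inl a) != internal_alpha x.
Proof.
apply/eqP => /(bij_inj (alpha_bij G)); case: x => //= x [] h.
by case/eqP: (valP x).
Qed.

Lemma internal_beta_ne x : beta G (inl b) != internal_beta x.
Proof.
apply/eqP => /(bij_inj (beta_bij G)); case: x => //= x [] h.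
by case/eqP: (valP x).
Qed.

Lemma internal_alpha_bij : bijective (drop_index internal_alpha_ne).
Proof.
apply: drop_index_bij => [|j].
  by apply: inj_comp (bij_inj (alpha_bij G)) (sum_map_inj val_inj _).
have [x <-] := bij_surj (alpha_bij G) j; case: x => x h; last by exists (inr x).
have /val_rest [y <-] : x != a by apply: contra h => /eqP ->.
by exists (inl y).
Qed.

Lemma internal_beta_bij : bijective (drop_index internal_beta_ne).
Proof.
apply: drop_index_bij => [|j].
  by apply: inj_comp (bij_inj (beta_bij G)) (sum_map_inj val_inj _).
have [x <-] := bij_surj (beta_bij G) j; case: x => x h; last by exists (inr x).
have /val_rest [y <-] : x != b by apply: contra h => /eqP ->.
by exists (inl y).
Qed.

Definition glue_internal : pgraph ain aout k l :=
  @rewire V ain aout _ _ k l G [finS of option E] (rest a) (rest b) IO L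
    _ _ _ _ (internal_old_bij a) (internal_old_bij b)
    internal_alpha_bij internal_beta_bij.

End Internal.

(* The input-output edge a meets f, which is an output, another input-output
   edge or a itself: a disappears, f takes over the output index of a, and
   there is a new loop if f is a. *)
Section FromIO.
Variables (a : IO) (f : O + IO).

Definition io_alpha (x : I + rest a) := alpha G (sum_map id val x).
Definition io_beta (x : O + rest a) :=
  let y := sum_map id val x in
  if y == f then beta G (inr a) else beta G y.

Lemma io_alpha_ne x : alpha G (inr a) != io_alpha x.
Proof.
apply/eqP => /(bij_inj (alpha_bij G)); case: x => //= x [] h.
by case/eqP: (valP x).
Qed.

Lemma io_sum_ne (x : O + rest a) : sum_map id val x != inr a.
Proof. by apply/eqP; case: x => //= x [] h; case/eqP: (valP x). Qed.

Lemma io_beta_ne x : beta G f != io_beta x.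
Proof.
rewrite /io_beta; case: (_ =P f) => [<-|h]; apply/eqP => /(bij_inj (beta_bij G)).
  by move/eqP; rewrite (negPf (io_sum_ne x)).
by move=> /esym.
Qed.

Lemma io_alpha_bij : bijective (drop_index io_alpha_ne).
Proof.
apply: drop_index_bij => [|j].
  by apply: inj_comp (bij_inj (alpha_bij G)) (sum_map_inj _ val_inj).
have [x <-] := bij_surj (alpha_bij G) j; case: x => x h; first by exists (inl x).
have /val_rest [y <-] : x != a by apply: contra h => /eqP ->.
by exists (inr y).
Qed.

Lemma io_surj (y : O + IO) : y != inr a -> exists x : O + rest a, sum_map id val x = y.
Proof.
case: y => [y _|y h]; first by exists (inl y).
have /val_rest [x <-] : y != a by apply: contra h => /eqP ->.
by exists (inr x).
Qed.

Lemma io_beta_bij : bijective (drop_index io_beta_ne).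
Proof.
apply: drop_index_bij => [x y|j].
  rewrite /io_beta; have smI := @sum_map_inj O (rest a) O IO id val (fun _ _ h => h) val_inj.
  case: eqP => [hx|_]; case: eqP => [hy|_] /(bij_inj (beta_bij G)).
  - by move=> _; apply: smI; rewrite hx hy.
  - by move/esym/eqP; rewrite (negPf (io_sum_ne y)).
  - by move/eqP; rewrite (negPf (io_sum_ne x)).
  - exact: smI.
have [y <-] := bij_surj (beta_bij G) j => h.
have yf : y != f by apply: contra h => /eqP ->.
have [ya|/io_surj [x xy]] := eqVneq y (inr a); last first.
  by exists x; rewrite /io_beta xy (negPf yf).
have /io_surj [x xf] : f != inr a by rewrite -ya eq_sym.
by exists x; rewrite /io_beta xf eqxx ya.
Qed.

Definition glue_io : pgraph ain aout k l :=
  @rewire V ain aout _ _ k l G E I O (rest a)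
    (if f == inr a then [finS of option L] else L)
    id id _ _ (bij_id _) (bij_id _) io_alpha_bij io_beta_bij.

End FromIO.

(* The input a meets the input-output edge b: b disappears and a takes over
   the input index of b. *)
Section ToIO.
Variables (a : I) (b : IO).

Definition oi_alpha (x : I + rest b) :=
  let y := sum_map id val x in
  if y == inl a then alpha G (inr b) else alpha G y.
Definition oi_beta (x : O + rest b) := beta G (sum_map id val x).

Lemma oi_sum_ne (x : I + rest b) : sum_map id val x != inr b.
Proof. by apply/eqP; case: x => //= x [] h; case/eqP: (valP x). Qed.

Lemma oi_alpha_ne x : alpha G (inl a) != oi_alpha x.
Proof.
rewrite /oi_alpha; case: (_ =P inl a) => h; apply/eqP => /(bij_inj (alpha_bij G)) //.
by move/esym.
Qed.

Lemma oi_beta_ne x : beta G (inr b) != oi_beta x.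
Proof.
apply/eqP => /(bij_inj (beta_bij G)); case: x => //= x [] h.
by case/eqP: (valP x).
Qed.

Lemma oi_alpha_bij : bijective (drop_index oi_alpha_ne).
Proof.
apply: drop_index_bij => [x y|j].
  rewrite /oi_alpha; have smI := @sum_map_inj I (rest b) I IO id val (fun _ _ h => h) val_inj.
  case: eqP => [hx|_]; case: eqP => [hy|_] /(bij_inj (alpha_bij G)).
  - by move=> _; apply: smI; rewrite hx hy.
  - by move/esym/eqP; rewrite (negPf (oi_sum_ne y)).
  - by move/eqP; rewrite (negPf (oi_sum_ne x)).
  - exact: smI.
have [y <-] := bij_surj (alpha_bij G) j; case: y => y h.
  exists (inl y); rewrite /oi_alpha /=; case: eqP => // e.
  by move: h; rewrite e eqxx.
have [->|/val_rest [x <-]] := eqVneq y b; last by exists (inr x).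
by exists (inl a); rewrite /oi_alpha eqxx.
Qed.

Lemma oi_beta_bij : bijective (drop_index oi_beta_ne).
Proof.
apply: drop_index_bij => [|j].
  by apply: inj_comp (bij_inj (beta_bij G)) (sum_map_inj _ val_inj).
have [x <-] := bij_surj (beta_bij G) j; case: x => x h; first by exists (inl x).
have /val_rest [y <-] : x != b by apply: contra h => /eqP ->.
by exists (inr y).
Qed.

Definition glue_oi : pgraph ain aout k l :=
  @rewire V ain aout _ _ k l G E I O (rest b) L
    id id _ _ (bij_id _) (bij_id _) oi_alpha_bij oi_beta_bij.

End ToIO.

Definition glue (e : I + IO) (f : O + IO) : pgraph ain aout k l :=
  match e, f with
  | inl a, inl b => glue_internal a b
  | inl a, inr b => glue_oi a b
  | inr a, _ => glue_io a f
  end.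

Definition pgraph_tr (i : 'I_k.+1) (j : 'I_l.+1) : pgraph ain aout k l :=
  glue (bij_inv (alpha_bij G) i) (bij_inv (beta_bij G) j).

End Glue.

Record dgraph (K : fieldType) (X : ssdata K) (k l : nat) : Type := DGraph {
  gV : finS;
  gin : gV -> nat;
  gout : gV -> nat;
  dec : forall v, X (gin v) (gout v);
  gr :> pgraph gin gout k l
}.
Arguments gV {K X k l} d.
Arguments gin {K X k l} d v.
Arguments gout {K X k l} d v.
Arguments dec {K X k l} d v.

Section Decorated.
Variables (K : fieldType) (X : ssdata K).

HB.instance Definition _ k l := gen_eqMixin (dgraph X k l).
HB.instance Definition _ k l := gen_choiceMixin (dgraph X k l).

(* The decoration of a vertex together with its arities. *)
Definition decv k l (D : dgraph X k l) (v : gV D) :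
    {n : nat * nat & X n.1 n.2} :=
  existT (fun n : nat * nat => X n.1 n.2 : Type) (gin D v, gout D v) (dec D v).

Record diso k l (D D' : dgraph X k l) : Type := DIso {
  fV : gV D -> gV D';
  fE : gE D -> gE D';
  fI : gI D -> gI D';
  fO : gO D -> gO D';
  fIO : gIO D -> gIO D';
  fL : gL D -> gL D';
  fV_bij : bijective fV;
  fE_bij : bijective fE;
  fI_bij : bijective fI;
  fO_bij : bijective fO;
  fIO_bij : bijective fIO;
  fL_bij : bijective fL;
  diso_src : forall e, src D' (sum_map fE fO e) = fV (src D e);
  diso_tgt : forall e, tgt D' (sum_map fE fI e) = fV (tgt D e);
  diso_alpha : forall e, alpha D' (sum_map fI fIO e) = alpha D e;
  diso_beta : forall e, beta D' (sum_map fO fIO e) = beta D e;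
  diso_rin : forall e e', rin D' (sum_map fE fI e) (sum_map fE fI e') = rin D e e';
  diso_rout : forall e e', rout D' (sum_map fE fO e) (sum_map fE fO e') = rout D e e';
  diso_dec : forall v, decv (fV v) = decv v
}.

(* D with the decoration of v replaced by x. *)
Definition redec k l (D : dgraph X k l) (v : gV D) (x : X (gin D v) (gout D v)) :
    dgraph X k l :=
  DGraph (dfwith (dec D) x) (gr D).

(* The relations turning formal combinations of decorated graphs into
   elements of the sum, over isoclasses of planar graphs, of the tensor
   products of the X(i(v), o(v)) over the vertices: isomorphic decorated
   graphs are equal and decorated graphs are multilinear in the decorations. *)
Inductive pgr_rel k l : {freeg (dgraph X k l) / K} -> Prop :=
| pgr_rel0 : pgr_rel 0
| pgr_rel_lin a u w : pgr_rel u -> pgr_rel w -> pgr_rel (a *: u + w)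
| pgr_rel_iso D D' : diso D D' -> pgr_rel (<< D >> - << D' >>)
| pgr_rel_multi D v a (x y : X (gin D v) (gout D v)) :
    pgr_rel (<< redec (a *: x + y) >> - (a *: << redec x >> + << redec y >>)).

Definition pgr_ideal k l : {pred {freeg (dgraph X k l) / K}} :=
  fun u => `[< pgr_rel u >].

Lemma pgr_ideal_submod k l : submod_closed (@pgr_ideal k l).
Proof.
split=> [|a u w /asboolP ru /asboolP rw]; apply/asboolP; first exact: pgr_rel0.
exact: pgr_rel_lin.
Qed.

Lemma pgr_ideal_zmod k l : zmod_closed (@pgr_ideal k l).
Proof.
have [r0 rl] := @pgr_ideal_submod k l; split=> // u w hu hw.
by rewrite -scaleN1r addrC; apply: rl.
Qed.

Lemma pgr_idealZ k l a u : u \in @pgr_ideal k l -> a *: u \in @pgr_ideal k l.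
Proof.
have [r0 rl] := @pgr_ideal_submod k l; move=> h.
by rewrite -[a *: u]addr0; apply: rl.
Qed.

HB.instance Definition _ k l := GRing.isZmodClosed.Build
  {freeg (dgraph X k l) / K} (@pgr_ideal k l) (@pgr_ideal_zmod k l).

Section Quot.
Variables k l : nat.

Definition pgr : Type := Quotient.quot (@pgr_ideal k l).
HB.instance Definition _ := GRing.Zmodule.on pgr.

Definition pgr_repr (x : pgr) : {freeg (dgraph X k l) / K} := generic_quotient.repr x.
Definition pgr_pi (u : {freeg (dgraph X k l) / K}) : pgr :=
  (\pi_(Quotient.quot (@pgr_ideal k l)) u)%qT.

Lemma pgr_reprK x : pgr_pi (pgr_repr x) = x.
Proof. exact: reprK. Qed.

Lemma pgr_pi_eq u w : pgr_pi u = pgr_pi w <-> pgr_rel (u - w).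
Proof.
have := Quotient.idealrBE (@pgr_ideal k l) u w => h.
by split=> [/eqP|/asboolP rh]; [rewrite -h => /asboolP | apply/eqP; rewrite -h].
Qed.

Lemma pgr_pi_zmod : zmod_morphism pgr_pi.
Proof. by move=> u w; rewrite /pgr_pi; rewrite [LHS]raddfB. Qed.
HB.instance Definition _ := GRing.isZmodMorphism.Build _ _ pgr_pi pgr_pi_zmod.

Definition pgr_scale (a : K) (x : pgr) : pgr := pgr_pi (a *: pgr_repr x).

Lemma pgr_piZ a u : pgr_pi (a *: u) = pgr_scale a (pgr_pi u).
Proof.
apply/pgr_pi_eq; rewrite -scalerBr; apply/asboolP; apply: pgr_idealZ.
by apply/asboolP/pgr_pi_eq; rewrite pgr_reprK.
Qed.

Lemma pgr_scaleA a b x : pgr_scale a (pgr_scale b x) = pgr_scale (a * b) x.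
Proof. by rewrite -(pgr_reprK x) -!pgr_piZ scalerA. Qed.
Lemma pgr_scale1 : left_id 1 pgr_scale.
Proof. by move=> x; rewrite -(pgr_reprK x) -pgr_piZ scale1r. Qed.
Lemma pgr_scaleDr : right_distributive pgr_scale +%R.
Proof.
move=> a x y; rewrite -(pgr_reprK x) -(pgr_reprK y) -raddfD -!pgr_piZ.
by rewrite scalerDr raddfD.
Qed.
Lemma pgr_scaleDl x : {morph pgr_scale^~ x : a b / a + b}.
Proof. by move=> a b; rewrite -(pgr_reprK x) -!pgr_piZ scalerDl raddfD. Qed.

HB.instance Definition _ := GRing.Zmodule_isLmodule.Build K pgr
  pgr_scaleA pgr_scale1 pgr_scaleDr pgr_scaleDl.

(* The class of a decorated graph. *)
Definition pgr_cl (D : dgraph X k l) : pgr := pgr_pi << D >>.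

(* The linear extension of f to pgr, provided f is compatible with the
   relations: see pgr_extE and pgr_ext_linear. *)
Definition pgr_ext (W : lmodType K) (f : dgraph X k l -> W) (x : pgr) : W :=
  fglift f (pgr_repr x).

Definition pgr_compatible (W : lmodType K) (f : dgraph X k l -> W) : Prop :=
  (forall D D', diso D D' -> f D = f D') /\
  (forall D v a (x y : X (gin D v) (gout D v)),
     f (redec (a *: x + y)) = a *: f (redec x) + f (redec y)).

Section Ext.
Variables (W : lmodType K) (f : dgraph X k l -> W).

HB.instance Definition _ := GRing.isZmodMorphism.Build _ _ (fglift f)
  (@lift_is_additive _ _ W f).

Lemma fgliftZ a u : fglift f (a *: u) = a *: fglift f u.
Proof.
rewrite -[in RHS](freeg_sumE u) [a *: u]/(fgscale a u) /fgscale !raddf_sum /=.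
by apply: eq_bigr => x _; rewrite !liftU scalerA.
Qed.

Hypothesis fc : pgr_compatible f.

Lemma fglift_rel u : pgr_rel u -> fglift f u = 0.
Proof.
case: fc => fiso flin; elim=> {u}.
- by rewrite raddf0.
- by move=> a u w _ hu _ hw; rewrite raddfD /= fgliftZ hu hw scaler0 addr0.
- by move=> D D' /fiso e; rewrite raddfB /= !liftU e subrr.
- move=> D v a x y.
  by rewrite raddfB raddfD /= fgliftZ !liftU !scale1r flin subrr.
Qed.

Lemma pgr_ext_pi u : pgr_ext f (pgr_pi u) = fglift f u.
Proof.
apply/eqP; rewrite -subr_eq0 -raddfB; apply/eqP/fglift_rel/pgr_pi_eq.
exact: pgr_reprK.
Qed.

Lemma pgr_ext_linear : linear (pgr_ext f).
Proof.
move=> a x y; rewrite -(pgr_reprK x) -(pgr_reprK y) -[a *: _]pgr_piZ -raddfD.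
by rewrite !pgr_ext_pi raddfD /= fgliftZ.
Qed.

Lemma pgr_extE D : pgr_ext f (pgr_cl D) = f D.
Proof. by rewrite pgr_ext_pi liftU scale1r. Qed.

End Ext.

End Quot.

Lemma pgr_cl_iso k l (D D' : dgraph X k l) : diso D D' -> pgr_cl D = pgr_cl D'.
Proof. by move=> i; apply/pgr_pi_eq; apply: pgr_rel_iso. Qed.

Lemma pgr_cl_multi k l (D : dgraph X k l) v a (x y : X (gin D v) (gout D v)) :
  pgr_cl (redec (a *: x + y)) = a *: pgr_cl (redec x) + pgr_cl (redec y).
Proof.
rewrite -[a *: pgr_cl _]pgr_piZ -raddfD; apply/pgr_pi_eq.
exact: pgr_rel_multi.
Qed.

End Decorated.

Section Operations.
Variables (K : fieldType) (X : ssdata K).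

Definition dgraph_actl k l (s : 'S_l) (D : dgraph X k l) : dgraph X k l :=
  DGraph (dec D) (pgraph_actl s D).

Definition dgraph_actr k l (D : dgraph X k l) (t : 'S_k) : dgraph X k l :=
  DGraph (dec D) (pgraph_actr D t).

Definition dgraph_tr k l (i : 'I_k.+1) (j : 'I_l.+1) (D : dgraph X k.+1 l.+1) :
    dgraph X k l :=
  DGraph (dec D) (pgraph_tr D i j).

Definition sum_dec k l k' l' (D : dgraph X k l) (D' : dgraph X k' l')
    (v : gV D + gV D') :
    X (sum_arity (gin D) (gin D') v) (sum_arity (gout D) (gout D') v) :=
  match v with inl w => dec D w | inr w => dec D' w end.

Definition dgraph_union k l k' l' (D : dgraph X k l) (D' : dgraph X k' l') :
    dgraph X (k + k') (l + l') :=
  @DGraph K X _ _ [finS of gV D + gV D'] _ _ (@sum_dec _ _ _ _ D D')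
    (pgraph_union D D').

Definition no_dec (v : void) : X 0 0 := match v with end.

Definition dgraph0 : dgraph X 0 0 := DGraph (no_dec : forall v : [finS of void], _) pgraph0.

Definition dgraph1 : dgraph X 1 1 := DGraph (no_dec : forall v : [finS of void], _) pgraph1.

Definition dgraph_corolla k l (x : X k l) : dgraph X k l :=
  @DGraph K X k l [finS of unit] (fun=> k) (fun=> l) (fun=> x) (pgraph_corolla k l).

Section RewireIso.
Variables (k l k' l' : nat) (D D' : dgraph X k l) (i : diso D D').
Variables (E I O IO L E' I' O' IO' L' : finS).
Variables (hT : E + I -> gE D + gI D) (hS : E + O -> gE D + gO D).
Variables (a : I + IO -> 'I_k') (b : O + IO -> 'I_l').
Variables (hTb : bijective hT) (hSb : bijective hS).
Variables (ab : bijective a) (bb : bijective b).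
Variables (hT' : E' + I' -> gE D' + gI D') (hS' : E' + O' -> gE D' + gO D').
Variables (a' : I' + IO' -> 'I_k') (b' : O' + IO' -> 'I_l').
Variables (hTb' : bijective hT') (hSb' : bijective hS').
Variables (ab' : bijective a') (bb' : bijective b').
Variables (pE : E -> E') (pI : I -> I') (pO : O -> O') (pIO : IO -> IO') (pL : L -> L').
Hypotheses (pEb : bijective pE) (pIb : bijective pI) (pOb : bijective pO).
Hypotheses (pIOb : bijective pIO) (pLb : bijective pL).
Hypothesis hTE : forall e, hT' (sum_map pE pI e) = sum_map (fE i) (fI i) (hT e).
Hypothesis hSE : forall e, hS' (sum_map pE pO e) = sum_map (fE i) (fO i) (hS e).
Hypothesis aE : forall e, a' (sum_map pI pIO e) = a e.
Hypothesis bE : forall e, b' (sum_map pO pIO e) = b e.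

Definition rewire_iso :
  diso (DGraph (dec D) (rewire L hTb hSb ab bb))
       (DGraph (dec D') (rewire L' hTb' hSb' ab' bb')).
Proof.
apply: (@DIso _ _ _ _ (DGraph _ (rewire _ _ _ _ _)) (DGraph _ (rewire _ _ _ _ _))
         (fV i) pE pI pO pIO pL (fV_bij i)) => //= [e|e|e e'|e e'|v].
- by rewrite hSE diso_src.
- by rewrite hTE diso_tgt.
- by rewrite !hTE diso_rin.
- by rewrite !hSE diso_rout.
- exact: (diso_dec i v).
Qed.
End RewireIso.

Definition actl_iso k l (s : 'S_l) (D D' : dgraph X k l) :
  diso D D' -> diso (dgraph_actl s D) (dgraph_actl s D').
Proof.
move=> i; apply: (rewire_iso (i := i) _ _ _ _ _ _ _ _
      (pE := (fE i))
      (pI := (fI i))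
      (pO := (fO i))
      (pIO := (fIO i))
      (pL := (fL i))) => //=.
- exact: fE_bij.
- exact: fI_bij.
- exact: fO_bij.
- exact: fIO_bij.
- exact: fL_bij.
- exact: diso_alpha.
- by move=> e; rewrite diso_beta.
Qed.

Definition actr_iso k l (t : 'S_k) (D D' : dgraph X k l) :
  diso D D' -> diso (dgraph_actr D t) (dgraph_actr D' t).
Proof.
move=> i; apply: (rewire_iso (i := i) _ _ _ _ _ _ _ _
      (pE := (fE i))
      (pI := (fI i))
      (pO := (fO i))
      (pIO := (fIO i))
      (pL := (fL i))) => //=.
- exact: fE_bij.
- exact: fI_bij.
- exact: fO_bij.
- exact: fIO_bij.
- exact: fL_bij.
- by move=> e; rewrite diso_alpha.
- exact: diso_beta.
Qed.

Lemma drop_ord_congr n (i i' j j' : 'I_n.+1) (h : i != j) (h' : i' != j') :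
  i = i' -> j = j' -> drop_ord h = drop_ord h'.
Proof. by move=> e e'; move: h h'; rewrite e e' => h h'; exact: drop_irr. Qed.

Section RestMap.
Variables (A A' : finS) (f : A -> A') (fb : bijective f) (a : A).

Definition rest_map (x : rest a) : rest (f a) :=
  exist _ (f (val x)) (etrans (congr1 negb (inj_eq (bij_inj fb) (val x) a)) (valP x)).

Lemma rest_map_bij : bijective rest_map.
Proof.
apply: inj_surj_bij => [x y /(congr1 val) /(bij_inj fb) /val_inj //|y].
have [z fz] := bij_surj fb (val y).
have /val_rest [x xz] : z != a.
  by apply/eqP => e; case/eqP: (valP y); rewrite -fz e.
by exists x; apply: val_inj; rewrite /= -fz -xz.
Qed.
End RestMap.

Lemma option_map_bij A B (f : A -> B) : bijective f -> bijective (option_map f).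
Proof.
by case=> g fK gK; exists (option_map g) => -[x|] //=; rewrite ?fK ?gK.
Qed.

Definition if_map (A A' : finS) (c c' : bool) (f : A -> A') (fb : bijective f) :
  c = c' -> {g : (if c then [finS of option A] else A) ->
                (if c' then [finS of option A'] else A') | bijective g}.
Proof.
move=> <-; case: c; last by exists f.
by exists (option_map f); exact: option_map_bij.
Qed.

Definition dgraph_glue k l (D : dgraph X k.+1 l.+1) e f : dgraph X k l :=
  DGraph (dec D) (glue (G := D) e f).

Definition glue_iso k l (D D' : dgraph X k.+1 l.+1) (i : diso D D') e f :
  diso (@dgraph_glue _ _ D e f)
       (@dgraph_glue _ _ D' (sum_map (fI i) (fIO i) e) (sum_map (fO i) (fIO i) f)).
Proof.
rewrite /dgraph_glue; case: e => a.
  case: f => b /=.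
    apply: (rewire_iso (i := i) (E := [finS of option (gE D)])
      (E' := [finS of option (gE D')]) _ _ _ _ _ _ _ _
      (pE := (option_map (fE i)))
      (pI := (rest_map (fI_bij i) (a := a)))
      (pO := (rest_map (fO_bij i) (a := b)))
      (pIO := (fIO i))
      (pL := (fL i))).
    - exact/option_map_bij/fE_bij.
    - exact: rest_map_bij.
    - exact: rest_map_bij.
    - exact: fIO_bij.
    - exact: fL_bij.
    - by move=> [[e|]|e].
    - by move=> [[e|]|e].
    - move=> e; apply: drop_ord_congr; first exact: (diso_alpha i (inl a)).
      by case: e => e; [exact: (diso_alpha i (inl (val e))) | exact: (diso_alpha i (inr e))].
    - move=> e; apply: drop_ord_congr; first exact: (diso_beta i (inl b)).
      by case: e => e; [exact: (diso_beta i (inl (val e))) | exact: (diso_beta i (inr e))].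
  apply: (rewire_iso (i := i) _ _ _ _ _ _ _ _
      (pE := (fE i))
      (pI := (fI i))
      (pO := (fO i))
      (pIO := (rest_map (fIO_bij i) (a := b)))
      (pL := (fL i))).
  - exact: fE_bij.
  - exact: fI_bij.
  - exact: fO_bij.
  - exact: rest_map_bij.
  - exact: fL_bij.
  - by [].
  - by [].
  - move=> e; apply: drop_ord_congr; first exact: (diso_alpha i (inl a)).
    rewrite /oi_alpha /= -!(diso_alpha i).
    have -> : sum_map id val (sum_map (fI i) (rest_map (fIO_bij i) (a := b)) e) =
              sum_map (fI i) (fIO i) (sum_map id val e) by case: e.
    have smb := sum_map_bij (fI_bij i) (fIO_bij i).
    rewrite -[inl (fI i a)]/(sum_map (fI i) (fIO i) (inl a)) (inj_eq (bij_inj smb)).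
    by case: ifP.
  - move=> e; apply: drop_ord_congr; first exact: (diso_beta i (inr b)).
    by case: e => e; [exact: (diso_beta i (inl e)) | exact: (diso_beta i (inr (val e)))].
have smb := sum_map_bij (fO_bij i) (fIO_bij i); rewrite /=.
have fEq : (f == inr a) = (sum_map (fO i) (fIO i) f == inr (fIO i a)).
  by rewrite -[inr (fIO i a)]/(sum_map (fO i) (fIO i) (inr a)) (inj_eq (bij_inj smb)).
have [fL' fLb'] := if_map (fL_bij i) fEq.
apply: (rewire_iso (i := i) _ _ _ _ _ _ _ _
      (pE := (fE i))
      (pI := (fI i))
      (pO := (fO i))
      (pIO := (rest_map (fIO_bij i) (a := a)))
      (pL := fL')) => //.
- exact: fE_bij.
- exact: fI_bij.
- exact: fO_bij.
- exact: rest_map_bij.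
- move=> e; apply: drop_ord_congr; first exact: (diso_alpha i (inr a)).
  by case: e => e; [exact: (diso_alpha i (inl e)) | exact: (diso_alpha i (inr (val e)))].
- move=> e; apply: drop_ord_congr; first exact: (diso_beta i f).
  rewrite /io_beta /= -!(diso_beta i).
  have -> : sum_map id val (sum_map (fO i) (rest_map (fIO_bij i) (a := a)) e) =
            sum_map (fO i) (fIO i) (sum_map id val e) by case: e.
  by rewrite (inj_eq (bij_inj smb)); case: ifP.
Qed.

Lemma bij_inv_iso (A A' : finType) (B : eqType) (f : A -> B) (f' : A' -> B)
    (h : A -> A') (fb : bijective f) (fb' : bijective f') :
  (forall x, f' (h x) = f x) -> forall y, bij_inv fb' y = h (bij_inv fb y).
Proof.
by move=> hE y; apply: (bij_inj fb'); rewrite hE !bij_invK.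
Qed.

Definition tr_iso k l i j (D D' : dgraph X k.+1 l.+1) :
  diso D D' -> diso (dgraph_tr i j D) (dgraph_tr i j D').
Proof.
move=> f; rewrite /dgraph_tr /pgraph_tr.
rewrite (bij_inv_iso (alpha_bij D) (alpha_bij D') (diso_alpha f)).
rewrite (bij_inv_iso (beta_bij D) (beta_bij D') (diso_beta f)).
exact: glue_iso.
Qed.

Definition union_iso k l k' l' (D1 D2 : dgraph X k l) (D1' D2' : dgraph X k' l') :
  diso D1 D2 -> diso D1' D2' -> diso (dgraph_union D1 D1') (dgraph_union D2 D2').
Proof.
move=> i i'.
apply: (@DIso _ _ _ _ (dgraph_union D1 D1') (dgraph_union D2 D2')
  (sum_map (fV i) (fV i')) (sum_map (fE i) (fE i')) (sum_map (fI i) (fI i'))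
  (sum_map (fO i) (fO i')) (sum_map (fIO i) (fIO i')) (sum_map (fL i) (fL i'))).
- by apply: sum_map_bij; exact: fV_bij.
- by apply: sum_map_bij; exact: fE_bij.
- by apply: sum_map_bij; exact: fI_bij.
- by apply: sum_map_bij; exact: fO_bij.
- by apply: sum_map_bij; exact: fIO_bij.
- by apply: sum_map_bij; exact: fL_bij.
- by move=> [[]e|[]e] /=; [rewrite -(diso_src i (inl e)) | rewrite -(diso_src i' (inl e))
                           | rewrite -(diso_src i (inr e)) | rewrite -(diso_src i' (inr e))].
- by move=> [[]e|[]e] /=; [rewrite -(diso_tgt i (inl e)) | rewrite -(diso_tgt i' (inl e))
                           | rewrite -(diso_tgt i (inr e)) | rewrite -(diso_tgt i' (inr e))].
- by move=> [[]e|[]e] /=; [rewrite -(diso_alpha i (inl e)) | rewrite -(diso_alpha i' (inl e))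
                           | rewrite -(diso_alpha i (inr e)) | rewrite -(diso_alpha i' (inr e))].
- by move=> [[]e|[]e] /=; [rewrite -(diso_beta i (inl e)) | rewrite -(diso_beta i' (inl e))
                           | rewrite -(diso_beta i (inr e)) | rewrite -(diso_beta i' (inr e))].
- by move=> [[]e|[]e] [[]e'|[]e'] //=;
    [exact: (diso_rin i (inl e) (inl e')) | exact: (diso_rin i (inl e) (inr e'))
    | exact: (diso_rin i' (inl e) (inl e')) | exact: (diso_rin i' (inl e) (inr e'))
    | exact: (diso_rin i (inr e) (inl e')) | exact: (diso_rin i (inr e) (inr e'))
    | exact: (diso_rin i' (inr e) (inl e')) | exact: (diso_rin i' (inr e) (inr e'))].
- by move=> [[]e|[]e] [[]e'|[]e'] //=;
    [exact: (diso_rout i (inl e) (inl e')) | exact: (diso_rout i (inl e) (inr e'))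
    | exact: (diso_rout i' (inl e) (inl e')) | exact: (diso_rout i' (inl e) (inr e'))
    | exact: (diso_rout i (inr e) (inl e')) | exact: (diso_rout i (inr e) (inr e'))
    | exact: (diso_rout i' (inr e) (inl e')) | exact: (diso_rout i' (inr e) (inr e'))].
- move=> [v|v]; [have := diso_dec i v | have := diso_dec i' v]; done.
Qed.

Lemma union_redecl k l k' l' (D : dgraph X k l) (D' : dgraph X k' l') v x :
  dgraph_union (redec (D := D) (v := v) x) D' =
  redec (D := dgraph_union D D') (v := inl v) x.
Proof.
congr (@DGraph K X _ _ [finS of gV D + gV D']); apply: functional_extensionality_dep.
move=> [w|w] /=; last by rewrite dfwith_out.
have [<-|vw] := eqVneq v w; first by rewrite !dfwith_in.
by rewrite !dfwith_out.
Qed.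

Lemma union_redecr k l k' l' (D : dgraph X k l) (D' : dgraph X k' l') v x :
  dgraph_union D (redec (D := D') (v := v) x) =
  redec (D := dgraph_union D D') (v := inr v) x.
Proof.
congr (@DGraph K X _ _ [finS of gV D + gV D']); apply: functional_extensionality_dep.
move=> [w|w] /=; first by rewrite dfwith_out.
have [<-|vw] := eqVneq v w; first by rewrite !dfwith_in.
by rewrite !dfwith_out.
Qed.

Definition diso_refl k l (D : dgraph X k l) : diso D D.
Proof.
by apply: (@DIso _ _ _ _ D D id id id id id id);
  first [exact: bij_id | by [] | by case | by move=> [e|e] [e'|e']].
Qed.

End Operations.

Section PGr.
Variables (K : fieldType) (X : ssdata K).

Definition pgr_actl k l (s : 'S_l) : pgr X k l -> pgr X k l :=
  pgr_ext (fun D => pgr_cl (dgraph_actl s D)).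

Definition pgr_actr k l (x : pgr X k l) (t : 'S_k) : pgr X k l :=
  pgr_ext (fun D => pgr_cl (dgraph_actr D t)) x.

Definition pgr_hcat k l k' l' (x : pgr X k l) (x' : pgr X k' l') :
    pgr X (k + k') (l + l') :=
  pgr_ext (fun D => pgr_ext (fun D' => pgr_cl (dgraph_union D D')) x') x.

Definition pgr_tr k l (i : 'I_k.+1) (j : 'I_l.+1) : pgr X k.+1 l.+1 -> pgr X k l :=
  pgr_ext (fun D => pgr_cl (dgraph_tr i j D)).

Lemma actl_compatible k l (s : 'S_l) :
  pgr_compatible (fun D : dgraph X k l => pgr_cl (dgraph_actl s D)).
Proof.
split=> [D D' /actl_iso i|D v a x y]; first exact/pgr_cl_iso/i.
exact: (pgr_cl_multi (D := dgraph_actl s D)).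
Qed.

Lemma actr_compatible k l (t : 'S_k) :
  pgr_compatible (fun D : dgraph X k l => pgr_cl (dgraph_actr D t)).
Proof.
split=> [D D' /actr_iso i|D v a x y]; first exact/pgr_cl_iso/i.
exact: (pgr_cl_multi (D := dgraph_actr D t)).
Qed.

Lemma tr_compatible k l (i : 'I_k.+1) (j : 'I_l.+1) :
  pgr_compatible (fun D : dgraph X k.+1 l.+1 => pgr_cl (dgraph_tr i j D)).
Proof.
split=> [D D' /tr_iso f|D v a x y]; first exact/pgr_cl_iso/f.
exact: (pgr_cl_multi (D := dgraph_tr i j D)).
Qed.

Lemma unionr_compatible k l k' l' (D : dgraph X k l) :
  pgr_compatible (fun D' : dgraph X k' l' => pgr_cl (dgraph_union D D')).
Proof.
split=> [D1 D2 i|D' v a x y]; first exact/pgr_cl_iso/union_iso/i/diso_refl.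
by rewrite !union_redecr; exact: (pgr_cl_multi (D := dgraph_union D D')).
Qed.

Lemma unionl_compatible k l k' l' (x' : pgr X k' l') :
  pgr_compatible (fun D : dgraph X k l =>
    pgr_ext (fun D' => pgr_cl (dgraph_union D D')) x').
Proof.
split=> [D1 D2 i|D v a x y].
  congr pgr_ext; apply: functional_extensionality_dep => D'.
  by apply/pgr_cl_iso/union_iso => //; exact: diso_refl.
rewrite -(pgr_reprK x'); set u := pgr_repr x'.
rewrite !pgr_ext_pi; do ?exact: unionr_compatible.
rewrite -(freeg_sumE u) !raddf_sum /= -big_split /=.
apply: eq_bigr => D' _; rewrite !liftU !union_redecl.
rewrite (pgr_cl_multi (D := dgraph_union D D')).
by rewrite scalerDr !scalerA mulrC.
Qed.

Lemma pgr_actlE k l (s : 'S_l) (D : dgraph X k l) :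
  pgr_actl s (pgr_cl D) = pgr_cl (dgraph_actl s D).
Proof. by rewrite /pgr_actl (pgr_extE (@actl_compatible k l s)). Qed.

Lemma pgr_actrE k l (t : 'S_k) (D : dgraph X k l) :
  pgr_actr (pgr_cl D) t = pgr_cl (dgraph_actr D t).
Proof. by rewrite /pgr_actr (pgr_extE (@actr_compatible k l t)). Qed.

Lemma pgr_trE k l (i : 'I_k.+1) (j : 'I_l.+1) (D : dgraph X k.+1 l.+1) :
  pgr_tr i j (pgr_cl D) = pgr_cl (dgraph_tr i j D).
Proof. by rewrite /pgr_tr (pgr_extE (@tr_compatible k l i j)). Qed.

Lemma pgr_hcatE k l k' l' (D : dgraph X k l) (D' : dgraph X k' l') :
  pgr_hcat (pgr_cl D) (pgr_cl D') = pgr_cl (dgraph_union D D').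
Proof.
by rewrite /pgr_hcat (pgr_extE (@unionl_compatible k l k' l' _)) (pgr_extE (@unionr_compatible k l k' l' D)).
Qed.

Definition PGr : trapdata K :=
  @TrapData K (@SSData K (fun k l => pgr X k l) pgr_actl pgr_actr)
    pgr_hcat (pgr_cl (dgraph0 X)) (pgr_cl (dgraph1 X)) pgr_tr.

Definition pgr_iota k l (x : X k l) : PGr k l := pgr_cl (dgraph_corolla x).

End PGr.

(* Main.v *)
(* A decorated planar graph is determined up to isomorphism by its decorated
   vertices, its number of loops and its wires, the pairs (s, t) in which s is an
   output of a vertex or an input of the graph, and t an input of a vertex or an
   output of the graph.  In terms of wires the four gluing rules become one: if
   W is the wire relation of G, that of t_{i,j}(G) is
     W(s, t) \/ (W(s, j) /\ W(i, t)),
   and there is a new loop iff W(i, j).  This proves the TraP axioms for PGr X.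

   Conversely, a TraP P extends to a family indexed by finite sets of inputs and
   outputs, in which the traces over disjoint pairs commute and the concatenation
   of a finite family does not depend on its order.  The value of a graph is the
   trace, along all its internal edges and loops, of the concatenation of the
   phi(x_v) over the vertices and of a copy of I for every input-output edge and
   every loop.  It is compatible with t_{i,j}: gluing an input to an output, or an
   input-output edge to itself, traces one pair more, and in the other cases one
   copy of I disappears by the unit axioms.

   Uniqueness: a graph with an internal edge or a loop is the trace of the graph
   in which it has been cut open, and a graph with neither is, up to permutations
   of its inputs and outputs, a concatenation of corollas and copies of I. *)

Require Import Defs.
From HB Require Import structures.
From mathcomp Require Import boolp freeg.
From mathcomp Require Import all_boot all_order all_algebra all_fingroup.
From mathcomp Require Import zify.

Set Implicit Arguments.
Unset Strict Implicit.
Unset Printing Implicit Defensive.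

Import GRing.Theory.
Local Open Scope ring_scope.

(** * Bijections *)

(** The obstacle is that a TraP is indexed by numbers: concatenations regroup and permute blocks of
    indices, traces shift them, and the laws hold only up to casts. Over finite sets both casts and
    permutations become renamings of labels along bijections, and [hc], [tr], [mtrace] and [tensor]
    all commute with renaming. An identity between values then splits into an algebraic law, coming
    from the TraP axioms, and an equality of two bijections between sum and [option] types, which is
    checked by cases. This is why [bij] keeps its inverse as data: composites and inverses have to
    compute. The second obstacle is the dependency of half-edges on arities. Every half-edge at a
    vertex is therefore compared through the pair of its vertex and its rank in the order at that
    vertex, an element of [V * nat] whose type mentions neither arities nor edges. The labels of the
    tensor product and the ends of wires are both named in this way, so that the planar structure is
    recovered from ranks alone. *)

Record bij (A B : Type) := Bij {
  fw :> A -> B;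
  bw : B -> A;
  fwK : cancel fw bw;
  bwK : cancel bw fw
}.
Notation "A <~> B" := (bij A B) (at level 70).

Definition bid A : A <~> A := @Bij A A id id (fun _ => erefl) (fun _ => erefl).
Definition binv A B (f : A <~> B) : B <~> A := Bij (bwK f) (fwK f).
Definition bcomp A B C (g : B <~> C) (f : A <~> B) : A <~> C :=
  Bij (can_comp (fwK g) (fwK f)) (can_comp (bwK f) (bwK g)).
Notation "g \b f" := (bcomp g f) (at level 50).

Lemma fw_inj A B (f : A <~> B) : injective f.
Proof. exact: can_inj (fwK f). Qed.
Arguments fw_inj {A B} f [x1 x2].

Lemma fw_bij A B (f : A <~> B) : bijective f.
Proof. by exists (bw f); [exact: fwK | exact: bwK]. Qed.

Lemma sum_mapK A B A' B' (f : A -> A') (f' : A' -> A) (g : B -> B') (g' : B' -> B) :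
  cancel f f' -> cancel g g' -> cancel (sum_map f g) (sum_map f' g').
Proof. by move=> fK gK [] x /=; rewrite ?fK ?gK. Qed.

Definition bsum A B A' B' (f : A <~> A') (g : B <~> B') : A + B <~> A' + B' :=
  Bij (sum_mapK (fwK f) (fwK g)) (sum_mapK (bwK f) (bwK g)).

Lemma option_mapK A B (f : A -> B) g : cancel f g -> cancel (option_map f) (option_map g).
Proof. by move=> fK [x|] //=; rewrite fK. Qed.

Definition bopt A B (f : A <~> B) : option A <~> option B :=
  Bij (option_mapK (fwK f)) (option_mapK (bwK f)).

(** Transparent, so that the underlying function is convertible to [f]: equations such as [bslotE]
    and [btgtE] hold by computation. *)
Definition bij_of (A : finType) (B : eqType) (f : A -> B) (fb : bijective f) : A <~> B.
Proof.
apply: (@Bij _ _ f (bij_inv fb)) => x; last exact: bij_invK.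
by apply: (bij_inj fb); rewrite bij_invK.
Defined.

Definition bsplit m n : 'I_(m + n) <~> 'I_m + 'I_n := Bij (@splitK m n) (@unsplitK m n).
Definition brank (A : finType) : A <~> 'I_#|A| := Bij (@enum_rankK A) (@enum_valK A).
Definition bperm n (s : 'S_n) : 'I_n <~> 'I_n := Bij (permK s) (permKV s).
Definition bcast m n (e : m = n) : 'I_m <~> 'I_n := Bij (cast_ordK e) (cast_ordKV e).

Lemma unliftK n (i : 'I_n.+1) : cancel (unlift i)
  (fun x => if x is Some y then lift i y else i).
Proof. by move=> x; case: unliftP. Qed.
Lemma liftOK n (i : 'I_n.+1) : cancel (fun x => if x is Some y then lift i y else i) (unlift i).
Proof. by case=> [y|]; rewrite ?liftK ?unlift_none. Qed.
Definition bunlift n (i : 'I_n.+1) : 'I_n.+1 <~> option 'I_n := Bij (unliftK i) (@liftOK n i).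

(** The enumeration of [option A] has no controlled relation to that of [A]. This change of
    numbering puts [None] at 0 and shifts the numbers of [A] by one, so that tracing the pair of
    labels [None] is [ptr ord0 ord0]. *)
Definition branko (A : finType) : 'I_#|{: option A}| <~> 'I_#|A|.+1 :=
  binv (bunlift ord0) \b bopt (brank A) \b binv (brank (option A)).

(** The equality of sizes is extracted from the bijection itself, so a renumbering carries the cast
    it needs; substituting along it reduces any renumbering to a permutation. *)
Lemma bij_ord m n (f : 'I_m <~> 'I_n) : m = n.
Proof. by rewrite -(card_ord m) (bij_eq_card (fw_bij f)) card_ord. Qed.

Lemma fwE A B C (f : A <~> B) (g : B <~> C) x : (g \b f) x = g (f x). Proof. by []. Qed.

Definition perm_of_bij n (f : 'I_n <~> 'I_n) : 'S_n := perm (fw_inj f).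

Local Arguments unsplit : simpl never.
Ltac bijsimp := repeat progress (rewrite ?(unsplitK, splitK, enum_rankK, enum_valK, liftK,
  unlift_none) /=).

(** * TraPs indexed by finite sets *)

Section Relab.
Variables (K : fieldType) (P : trap K).

Let hP := trapP P.
Let hS := trap_ssmod hP.

(* Casts and both actions at once: f and g are the new numbers of the inputs and
   of the outputs. *)
Definition relab m n m' n' (f : 'I_m <~> 'I_n) (g : 'I_m' <~> 'I_n') (p : P m m') : P n n' :=
  actl (perm_of_bij (g \b binv (bcast (bij_ord g))))
    (actr (castP (bij_ord f, bij_ord g) p)
       (perm_of_bij (f \b binv (bcast (bij_ord f))))^-1%g).

(** The right action by [t] renumbers inputs by the inverse of [t], as it does on graphs; hence the
    inverse on the input side only. *)
Lemma relab_perm n n' (s : 'S_n) (t : 'S_n') (p : P n n') :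
  relab (bperm s) (bperm t) p = actl t (actr p s^-1%g).
Proof.
rewrite /relab (eq_irrelevance (bij_ord (bperm s)) erefl).
rewrite (eq_irrelevance (bij_ord (bperm t)) erefl) /=.
congr (actl _ (actr _ _^-1)); apply/permP => x; rewrite permE /=; congr (_ _); exact: val_inj.
Qed.

Lemma relab_ext m n m' n' (f f2 : 'I_m <~> 'I_n) (g g2 : 'I_m' <~> 'I_n') p :
  f =1 f2 -> g =1 g2 -> relab f g p = relab f2 g2 p.
Proof.
move=> ef eg; rewrite /relab (eq_irrelevance (bij_ord f2) (bij_ord f)).
rewrite (eq_irrelevance (bij_ord g2) (bij_ord g)).
by congr (actl _ (actr _ _^-1)); apply/permP => x; rewrite !permE /= ?ef ?eg.
Qed.

Lemma bij_permE n (f : 'I_n <~> 'I_n) : f =1 bperm (perm_of_bij f).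
Proof. by move=> x; rewrite /= permE. Qed.

Lemma relab_self n n' (f : 'I_n <~> 'I_n) (g : 'I_n' <~> 'I_n') (p : P n n') :
  relab f g p = actl (perm_of_bij g) (actr p (perm_of_bij f)^-1%g).
Proof. by rewrite -relab_perm; apply: relab_ext => x; exact: bij_permE. Qed.

Lemma relab_id n n' (f : 'I_n <~> 'I_n) (g : 'I_n' <~> 'I_n') (p : P n n') :
  f =1 id -> g =1 id -> relab f g p = p.
Proof.
move=> ef eg; have e k (h : 'I_k <~> 'I_k) : h =1 id -> h =1 bperm 1.
  by move=> eh x; rewrite eh /= perm1.
rewrite (relab_ext _ (e _ _ ef) (e _ _ eg)) relab_perm invg1.
by rewrite (actl1 hS) (actr1 hS).
Qed.

Lemma relab_comp k m n k' m' n' (f1 : 'I_k <~> 'I_m) (f2 : 'I_m <~> 'I_n)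
    (g1 : 'I_k' <~> 'I_m') (g2 : 'I_m' <~> 'I_n') p :
  relab f2 g2 (relab f1 g1 p) = relab (f2 \b f1) (g2 \b g1) p.
Proof.
have e1 := bij_ord f1; have e2 := bij_ord f2; have e3 := bij_ord g1; have e4 := bij_ord g2.
subst m n m' n'; rewrite !relab_self (actlr hS) -(actlM hS) -(actlr hS) -(actrM hS).
congr (actl _ (actr _ _)); last by rewrite -invMg; congr (_^-1)%g; apply/permP => x;
  rewrite permM !permE.
by apply/permP => x; rewrite permM !permE.
Qed.

Lemma relab_linear m n m' n' (f : 'I_m <~> 'I_n) (g : 'I_m' <~> 'I_n') : linear
  (@relab m n m' n' f g).
Proof.
have e := bij_ord f; have e' := bij_ord g; subst n n' => a x y.
by rewrite !relab_self (actr_linear hS) (actl_linear hS).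
Qed.

Lemma castP_relab k l k' l' (e : (k = k') * (l = l')) (p : P k l) :
  castP e p = relab (bcast e.1) (bcast e.2) p.
Proof.
case: e => e e'; subst; rewrite relab_id //= => x; exact: cast_ord_id.
Qed.

Lemma actl_relab k l (s : 'S_l) (p : P k l) : actl s p = relab (bid _) (bperm s) p.
Proof.
rewrite (@relab_ext _ _ _ _ (bid _) (bperm 1) (bperm s) (bperm s)) => [|x|] //;
  last by rewrite /= perm1.
by rewrite relab_perm invg1 (actr1 hS).
Qed.

Lemma actr_relab k l (s : 'S_k) (p : P k l) : actr p s = relab (bperm s^-1) (bid _) p.
Proof.
rewrite (@relab_ext _ _ _ _ (bperm s^-1) (bperm s^-1) (bid _) (bperm 1)) => [|//|x];
  last by rewrite /= perm1.
by rewrite relab_perm invgK (actl1 hS).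
Qed.

Definition bplus m n m' n' (f : 'I_m <~> 'I_n) (g : 'I_m' <~> 'I_n') : 'I_(m + m') <~>
  'I_(n + n') :=
  binv (bsplit n n') \b (bsum f g \b bsplit m m').

Lemma perm_tensV m n (s : 'S_m) (t : 'S_n) : (perm_tens s^-1 t^-1 = (perm_tens s t)^-1)%g.
Proof.
apply: (@mulIg _ (perm_tens s t)); rewrite mulVg.
apply/permP => u; rewrite perm1 permM !permE /perm_tens_fun unsplitK.
by rewrite -[RHS](splitK u); case: split => v /=; rewrite permKV.
Qed.

Lemma perm_of_bplus m n (f : 'I_m <~> 'I_m) (g : 'I_n <~> 'I_n) :
  perm_of_bij (bplus f g) = perm_tens (perm_of_bij f) (perm_of_bij g).
Proof.
by apply/permP => u; rewrite !permE /= /perm_tens_fun; case: split => v /=; rewrite permE.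
Qed.

Lemma hcat_relab m n m' n' p p' q q' (f : 'I_m <~> 'I_n) (g : 'I_m' <~> 'I_n')
   (f' : 'I_p <~> 'I_p') (g' : 'I_q <~> 'I_q') (x : P m m') (y : P p q) :
  hcat (relab f g x) (relab f' g' y) = relab (bplus f f') (bplus g g') (hcat x y).
Proof.
have e1 := bij_ord f; have e2 := bij_ord g; have e3 := bij_ord f'; have e4 := bij_ord g'.
subst n n' p' q'; rewrite !relab_self !(actlr hS) (hcat_equiv hP).
by rewrite perm_tensV !perm_of_bplus.
Qed.

Lemma perm_of_bijV n (f : 'I_n <~> 'I_n) x : ((perm_of_bij f)^-1)%g (f x) = x.
Proof. by rewrite -[f x](permE (fw_inj f)) permK. Qed.

(** [perm_del] is characterised by intertwining two lifts, so it may be replaced by any bijections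
    [f0] and [g0] induced off the traced pair. The computations with traces in [P] use equivariance
    in this form. *)
Lemma ptr_relab m n m' n' (f : 'I_m.+1 <~> 'I_n.+1) (g : 'I_m'.+1 <~> 'I_n'.+1)
    (f0 : 'I_m <~> 'I_n) (g0 : 'I_m' <~> 'I_n') i j i' j' (p : P m.+1 m'.+1) :
  f i = i' -> g j = j' -> (forall x : 'I_m, f (lift i x) = lift i' (f0 x)) ->
  (forall x : 'I_m', g (lift j x) = lift j' (g0 x)) ->
  ptr i' j' (relab f g p) = relab f0 g0 (ptr i j p).
Proof.
move=> ei ej ef eg; have e1 := bij_ord f0; have e2 := bij_ord g0; subst n n'.
rewrite !relab_self (actlr hS) (ptr_equiv hP) !(actlr hS).
have ki : ((perm_of_bij f)^-1)%g i' = i by rewrite -ei perm_of_bijV.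
have kj : ((perm_of_bij g)^-1)%g j' = j by rewrite -ej perm_of_bijV.
rewrite ki kj; congr (actr (actl _ _) _).
  apply/permP => x; rewrite !permE; apply: (@lift_inj _ j').
  by rewrite lift_drop permE kj eg.
apply: (@mulgI _ (perm_of_bij f0)); rewrite mulgV; apply/permP => x; rewrite perm1 permM.
rewrite [LHS]permE; apply: (@lift_inj _ i); rewrite lift_drop [perm_of_bij f0 x]permE.
have -> : ((((perm_of_bij f)^-1)^-1) i)%g = i' by rewrite invgK permE.
by rewrite -ef perm_of_bijV.
Qed.

(** Naming both inputs and both outputs by their numbers before any trace merges the four cases of
    the commutation axiom: [i2] is the original number of [i'], and [i] that of [i2']. *)
Lemma ptr_ptr k l (i i2 : 'I_k.+2) (j j2 : 'I_l.+2) (i' i2' : 'I_k.+1)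
    (j' j2' : 'I_l.+1) (p : P k.+2 l.+2) :
  lift i i' = i2 -> lift i2 i2' = i -> lift j j' = j2 -> lift j2 j2' = j ->
  ptr i' j' (ptr i j p) = ptr i2' j2' (ptr i2 j2 p).
Proof.
(* Recovers, from the equations on lifts, the explicit shifted indices of the axiom; the two cases
   are the comparison of [b] with [a]. *)
have key n (a a2 : 'I_n.+2) (b b2 : 'I_n.+1) : lift a b = a2 -> lift a2 b2 = a ->
  if (b < a)%N then a2 = inord b /\ b2 = inord a.-1 else a2 = inord b.+1 /\ b2 = inord a.
  move=> /(congr1 val) /= e /(congr1 val) /= e2;
    move: (ltn_ord a) (ltn_ord b) (ltn_ord b2) => *.
  by case: ifP => h; split; apply: val_inj; rewrite /= inordK; rewrite /bump in e e2; lia.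
move=> /key h /h{h}hi /key h /h{h}hj; move: hi hj.
case: ltnP => ii [-> ->]; case: ltnP => jj [-> ->].
- exact: (ptr_ptr_ll hP).
- exact: (ptr_ptr_lg hP).
- exact: (ptr_ptr_gl hP).
- exact: (ptr_ptr_gg hP).
Qed.

(** In this position the cycle of the unit axiom is the identity; other positions are reached by
    renaming labels. *)
Lemma ptr_unit_out k l (p : P k l.+1) :
  ptr (ord0 : 'I_k.+1) (lift ord0 ord0) (hcat (trap1 P) p) = p.
Proof.
rewrite (ptr_1hcat_out hP) -[RHS](actl1 hS); congr actl.
by rewrite /cyc lift_perm1.
Qed.

Lemma ptr_unit_in k l (p : P k.+1 l) :
  ptr (lift ord0 ord0) (ord0 : 'I_l.+1) (hcat (trap1 P) p) = p.
Proof.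
rewrite (ptr_1hcat_in hP) -[RHS](actr1 hS); congr actr.
by rewrite /cyc lift_perm1 invg1.
Qed.

(* The elements of P whose inputs are labelled by A and outputs by B; ren, hc and
   tr below are the renumbering, the concatenation and the trace of the pair of
   labels None. *)
Definition lab (A B : finType) : lmodType K := P #|A| #|B|.

Definition blab (A B : finType) (f : A <~> B) : 'I_#|A| <~> 'I_#|B| :=
  brank B \b f \b binv (brank A).

Definition ren (A B A' B' : finType) (f : A <~> A') (g : B <~> B') : lab A B -> lab A' B' :=
  relab (blab f) (blab g).

Lemma ren_ext (A B A' B' : finType) (f f' : A <~> A') (g g' : B <~> B') p :
  f =1 f' -> g =1 g' -> ren f g p = ren f' g' p.
Proof. by move=> ef eg; apply: relab_ext => x /=; rewrite ?ef ?eg. Qed.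

Lemma ren_id (A B : finType) (f : A <~> A) (g : B <~> B) p :
  f =1 id -> g =1 id -> ren f g p = p.
Proof. by move=> ef eg; apply: relab_id => x /=; rewrite ?ef ?eg enum_valK. Qed.

Lemma ren_comp (A B A' B' A'' B'' : finType) (f : A <~> A') (f' : A' <~> A'')
    (g : B <~> B') (g' : B' <~> B'') p :
  ren f' g' (ren f g p) = ren (f' \b f) (g' \b g) p.
Proof. by rewrite /ren relab_comp; apply: relab_ext => x /=; rewrite enum_rankK. Qed.

Lemma renK (A B A' B' : finType) (f : A <~> A') (g : B <~> B') p :
  ren (binv f) (binv g) (ren f g p) = p.
Proof. by rewrite ren_comp; apply: ren_id => x /=; rewrite fwK. Qed.

Lemma renKV (A B A' B' : finType) (f : A <~> A') (g : B <~> B') p :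
  ren f g (ren (binv f) (binv g) p) = p.
Proof. by rewrite ren_comp; apply: ren_id => x /=; rewrite bwK. Qed.

Lemma ren_linear (A B A' B' : finType) (f : A <~> A') (g : B <~> B') : linear (ren f g).
Proof. exact: relab_linear. Qed.

Definition inn k l : P k l -> lab 'I_k 'I_l := relab (brank _) (brank _).
Definition out k l : lab 'I_k 'I_l -> P k l := relab (binv (brank _)) (binv (brank _)).

Lemma innK k l : cancel (@inn k l) (@out k l).
Proof. by move=> p; rewrite /out relab_comp; apply: relab_id => x /=; rewrite enum_rankK. Qed.

Lemma outK k l : cancel (@out k l) (@inn k l).
Proof. by move=> p; rewrite /inn relab_comp; apply: relab_id => x /=; rewrite enum_valK. Qed.

Lemma out_linear k l : linear (@out k l).
Proof. exact: relab_linear. Qed.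

Lemma inn_linear k l : linear (@inn k l).
Proof. exact: relab_linear. Qed.

Lemma inn_relab k l k' l' (f : 'I_k <~> 'I_k') (g : 'I_l <~> 'I_l') p :
  inn (relab f g p) = ren f g (inn p).
Proof. by rewrite /inn /ren !relab_comp; apply: relab_ext => x /=; rewrite enum_rankK. Qed.

Definition hc (A B A' B' : finType) (p : lab A B) (q : lab A' B') : lab (A + A')%type
  (B + B')%type :=
  relab (brank _ \b bsum (binv (brank A)) (binv (brank A')) \b bsplit _ _)
        (brank _ \b bsum (binv (brank B)) (binv (brank B')) \b bsplit _ _) (hcat p q).

Definition tr (A B : finType) (p : lab (option A) (option B)) : lab A B :=
  ptr ord0 ord0 (relab (branko A) (branko B) p).

Lemma hc_linearl (A B A' B' : finType) (q : lab A' B') : linear (fun p : lab A B => hc p q).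
Proof. by move=> a x y; rewrite /hc (hcat_linearl hP) relab_linear. Qed.

Lemma tr_linear (A B : finType) : linear (@tr A B).
Proof. by move=> a x y; rewrite /tr relab_linear (ptr_linear hP). Qed.

Lemma hc_ren (A B A' B' C D C' D' : finType) (f : A <~> C) (g : B <~> D) (f' : A' <~> C')
   (g' : B' <~> D') p q :
  hc (ren f g p) (ren f' g' q) = ren (bsum f f') (bsum g g') (hc p q).
Proof.
rewrite /hc /ren hcat_relab !relab_comp.
by apply: relab_ext => x /=; rewrite unsplitK !enum_rankK /=; case: split => y /=;
  rewrite enum_rankK.
Qed.

Lemma inn_hcat k l k' l' (p : P k l) (q : P k' l') :
  inn (hcat p q) = ren (binv (bsplit k k')) (binv (bsplit l l')) (hc (inn p) (inn q)).
Proof.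
rewrite /hc /inn hcat_relab /ren !relab_comp.
apply: relab_ext => x /=; rewrite unsplitK !enum_rankK /=;
 by rewrite -[in LHS](splitK x); case: (split x) => y /=; rewrite enum_rankK.
Qed.

Lemma tr_ren (A B A' B' : finType) (f : A <~> A') (g : B <~> B') p :
  tr (ren (bopt f) (bopt g) p) = ren f g (tr p).
Proof.
rewrite /tr /ren !relab_comp -(ptr_relab (f := binv (bunlift ord0) \b bopt (blab f) \b bunlift
  ord0)
 (g := binv (bunlift ord0) \b bopt (blab g) \b bunlift ord0) (i := ord0) (j := ord0)
 (i' := ord0) (j' := ord0)) /=.
- rewrite relab_comp; congr ptr; apply: relab_ext => x /=;
  by rewrite enum_rankK; case: (enum_val x) => [y|] /=;
    rewrite ?liftK ?unlift_none //= enum_rankK.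
- by rewrite unlift_none.
- by rewrite unlift_none.
- by move=> x; rewrite liftK.
- by move=> x; rewrite liftK.
Qed.

Lemma inn_ptr k l i j (p : P k.+1 l.+1) :
  inn (ptr i j p) = tr (ren (bunlift i) (bunlift j) (inn p)).
Proof.
rewrite /tr /ren /inn !relab_comp; apply/esym/ptr_relab => /=;
  rewrite ?enum_rankK ?unlift_none //.
- by move=> x; rewrite !enum_rankK liftK.
- by move=> x; rewrite !enum_rankK liftK.
Qed.

Definition bsumA A B C : (A + B) + C <~> A + (B + C).
Proof.
exists (fun x => match x with inl (inl a) => inl a | inl (inr b) => inr (inl b) | inr c => inr
  (inr c) end)
  (fun x => match x with inl a => inl (inl a) | inr (inl b) => inl (inr b) | inr (inr c) =>
    inr c end).
- by move=> [[]|].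
- by move=> [|[]].
Defined.

Definition bsumC A B : A + B <~> B + A.
Proof.
by exists (fun x => match x with inl a => inr a | inr b => inl b end)
  (fun x => match x with inl a => inr a | inr b => inl b end) => [[]|[]].
Defined.

Definition bvoid A : A <~> void + A.
Proof.
by exists inr (fun x : void + A => match x with inl a => match a with end | inr b => b end) =>
  [|[[]|]].
Defined.

Definition boptsum A B : option A + B <~> option (A + B).
Proof.
by exists (fun x => match x with inl a => omap inl a | inr b => Some (inr b) end)
  (fun x => match x with Some (inl a) => inl (Some a) | Some (inr a) => inr a | None => inl
    None end)
  => [[[]|]|[[]|]].
Defined.

Definition bopt2 A : option (option A) <~> option (option A).
Proof.
by exists (fun x => match x with None => Some None | Some None => None | _ => x end)
  (fun x => match x with None => Some None | Some None => None | _ => x end)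
  => [[[]|]|[[]|]].
Defined.

Definition bunitsum A : unit + A <~> option A.
Proof.
by exists (fun x => match x with inr a => Some a | inl _ => None end)
  (fun x => match x with Some a => inr a | None => inl tt end)
  => [[[]|]|[]].
Defined.

Definition bord0 : 'I_0 <~> void.
Proof.
exists (fun i : 'I_0 => match notF (ltn_ord i) return void with end)
  (fun v : void => match v with end).
  by case.
by case.
Defined.

Definition bord1 : 'I_1 <~> unit.
Proof. by exists (fun _ => tt) (fun _ => ord0) => [x|[]]; rewrite ?[x]ord1. Defined.

Lemma hcA (A B A' B' A'' B'' : finType) (p : lab A B) (q : lab A' B') (r : lab A'' B'') :
  hc p (hc q r) = ren (bsumA _ _ _) (bsumA _ _ _) (hc (hc p q) r).
Proof.
rewrite /hc.
(* Identity renumberings are inserted so that [hcat_relab] applies to the factors that are not yet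
   renumbered. *)
have r1 : p = relab (bid _) (bid _) p by rewrite relab_id.
have r2 : r = relab (bid _) (bid _) r by rewrite relab_id.
rewrite [in LHS]r1 [in RHS]r2 !hcat_relab (hcatA hP) castP_relab /ren !relab_comp.
have key a b c : (@bsplit a (b + c)) \b bcast (esym (addnA a b c)) =1
  (bsum (bid _) (binv (bsplit _ _)) \b bsumA _ _ _ \b bsum (bsplit a b) (bid _) \b bsplit
    (a + b) c).
  move=> x; apply: (can_inj (@unsplitK _ _)); rewrite /= splitK -[x in LHS]splitK.
  case: (split x) => [y|y]; apply: val_inj => /=; last by rewrite addnA.
  by rewrite -[y in LHS]splitK; case: (split y).
apply: relab_ext => x /=; have := key _ _ _ x; rewrite /= => ->;
  by case: (split x) => y; bijsimp; first (case: (split y) => z; bijsimp).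
Qed.

Lemma hcC (A B A' B' : finType) (p : lab A B) (q : lab A' B') :
  hc q p = ren (bsumC _ _) (bsumC _ _) (hc p q).
Proof.
have e := hcatC hP p q.
move: e; rewrite actl_relab actr_relab castP_relab relab_comp.
move/(congr1 (relab (bperm (perm_braid #|A| #|A'|) ) (bid _))); rewrite !relab_comp.
set u := LHS; set v := RHS => e.
have -> : hc q p = relab (brank _ \b bsum (binv (brank A')) (binv (brank A)) \b bsplit _ _
   \b binv (bcast (addnC _ _))) (brank _ \b bsum (binv (brank B')) (binv (brank B)) \b bsplit
     _ _
   \b binv (bcast (addnC _ _))) v.
  rewrite /v relab_comp /hc; apply: relab_ext => x /=; last by rewrite cast_ordK.
  by rewrite permKV cast_ordK.
rewrite -e /u /ren /hc !relab_comp.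
(* The braiding followed by the cast exchanges the two blocks, which is [bsumC] on the split
   index. *)
have key a b (x : 'I_(a + b)) : split (cast_ord (esym (addnC b a)) (perm_braid a b x)) = bsumC
  _ _ (split x).
  apply: (can_inj (@unsplitK _ _)); rewrite splitK permE /perm_braid_fun cast_ordK.
  by case: (split x).
by apply: relab_ext => x /=; rewrite key enum_rankK; case: (split x) => y.
Qed.

Definition onel : lab void void := relab (brank _ \b bord0) (brank _ \b bord0) (trap0 P).
Definition idl : lab unit unit := relab (brank _ \b bord1) (brank _ \b bord1) (trap1 P).

Lemma inn_trap0 : inn (trap0 P) = ren (binv bord0) (binv bord0) onel.
Proof. by rewrite /inn /ren relab_comp; apply: relab_ext => -[]. Qed.

Lemma inn_trap1 : inn (trap1 P) = ren (binv bord1) (binv bord1) idl.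
Proof. by rewrite /inn /ren relab_comp; apply: relab_ext => x /=; rewrite [x]ord1. Qed.

Lemma hc1 (A B : finType) (p : lab A B) : hc onel p = ren (bvoid _) (bvoid _) p.
Proof.
rewrite /hc /onel.
have r1 : p = relab (bid _) (bid _) p by rewrite relab_id.
rewrite {1}r1 hcat_relab (hcat0p hP) /ren !relab_comp.
have key n : @split 0 n =1 inr.
  by move=> x; apply: (can_inj (@unsplitK _ _)); rewrite splitK; apply: val_inj.
by apply: relab_ext => x /=; rewrite key /= unsplitK.
Qed.

Lemma split_lift_lshift a b (i : 'I_a.+1) (x : 'I_(a + b)) :
  split (lift (lshift b i) x : 'I_(a.+1 + b)) = sum_map (lift i) id (split x).
Proof.
apply: (can_inj (@unsplitK _ _)); rewrite splitK -[x in LHS]splitK.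
case: (split x) => y; apply: val_inj => //=.
by move: (ltn_ord i) (ltn_ord y); rewrite /bump; lia.
Qed.

Lemma tr_tr (A B : finType) (p : lab (option (option A)) (option (option B))) :
  tr (tr (ren (bopt2 A) (bopt2 B) p)) = tr (tr p).
Proof.
(* [R] numbers [None] by 0, [Some None] by 1 and the rest from 2 on, so that two successive traces
   of [None] both take place at index 0. *)
pose R (C : finType) : 'I_#|{: option (option C)}| <~> 'I_#|C|.+2 :=
  binv (bunlift ord0) \b bopt (binv (bunlift ord0) \b bopt (brank C) \b binv (brank (option C)))
   \b bopt (brank (option C)) \b binv (brank _).
have R0 q : tr (tr q) = ptr ord0 ord0 (ptr ord0 ord0 (relab (R A) (R B) q)).
  rewrite /tr; congr ptr; apply/esym; set f0 := branko A; set g0 := branko B.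
  rewrite -(ptr_relab (f := binv (bunlift ord0) \b bopt f0 \b bunlift ord0) (i := ord0)
    (j := ord0)
     (g := binv (bunlift ord0) \b bopt g0 \b bunlift ord0) (i' := ord0) (j' := ord0)) /=;
    rewrite ?unlift_none //; try by move=> x; rewrite liftK.
  by rewrite relab_comp; congr ptr; apply: relab_ext => x /=; bijsimp;
    case: (enum_val x) => [y|] /=; rewrite ?liftK ?unlift_none /=.
(* The transposition of 0 and 1, in the form that suits [ptr_ptr]: index 0 is removed and reinserted
   at place 1. *)
pose s n : 'I_n.+2 <~> 'I_n.+2 := binv (bunlift (lift ord0 ord0)) \b bunlift ord0.
rewrite !R0 [RHS](ptr_ptr (i2 := lift ord0 ord0) (j2 := lift ord0 ord0) (i2' := ord0)
  (j2' := ord0));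
  try exact: val_inj.
have -> : relab (R A) (R B) p = relab (s _) (s _)
  (relab (R A) (R B) (ren (bopt2 A) (bopt2 B) p)).
  have e (C : finType) : R C =1 s _ \b (R C \b (brank _ \b bopt2 C \b binv (brank _))).
    move=> x /=; rewrite enum_rankK; case: (enum_val x) => [[y|]|] /=;
      rewrite ?enum_rankK /= ?(liftK, unlift_none) //=;
    by rewrite ?(liftK, unlift_none); apply: val_inj.
  by rewrite !relab_comp; apply: relab_ext => x; rewrite e.
congr ptr; apply/esym; rewrite -[RHS](@relab_id _ _ (bid _) (bid _)) //.
by apply: ptr_relab => //= [||x|x]; rewrite ?unlift_none ?liftK.
Qed.

Lemma tr_hc (A B A' B' : finType) (p : lab (option A) (option B)) (q : lab A' B') :
  hc (tr p) q = tr (ren (boptsum _ _) (boptsum _ _) (hc p q)).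
Proof.
rewrite /hc /tr -(ptr_hcatl hP).
have {2}-> : p = relab (binv (branko A)) (binv (branko B)) (relab (branko A) (branko B) p).
  by rewrite relab_comp relab_id // => x; [exact: (fwK (branko A)) | exact: (fwK (branko B))].
have {2}-> : q = relab (bid _) (bid _) q by rewrite relab_id.
rewrite hcat_relab /ren !relab_comp; apply/esym.

apply: ptr_relab => [||x|x]; rewrite /= -?[lshift _ ord0]/(unsplit (inl ord0))
  ?split_lift_lshift; bijsimp => //;
  by case: (split x) => y; bijsimp.
Qed.

(** The strand is glued by its input to the output [None] of [p]: [bopt2] hands the traced label to
    that output and its former label to the output of the strand, so the unit axiom returns [p] with
    unchanged labels. *)
Lemma tr_idl_out (A B : finType) (p : lab A (option B)) :
  tr (ren (bunitsum A) (bopt2 B \b bunitsum _) (hc idl p)) = p.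
Proof.
rewrite /tr /ren /hc !relab_comp.
have [q ->] : exists q, p = relab (bid _) (binv (branko B)) q.
  exists (relab (bid _) (branko B) p).
  by rewrite relab_comp relab_id // => x; exact: (fwK (branko B)).
rewrite /idl hcat_relab relab_comp -[X in _ = relab _ _ X]ptr_unit_out.
apply: ptr_relab => [||x|x].
- have {1}-> : (ord0 : 'I_(#|A|.+1)) = unsplit (inl ord0 : 'I_1 + 'I_#|A|) by exact: val_inj.
  by rewrite /=; bijsimp.
- have -> : lift ord0 ord0 = unsplit (inr ord0 : 'I_1 + 'I_#|B|.+1) by exact: val_inj.
  by rewrite /=; bijsimp.
- have {1}-> : lift ord0 x = unsplit (inr x : 'I_1 + 'I_#|A|) by exact: val_inj.
  by rewrite /=; bijsimp.
- case: (@unliftP _.+1 ord0 x) => [y ->|->].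
    have -> : lift (lift ord0 ord0) (lift ord0 y) = unsplit
      (inr (lift ord0 y) : 'I_1 + 'I_#|B|.+1) by exact: val_inj.
    by rewrite /=; bijsimp.
  have -> : lift (lift ord0 ord0) ord0 = unsplit (inl ord0 : 'I_1 + 'I_#|B|.+1) by exact:
    val_inj.
  by rewrite /=; bijsimp.
Qed.

Lemma tr_idl_in (A B : finType) (p : lab (option A) B) :
  tr (ren (bopt2 A \b bunitsum _) (bunitsum B) (hc idl p)) = p.
Proof.
rewrite /tr /ren /hc !relab_comp.
have [q ->] : exists q, p = relab (binv (branko A)) (bid _) q.
  exists (relab (branko A) (bid _) p).
  by rewrite relab_comp relab_id // => x; exact: (fwK (branko A)).
rewrite /idl hcat_relab relab_comp -[X in _ = relab _ _ X]ptr_unit_in.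
apply: ptr_relab => [||x|x].
- have -> : lift ord0 ord0 = unsplit (inr ord0 : 'I_1 + 'I_#|A|.+1) by exact: val_inj.
  by rewrite /=; bijsimp.
- have {1}-> : (ord0 : 'I_(#|B|.+1)) = unsplit (inl ord0 : 'I_1 + 'I_#|B|) by exact: val_inj.
  by rewrite /=; bijsimp.
- case: (@unliftP _.+1 ord0 x) => [y ->|->].
    have -> : lift (lift ord0 ord0) (lift ord0 y) = unsplit
      (inr (lift ord0 y) : 'I_1 + 'I_#|A|.+1) by exact: val_inj.
    by rewrite /=; bijsimp.
  have -> : lift (lift ord0 ord0) ord0 = unsplit (inl ord0 : 'I_1 + 'I_#|A|.+1) by exact:
    val_inj.
  by rewrite /=; bijsimp.
- have {1}-> : lift ord0 x = unsplit (inr x : 'I_1 + 'I_#|B|) by exact: val_inj.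
  by rewrite /=; bijsimp.
Qed.
End Relab.

(** * Traces and concatenations over finite sets *)

Definition bsumv A B (h : B <~> void) : A + B <~> A.
Proof.
exists (fun x : A + B => match x with inl a => a | inr v => match h v with end end) inl =>
  [[a|v]|//].
  by [].
by case: (h v).
Defined.

Definition bsumo A C : A + option C <~> option (A + C).
Proof.
by exists (fun x => match x with inl a => Some (inl a) | inr c => omap inr c end)
  (fun x => match x with Some (inl a) => inl a | Some (inr c) => inr (Some c) | None => inr
    None end)
  => [[|[]]|[[]|]].
Defined.

Definition bsum23 A C B : (A + C) + B <~> (A + B) + C.
Proof.
by exists (fun x => match x with inl (inl a) => inl (inl a) | inl (inr c) => inr c | inr b =>
  inl (inr b) end)
  (fun x => match x with inl (inl a) => inl (inl a) | inl (inr c) => inr c | inr b => inl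
    (inr b) end)
  => [[[]|]|[[]|]].
Defined.

Lemma bopt2K A (x : option (option A)) : bopt2 A (bopt2 A x) = x.
Proof. by case: x => [[]|]. Qed.

Lemma bij_unopt C D (k : option C <~> option D) :
  k None = None -> exists h : C <~> D, forall x, k (Some x) = Some (h x).
Proof.
have key C' D' (f : option C' <~> option D') : f None = None ->
    forall x, {y | f (Some x) = Some y}.
  move=> f0 x; case E: (f (Some x)) => [y|]; first by exists y.
  by have := fw_inj f (etrans E (esym f0)).
move=> k0; have k0' : binv k None = None by rewrite -[in LHS]k0 /= fwK.
pose u := key _ _ _ k0; pose v := key _ _ _ k0'.
unshelve eexists; first (exists (fun x => sval (u x)) (fun x => sval (v x))) => x.
- by case: (u x) => y /= e; case: (v y) => z /=; rewrite -e fwK => -[].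
- by case: (v x) => y /= e; case: (u y) => z /=; rewrite -e bwK => -[].
by move=> x /=; case: (u x).
Qed.

(** A finite type is equivalent to an iterated [option] of [void], and invariance under bijections
    permits the passage. Label maps on sums and options compute by cases, unlike ranks in an
    enumeration. *)
Lemma fin_ind (Q : finType -> Prop) :
  Q void -> (forall C : finType, Q C -> Q (option C)) ->
  (forall C D : finType, C <~> D -> Q C -> Q D) -> forall C, Q C.
Proof.
move=> q0 qS qb C; apply: (qb _ _ (binv (brank C))).
elim: #|C| => [|n IH]; first exact: qb (binv bord0) q0.
exact: qb (binv (bunlift ord0)) (qS _ IH).
Qed.

Section MultiTrace.
Variables (K : fieldType) (P : trap K).

Lemma ren_surj (A B A' B' : finType) (f : A <~> A') (g : B <~> B') (p : lab P A' B') :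
  exists q, p = ren f g q.
Proof. by exists (ren (binv f) (binv g) p); rewrite renKV. Qed.

Definition bpeel A n (i : 'I_n.+1) : A + 'I_n.+1 <~> option (A + 'I_n) :=
  bsumo _ _ \b bsum (bid A) (bunlift i).

Fixpoint mtrace_ord (A B : finType) n : lab P (A + 'I_n)%type (B + 'I_n)%type -> lab P A B :=
  match n with
  | 0 => ren (bsumv A bord0) (bsumv B bord0)
  | n'.+1 => fun p => mtrace_ord (tr (ren (bpeel A (ord0 : 'I_n'.+1)) (bpeel B ord0) p))
  end.

(** Removing two traced pairs in either order leaves the same labels, except that the two removed
    ones are exchanged; [tr_tr] absorbs that exchange in [mtrace_ord_peel]. *)
Lemma bpeel2 A n (i : 'I_n.+1) x :
  bopt (bpeel A ord0) (bpeel A (lift ord0 i : 'I_n.+2) x) =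
  bopt2 _ (bopt (bpeel A i) (bpeel A ord0 x)).
Proof.
case: x => [a|u] //=; case: (unliftP ord0 u) => [v ->|->] /=; last first.
  have -> : ord0 = lift (lift ord0 i : 'I_n.+2) ord0 by apply: val_inj.
  by rewrite liftK /= unlift_none.
case: (unliftP i v) => [w ->|->]; last by rewrite unlift_none.
have -> : lift ord0 (lift i w) = lift (lift ord0 i : 'I_n.+2) (lift ord0 w).
  by apply: val_inj; rewrite /= /bump; lia.
by rewrite liftK /= liftK.
Qed.

(* The pair traced first may be chosen: the order of the traces is irrelevant. *)
Lemma mtrace_ord_peel (A B : finType) n (i : 'I_n.+1)
  (p : lab P (A + 'I_n.+1)%type (B + 'I_n.+1)%type) :
  mtrace_ord p = mtrace_ord (tr (ren (bpeel A i) (bpeel B i) p)).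
Proof.
elim: n i p => [|n IH] i p; first by rewrite [i]ord1.
case: (unliftP ord0 i) => [j ->|-> //].
rewrite [LHS]/(mtrace_ord (tr _)) [LHS](IH j) -tr_ren [RHS]/(mtrace_ord (tr _)) -tr_ren
  !ren_comp.
rewrite -[in RHS]tr_tr ren_comp; congr (mtrace_ord (tr (tr _))).
by apply: ren_ext => x; have := congr1 (bopt2 _) (bpeel2 j x); rewrite bopt2K => e;
  exact: esym e.
Qed.

(** The content is the permutation [h] of the traced pairs. The pair that [h] sends to 0 is peeled
    first, which leaves a bijection between the remaining pairs. *)
Lemma mtrace_ord_ren (A B A' B' : finType) (f : A <~> A') (g : B <~> B') m n (h : 'I_m <~> 'I_n)
    (p : lab P (A + 'I_m)%type (B + 'I_m)%type) :
  mtrace_ord (ren (bsum f h) (bsum g h) p) = ren f g (mtrace_ord p).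
Proof.
have e := bij_ord h; subst m; elim: n h p => [|n IH] h p.
  by rewrite /= !ren_comp; apply: ren_ext => -[a|[]].
set i := bw h ord0.
have [] := @bij_unopt _ _ (bunlift ord0 \b (h \b binv (bunlift i))).
  by rewrite /= bwK unlift_none.
move=> h' h'E; rewrite [in RHS](mtrace_ord_peel i) -(IH h') -tr_ren [LHS]/(mtrace_ord (tr _))
  !ren_comp.
congr (mtrace_ord (tr _)); apply: ren_ext => -[a|u] //=;
 case: (unliftP i u) => [v ->|->]; by [have /= -> := h'E v | rewrite bwK unlift_none].
Qed.

Definition mtrace (A B C : finType) (p : lab P (A + C)%type (B + C)%type) : lab P A B :=
  mtrace_ord (ren (bsum (bid A) (brank C)) (bsum (bid B) (brank C)) p).

Lemma mtrace_linear (A B C : finType) : linear (@mtrace A B C).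
Proof.
have mtnl n : linear (@mtrace_ord A B n).
  elim: n => [|n IH] a x y; first exact: ren_linear.
  by rewrite [LHS]/(mtrace_ord (tr _)) ren_linear tr_linear; exact: IH.
by move=> a x y; rewrite /mtrace ren_linear; exact: mtnl.
Qed.

Lemma mtrace_ren (A B C A' B' D : finType) (f : A <~> A') (g : B <~> B') (h : C <~> D) p :
  mtrace (ren (bsum f h) (bsum g h) p) = ren f g (mtrace p).
Proof.
rewrite /mtrace -(@mtrace_ord_ren _ _ _ _ _ _ _ _ (brank D \b (h \b binv (brank C)))) !ren_comp.
by congr mtrace_ord; apply: ren_ext => -[] x //=; rewrite enum_rankK.
Qed.

Lemma mtrace_mtracen (A B C : finType) n (h : C <~> 'I_n)
  (p : lab P (A + C)%type (B + C)%type) :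
  mtrace p = mtrace_ord (ren (bsum (bid A) h) (bsum (bid B) h) p).
Proof.
rewrite /mtrace -[LHS](ren_id (f := bid _) (g := bid _)) //
  -(@mtrace_ord_ren _ _ _ _ _ _ _ _ (h \b binv (brank C))) ren_comp.
by congr mtrace_ord; apply: ren_ext => -[] x //=; rewrite enum_rankK.
Qed.

Lemma mtrace_void (A B C : finType) (h : C <~> void) (p : lab P (A + C)%type (B + C)%type) :
  mtrace p = ren (bsumv _ h) (bsumv _ h) p.
Proof.
rewrite (mtrace_mtracen (binv bord0 \b h)) /= ren_comp.
by apply: ren_ext => -[a|c] //=; case: (h c).
Qed.

Lemma mtrace_opt (A B C : finType) (p : lab P (A + option C)%type (B + option C)%type) :
  mtrace p = mtrace (tr (ren (bsumo _ _) (bsumo _ _) p)).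
Proof.
rewrite (mtrace_mtracen (binv (bunlift ord0) \b bopt (brank C))) /mtrace -tr_ren
  [LHS]/(mtrace_ord (tr _)) !ren_comp.
congr (mtrace_ord (tr _)); apply: ren_ext => -[a|[c|]] //=; by rewrite ?liftK ?unlift_none.
Qed.

(** By induction on the traced set; commuting two single traces by [tr_tr] is the step. *)
Lemma tr_mtrace (A B C : finType) (p : lab P (option A + C)%type (option B + C)%type) :
  tr (mtrace p) = mtrace (tr (ren (boptsum _ _) (boptsum _ _) p)).
Proof.
elim/fin_ind: C A B p => [|C IH|C D h IH] A B p.
- rewrite !(mtrace_void (bid _)) -!tr_ren !ren_comp; congr (tr _).
  by apply: ren_ext => -[[]|[]].
- rewrite !mtrace_opt IH -!tr_ren !ren_comp -[in RHS]tr_tr ren_comp; congr (mtrace (tr (tr _))).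
  by apply: ren_ext => -[[]|[]].
- have [q ->] := ren_surj (bsum (bid _) h) (bsum (bid _) h) p.
  rewrite mtrace_ren ren_id // IH -[LHS](ren_id (f := bid _) (g := bid _)) //
    -(mtrace_ren _ _ h) -!tr_ren !ren_comp.
  by congr (mtrace (tr _)); apply: ren_ext => -[[]|].
Qed.

Lemma hc_mtrace (A B C A' B' : finType) (p : lab P (A + C)%type (B + C)%type)
  (q : lab P A' B') :
  hc (mtrace p) q = mtrace (ren (bsum23 _ _ _) (bsum23 _ _ _) (hc p q)).
Proof.
elim/fin_ind: C p => [|C IH|C D h IH] p.
- rewrite !(mtrace_void (bid _)) ren_comp -[q in LHS](ren_id (f := bid _) (g := bid _)) //
    hc_ren.
  by apply: ren_ext => -[[]|].
- rewrite !mtrace_opt IH tr_hc -!tr_ren !ren_comp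
    -[q in LHS](ren_id (f := bid _) (g := bid _)) // hc_ren !ren_comp.
  by congr (mtrace (tr _)); apply: ren_ext => -[[|[]]|].
- have [r ->] := ren_surj (bsum (bid _) h) (bsum (bid _) h) p.
  rewrite mtrace_ren ren_id // IH -[LHS](ren_id (f := bid _) (g := bid _)) //
    -(mtrace_ren _ _ h).
  rewrite -[q in RHS](ren_id (f := bid _) (g := bid _)) // hc_ren !ren_comp.
  by congr (mtrace _); apply: ren_ext => -[[]|].
Qed.

Lemma mtrace_mtrace (A B C D : finType) (p : lab P ((A + C) + D)%type ((B + C) + D)%type) :
  mtrace (mtrace p) = mtrace (ren (bsumA _ _ _) (bsumA _ _ _) p).
Proof.
elim/fin_ind: D p => [|D IH|D E h IH] p.
- rewrite !(mtrace_void (bid _)); pose h : C <~> C + void := binv (bsumv C (bid void)).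
  rewrite -[LHS](ren_id (f := bid _) (g := bid _)) // -(mtrace_ren _ _ h) !ren_comp.
  by congr mtrace; apply: ren_ext => -[[]|].
- rewrite (mtrace_opt p) IH.
  rewrite -[RHS](ren_id (f := bid _) (g := bid _)) // -(mtrace_ren _ _ (bsumo C D)) mtrace_opt
    -!tr_ren !ren_comp.
  by congr (mtrace (tr _)); apply: ren_ext => -[[]|[]].
- have [r ->] := ren_surj (bsum (bid _) h) (bsum (bid _) h) p.
  rewrite mtrace_ren ren_id // IH -[LHS](ren_id (f := bid _) (g := bid _)) //
    -(mtrace_ren _ _ (bsum (bid C) h)) !ren_comp.
  by congr mtrace; apply: ren_ext => -[[]|].
Qed.

End MultiTrace.

(* The half-edges at the vertices when v has m v of them. *)
Notation slot m := {v & 'I_(m v)}.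

(** Forgets the bound on the position: slots for two arity functions that are only propositionally
    equal become comparable in [V * nat]. *)
Definition slotv (V : Type) (m : V -> nat) (x : slot m) : V * nat := (tag x, val (tagged x)).

Lemma slotv_inj (V : eqType) (m : V -> nat) : injective (@slotv V m).
Proof.
case=> v a [w b] [] /= e; subst w => /val_inj ->; reflexivity.
Qed.

Lemma slotv_surj (V : Type) (m : V -> nat) v n : (n < m v)%N -> exists x : slot m,
  slotv x = (v, n).
Proof. by move=> h; exists (Tagged (fun v => 'I_(m v)) (Ordinal h)). Qed.

Section Reindex.
Variables (V W : finType) (m : V -> nat) (m' : W -> nat) (f : V <~> W).
Hypothesis e : forall v, m' (f v) = m v.

Definition slot_map (x : slot m) : slot m' :=
  Tagged (fun w => 'I_(m' w)) (cast_ord (esym (e (tag x))) (tagged x)).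

Lemma slot_mapE x : slotv (slot_map x) = (f (slotv x).1, (slotv x).2).
Proof. by []. Qed.

Lemma slot_map_bij : bijective slot_map.
Proof.
apply: inj_surj_bij => [x y /(congr1 (@slotv _ _))|y].
  by rewrite !slot_mapE => -[/(fw_inj f) ev en]; apply: slotv_inj; apply: injective_projections.
have h : (tagged y < m (bw f (tag y)))%N by rewrite -e bwK.
have [x xE] := slotv_surj h; exists x; apply: slotv_inj.
by rewrite slot_mapE xE /= bwK.
Qed.

Definition bslot : slot m <~> slot m' := bij_of slot_map_bij.

Lemma bslotE x : slotv (bslot x) = (f (slotv x).1, (slotv x).2).
Proof. by []. Qed.
End Reindex.

Definition bpull (V W : finType) (h : V <~> W) (m : W -> nat) : slot (m \o h) <~> slot m :=
  bslot (f := h) (fun _ => erefl).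

Definition bcons V (m : option V -> nat) : 'I_(m None) + slot (m \o some) <~> slot m.
Proof.
exists (fun x : 'I_(m None) + slot (m \o some) => match x with
   | inl a => Tagged (fun v => 'I_(m v)) a
   | inr (existT v a) => Tagged (fun v => 'I_(m v)) (a : 'I_(m (Some v))) end)
  (fun x : slot m => (match tag x as v return 'I_(m v) -> 'I_(m None) + slot (m \o some) with
   | None => inl
   | Some v => fun a => inr (Tagged (fun v => 'I_((m \o some) v)) a) end) (tagged x)).
- by move=> [a|[v a]].
- by move=> [[v|] a].
Defined.

Definition bslotD V W (m : V + W -> nat) : slot (m \o inl) + slot (m \o inr) <~> slot m.
Proof.
exists (fun x : slot (m \o inl) + slot (m \o inr) => match x with
   | inl (existT v a) => Tagged (fun v => 'I_(m v)) (a : 'I_(m (inl v)))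
   | inr (existT v a) => Tagged (fun v => 'I_(m v)) (a : 'I_(m (inr v))) end)
  (fun x : slot m => (match tag x as v return 'I_(m v) -> slot (m \o inl) + slot (m \o inr) with
   | inl v => fun a => inl (Tagged (fun v => 'I_((m \o inl) v)) a)
   | inr v => fun a => inr (Tagged (fun v => 'I_((m \o inr) v)) a) end) (tagged x)).
- by move=> [[v a]|[v a]].
- by move=> [[v|v] a].
Defined.

Definition bslot0 (V : Type) (h : V <~> void) (m : V -> nat) : void <~> slot m.
Proof.
exists (fun v : void => match v return slot m with end) (fun x => h (tag x)) => [[]|[v a]].
by case: (h v).
Defined.

(** * The concatenation of a finite family of elements *)

Section Tensor.
Variables (K : fieldType) (P : trap K).

(* Elements of P of arbitrary arities: equality of decorations at vertices whose
   arities are only propositionally equal is equality in this type. *)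
Definition elt := {n : nat * nat & P n.1 n.2 : Type}.
Definition arin V (y : V -> elt) v := (tag (y v)).1.
Definition arout V (y : V -> elt) v := (tag (y v)).2.
Definition elt_in (x x' : elt) (e : x = x') : (tag x).1 = (tag x').1 :=
  congr1 (fun u : elt => (tag u).1) e.
Definition elt_out (x x' : elt) (e : x = x') : (tag x).2 = (tag x').2 :=
  congr1 (fun u : elt => (tag u).2) e.
Definition mkelt k l (p : P k l) : elt := existT (fun n : nat * nat => P n.1 n.2 : Type)
  (k, l) p.

Fixpoint tensor_ord n : forall y : 'I_n -> elt, lab P {: slot (arin y)} {: slot (arout y)} :=
  match n with
  | 0 => fun y => ren (bslot0 bord0 (arin y)) (bslot0 bord0 (arout y)) (onel P)
  | n'.+1 => fun y =>
     let y' := y \o binv (bunlift ord0) in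
     ren (bpull (binv (bunlift ord0)) (arin y) \b bcons (arin y'))
         (bpull (binv (bunlift ord0)) (arout y) \b bcons (arout y'))
         (hc (inn (tagged (y ord0))) (tensor_ord (y' \o some)))
  end.

Lemma hc_renl (A B A' B' C D : finType) (f : A <~> A') (g : B <~> B') (p : lab P A B)
  (q : lab P C D) :
  hc (ren f g p) q = ren (bsum f (bid _)) (bsum g (bid _)) (hc p q).
Proof. by rewrite -[q in LHS](ren_id (f := bid _) (g := bid _)) // hc_ren. Qed.

Lemma hc_renr (A B A' B' C D : finType) (f : A <~> A') (g : B <~> B') (p : lab P A B)
  (q : lab P C D) :
  hc q (ren f g p) = ren (bsum (bid _) f) (bsum (bid _) g) (hc q p).
Proof. by rewrite -[q in LHS](ren_id (f := bid _) (g := bid _)) // hc_ren. Qed.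

Definition bsumCA A B C : A + (B + C) <~> B + (A + C).
Proof.
by exists (fun x => match x with inl a => inr (inl a) | inr (inl b) => inl b | inr (inr c) =>
  inr (inr c) end)
  (fun x => match x with inl a => inr (inl a) | inr (inl b) => inl b | inr (inr c) => inr
    (inr c) end)
  => [[|[]]|[|[]]].
Defined.

Lemma hcCA (A B A' B' A'' B'' : finType) (p : lab P A B) (q : lab P A' B') (r : lab P A'' B'') :
  hc q (hc p r) = ren (bsumCA _ _ _) (bsumCA _ _ _) (hc p (hc q r)).
Proof.
rewrite !hcA (hcC p q) -[r in LHS](ren_id (f := bid _) (g := bid _)) // hc_ren !ren_comp.
by apply: ren_ext => -[[]|].
Qed.

Lemma inn_elt (x x' : elt) : x = x' -> forall (e1 : (tag x).1 = (tag x').1)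
  (e2 : (tag x).2 = (tag x').2),
  inn (tagged x') = ren (bcast e1) (bcast e2) (inn (tagged x)).
Proof. by move=> <- e1 e2; rewrite ren_id // => u; exact: cast_ord_id. Qed.

Lemma tensor_ord_ext n (y z : 'I_n -> elt) (ei : forall i, arin z i = arin y i)
  (eo : forall i, arout z i = arout y i) :
  (forall i, z i = y i) -> tensor_ord z = ren (bslot (f := bid _) ei) (bslot (f := bid _) eo)
    (tensor_ord y).
Proof.
move=> /funext e; subst z; rewrite ren_id // => x; exact: slotv_inj.
Qed.

Lemma tensor_ordS n (y : 'I_n.+1 -> elt) :
  tensor_ord y = ren (bpull (binv (bunlift ord0)) (arin y) \b bcons
    (arin (y \o binv (bunlift ord0))))
         (bpull (binv (bunlift ord0)) (arout y) \b bcons (arout (y \o binv (bunlift ord0))))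
         (hc (inn (tagged (y ord0))) (tensor_ord (y \o binv (bunlift ord0) \o some))).
Proof. by []. Qed.

(** Any factor may be taken first: in the induction step the factors 0 and [i] are exchanged by
    [hcCA], and what remains is an equality of two label bijections. *)
Lemma tensor_ord_peel n (i : 'I_n.+1) (y : 'I_n.+1 -> elt) :
  tensor_ord y = ren (bpull (binv (bunlift i)) (arin y) \b bcons (arin (y \o binv (bunlift i))))
         (bpull (binv (bunlift i)) (arout y) \b bcons (arout (y \o binv (bunlift i))))
         (hc (inn (tagged (y i))) (tensor_ord (y \o binv (bunlift i) \o some))).
Proof.
elim: n i y => [|n IH] i y; first by rewrite [i]ord1.
case: (unliftP ord0 i) => [j ->|-> //].
set y0 := y \o binv (bunlift ord0) \o some; set yi := y \o binv (bunlift (lift ord0 j)) \o some.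
rewrite tensor_ordS -[tensor_ord _ in LHS]/(tensor_ord y0) (IH j y0)
  -[tensor_ord _ in RHS]/(tensor_ord yi) [tensor_ord yi]tensor_ordS.
set y0j := y0 \o binv (bunlift j) \o some.
set yi0 := yi \o binv (bunlift ord0) \o some.
have yE v : yi0 v = y0j v.
  by rewrite /yi0 /y0j /yi /y0 /=; congr y; apply: val_inj; rewrite /= /bump; lia.
have y0E : y ord0 = yi ord0 by rewrite /yi /=; congr y; exact: val_inj.
rewrite (inn_elt y0E (elt_in y0E) (elt_out y0E)).
rewrite (tensor_ord_ext (fun v => elt_in (yE v)) (fun v => elt_out (yE v)) yE).
rewrite hc_ren !hc_renr [in RHS]hcCA !ren_comp.
apply: ren_ext => -[a|[b|[v c]]]; apply: slotv_inj; rewrite /slotv /=; congr (_, _).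
all: try by apply: val_inj => //=; rewrite /bump; lia.
Qed.

Lemma tensor_ord_ren m n (f : 'I_m <~> 'I_n) (y : 'I_m -> elt) (z : 'I_n -> elt)
   (ei : forall i, arin z (f i) = arin y i) (eo : forall i, arout z (f i) = arout y i) :
  (forall i, z (f i) = y i) -> tensor_ord z = ren (bslot ei) (bslot eo) (tensor_ord y).
Proof.
have e := bij_ord f; subst m; elim: n f y z ei eo => [|n IH] f y z ei eo zE.
  by rewrite /= ren_comp; apply: ren_ext => -[].
have [f' f'E] : exists f' : 'I_n <~> 'I_n, forall x,
  bunlift (f ord0) (f (lift ord0 x)) = Some (f' x).
  by have [] := @bij_unopt _ _ (bunlift (f ord0) \b (f \b binv (bunlift ord0)));
    [rewrite /= unlift_none | move=> f'; exists f'].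
have fE x : f (lift ord0 x) = lift (f ord0) (f' x).
  by apply: (fw_inj (bunlift (f ord0))); rewrite f'E /= liftK.
have E x : (z \o binv (bunlift (f ord0)) \o some) (f' x) = (y \o binv (bunlift ord0) \o some) x.
  by rewrite /= -zE fE.
rewrite (tensor_ord_peel (f ord0)) tensor_ordS
  (inn_elt (esym (zE ord0)) (elt_in (esym (zE ord0))) (elt_out (esym (zE ord0)))).
rewrite (IH f' _ _ (fun v => elt_in (E v)) (fun v => elt_out (E v)) E).
rewrite hc_ren !ren_comp.
by apply: ren_ext => -[a|[v a]]; apply: slotv_inj; rewrite /slotv /= ?fE.
Qed.

(** The lock keeps conversion from unfolding the recursion over an enumeration of the vertices;
    [tensor_void], [tensor_opt] and [tensor_ren] serve as the interface. *)
Fact tensor_key : unit. Proof. exact: tt. Qed.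
Definition tensor (V : finType) (y : V -> elt) : lab P {: slot (arin y)} {: slot (arout y)} :=
  locked_with tensor_key (ren (bpull (binv (brank V)) (arin y))
      (bpull (binv (brank V)) (arout y))
      (tensor_ord (y \o binv (brank V)))).

Lemma tensor_ren (V W : finType) (f : V <~> W) (y : V -> elt) (z : W -> elt)
   (ei : forall i, arin z (f i) = arin y i) (eo : forall i, arout z (f i) = arout y i) :
  (forall i, z (f i) = y i) -> tensor z = ren (bslot ei) (bslot eo) (tensor y).
Proof.
move=> zE; have E x : (z \o binv (brank W)) (blab f x) = (y \o binv (brank V)) x.
  by rewrite /= enum_rankK zE.
rewrite /tensor !locked_withE (tensor_ord_ren (fun v => elt_in (E v)) (fun v => elt_out (E v))
  E) !ren_comp.
by apply: ren_ext => -[v a]; apply: slotv_inj; rewrite /slotv /= enum_rankK.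
Qed.

Lemma tensor_ordE n (V : finType) (f : V <~> 'I_n) (y : V -> elt) :
  tensor y = ren (bpull (binv f) (arin y))
      (bpull (binv f) (arout y)) (tensor_ord (y \o binv f)).
Proof.
have E x : (y \o binv (brank V)) ((brank V \b binv f) x) = (y \o binv f) x.
  by rewrite /= enum_rankK.
rewrite /tensor !locked_withE (tensor_ord_ren (fun v => elt_in (E v)) (fun v => elt_out (E v))
  E) !ren_comp.
by apply: ren_ext => -[v a]; apply: slotv_inj; rewrite /slotv /= enum_rankK.
Qed.

Lemma tensor_void (V : finType) (h : V <~> void) (y : V -> elt) :
  tensor y = ren (bslot0 h (arin y)) (bslot0 h (arout y)) (onel P).
Proof. by rewrite (tensor_ordE (binv bord0 \b h)) /= ren_comp; apply: ren_ext => -[]. Qed.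

Lemma tensor_opt (V : finType) (y : option V -> elt) :
  tensor y = ren (bcons (arin y)) (bcons (arout y))
    (hc (inn (tagged (y None))) (tensor (y \o some))).
Proof.
rewrite (tensor_ordE (binv (bunlift ord0) \b bopt (brank V))) tensor_ordS {1}/tensor
  locked_withE.
set z := y \o binv _; rewrite hc_renr.
have e : z ord0 = y None by rewrite /z /= unlift_none.
rewrite (inn_elt (esym e) (elt_in (esym e)) (elt_out (esym e))).
have E x : (z \o binv (bunlift ord0) \o some) x = (y \o some \o binv (brank V)) x.
  by rewrite /z /= liftK.
rewrite (tensor_ord_ext (fun v => elt_in (E v)) (fun v => elt_out (E v)) E).
rewrite hc_ren !ren_comp.
by apply: ren_ext => -[a|[v a]]; apply: slotv_inj; rewrite /slotv /= ?liftK ?unlift_none.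
Qed.

Lemma tensor_sum (V W : finType) (y : V + W -> elt) :
  tensor y = ren (bslotD (arin y)) (bslotD (arout y))
    (hc (tensor (y \o inl)) (tensor (y \o inr))).
Proof.
elim/fin_ind: V y => [|V IH|V V' h IH] y.
- rewrite (tensor_void (bid void)) hc_renl hc1
    (@tensor_ren _ _ (bvoid W) (y \o inr) y (fun _ => erefl) (fun _ => erefl)) // !ren_comp.
  by apply: ren_ext => -[v a]; apply: slotv_inj; rewrite /slotv.
- rewrite tensor_opt (@tensor_ren _ _ (binv (boptsum V W)) (y \o binv (boptsum V W)) y
    (fun _ => erefl) (fun _ => erefl)) //.
  rewrite tensor_opt IH !hc_renl !hc_renr hcA !ren_comp.
  by apply: ren_ext => -[[a|[v a]]|[v a]]; apply: slotv_inj; rewrite /slotv.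
- rewrite (@tensor_ren _ _ h (y \o inl \o h) (y \o inl) (fun _ => erefl) (fun _ => erefl)) //.
  rewrite (@tensor_ren _ _ (bsum h (bid W)) (y \o bsum h (bid W)) y (fun _ => erefl)
    (fun _ => erefl)) // IH.
  rewrite hc_renl !ren_comp.
  by apply: ren_ext => -[[v a]|[v a]]; apply: slotv_inj; rewrite /slotv.
Qed.

Lemma tensor_eq (V : finType) (y z : V -> elt)
   (ei : forall i, arin z i = arin y i) (eo : forall i, arout z i = arout y i) :
  (forall i, z i = y i) -> tensor z = ren (bslot (f := bid V) ei) (bslot (f := bid V) eo)
    (tensor y).
Proof. exact: (@tensor_ren _ _ (bid V)). Qed.

Definition bpick (V : finType) (v : V) : option {w : V | w != v} <~> V.
Proof.
apply: (@bij_of _ _ (fun x : option {w : V | w != v} => if x is Some w then val w else v)).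
apply: inj_surj_bij => [[[w h]|] [[w' h']|] //=|w].
- by move=> e; congr Some; exact: val_inj.
- by move=> /= e; case/eqP: (h).
- by move=> /= e; case/eqP: (h').
- by have [->|h] := eqVneq w v; [exists None | exists (Some (exist _ w h))].
Defined.

Definition mkdec (V : finType) (m n : V -> nat) (x : forall v, P (m v) (n v)) (v : V) : elt :=
  mkelt (x v).

(** Isolates the factor at [v] on the left: [C], [D], [f], [g] and [q] do not depend on [p], so
    multilinearity reduces to the linearity of [hc] in its first argument. *)
Lemma tensor_dfwith (V : finType) (m n : V -> nat) (x : forall v, P (m v) (n v)) (v : V) :
  exists (C D : finType) (f : 'I_(m v) + C <~> slot m) (g : 'I_(n v) + D <~> slot n)
    (q : lab P C D),
  forall p : P (m v) (n v), tensor (mkdec (dfwith x p)) = ren f g (hc (inn p) q).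
Proof.
pose z := mkdec x \o bpick v \o some.
exists {: slot (arin z)}, {: slot (arout z)}.
exists (@bslot _ _ (m \o bpick v) m (bpick v) (fun=> erefl) \b bcons (m \o bpick v)).
exists (@bslot _ _ (n \o bpick v) n (bpick v) (fun=> erefl) \b bcons (n \o bpick v)).
exists (tensor z) => p.
rewrite (@tensor_ren _ _ (bpick v) (mkdec (dfwith x p) \o bpick v) (mkdec (dfwith x p))
  (fun=> erefl) (fun=> erefl)) // tensor_opt.
have E u : (mkdec (dfwith x p) \o bpick v \o some) u = z u.
  by case: u => w h; rewrite /z /= /mkdec dfwith_out // eq_sym.
rewrite (@tensor_eq _ z (mkdec (dfwith x p) \o bpick v \o some) (fun=> erefl) (fun=> erefl) E).
have e : mkelt p = mkdec (dfwith x p) v by rewrite /mkdec dfwith_in.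
rewrite (inn_elt e erefl erefl) hc_ren !ren_comp.
by apply: ren_ext => -[a|[w a]]; apply: slotv_inj; rewrite /slotv.
Qed.

Lemma tensor_multi (V : finType) (m n : V -> nat) (x : forall v, P (m v) (n v)) (v : V) a
  (p q : P (m v) (n v)) :
  tensor (mkdec (dfwith x (a *: p + q))) = a *:
    (tensor (mkdec (dfwith x p)) : lab P {: slot m} {: slot n}) + tensor (mkdec (dfwith x q)).
Proof.
have [C [D [f [g [r E]]]]] := tensor_dfwith x v.
by rewrite !E inn_linear hc_linearl ren_linear.
Qed.

Lemma tensor_unit (V : finType) (h : V <~> unit) (y : V -> elt) :
  exists (f : 'I_(arin y (bw h tt)) <~> slot (arin y))
    (g : 'I_(arout y (bw h tt)) <~> slot (arout y)),
  [/\ forall a, slotv (f a) = (bw h tt, val a), forall a, slotv (g a) = (bw h tt, val a)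
    & tensor y = ren f g (inn (tagged (y (bw h tt))))].
Proof.
pose k : option void <~> V := binv (bunitsum void \b (bsumC _ _ \b bvoid unit) \b h).
exists (@bslot _ _ (arin y \o k) (arin y) k (fun=> erefl) \b (bcons (arin y \o k)
  \b binv (bsumv _ (binv (bslot0 (bid void) (arin y \o k \o some)))))).
exists (@bslot _ _ (arout y \o k) (arout y) k (fun=> erefl) \b (bcons (arout y \o k)
  \b binv (bsumv _ (binv (bslot0 (bid void) (arout y \o k \o some)))))).
split=> //.
rewrite (@tensor_ren _ _ k (y \o k) y (fun=> erefl) (fun=> erefl)) // tensor_opt
  (tensor_void (bid void)).
rewrite hc_renr (hcC (onel P)) hc1 !ren_comp.
by apply: ren_ext => a; apply: slotv_inj.
Qed.
End Tensor.

(** * The value of a decorated graph *)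

Section Position.
Variables (A : finType) (V : finType) (f : A -> V) (r : rel A).
Hypothesis fo : fibre_order f r.

(** The rank of [x] inside its own fibre, counted from 0: a fibre order never relates elements of
    different fibres. *)
Definition pos (x : A) : nat := #|[pred y | r y x && (y != x)]|.

Lemma fo_refl x : r x x. Proof. by case: fo. Qed.
Lemma fo_anti x y : r x y -> r y x -> x = y.
Proof. by move=> h h'; case: fo => _ ra _ _; apply: ra; rewrite h h'. Qed.
Lemma fo_trans y x z : r x y -> r y z -> r x z. Proof. by case: fo => _ _ rt _; exact: rt. Qed.
Lemma fo_total x y : f x = f y -> r x y || r y x.
Proof. by case: fo => _ _ _ -> /eqP. Qed.
Lemma fo_fib x y : r x y -> f x = f y.
Proof. by case: fo => _ _ _ rc h; apply/eqP; rewrite -rc h. Qed.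

Lemma pos_mono x y : r x y -> (pos x <= pos y)%N.
Proof.
move=> rxy; apply/subset_leq_card/subsetP => z; rewrite !inE => /andP [rzx zx].
rewrite (fo_trans rzx rxy); apply/eqP => e; subst z.
by move: zx; rewrite (fo_anti rxy rzx) eqxx.
Qed.

Lemma pos_lt x y : r x y -> x != y -> (pos x < pos y)%N.
Proof.
move=> rxy xy; apply/proper_card/properP; split; last first.
  by exists x; rewrite !inE ?rxy ?xy // eqxx andbF.
apply/subsetP => z; rewrite !inE => /andP [rzx zx].
rewrite (fo_trans rzx rxy); apply/eqP => e; subst z.
by move: zx; rewrite (fo_anti rxy rzx) eqxx.
Qed.

Lemma pos_ltn x : (pos x < #|[pred y | f y == f x]|)%N.
Proof.
apply/proper_card/properP; split.
  by apply/subsetP => z; rewrite !inE => /andP [/fo_fib -> _].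
by exists x; rewrite !inE ?eqxx // andbF.
Qed.

Lemma pos_inj x y : f x = f y -> pos x = pos y -> x = y.
Proof.
move=> fxy pxy; apply/eqP; apply: contraT => xy.
case/orP: (fo_total fxy) => h; first by have := pos_lt h xy; rewrite pxy ltnn.
by have := pos_lt h; rewrite eq_sym pxy ltnn => /(_ xy).
Qed.

(** Image and rank determine the order. A map of graphs that respects the vertices and the ranks of
    half-edges therefore respects the planar structure. *)
Lemma posE x y : r x y = (f x == f y) && (pos x <= pos y)%N.
Proof.
apply/idP/andP => [h|[/eqP e h]]; first by rewrite (fo_fib h) eqxx (pos_mono h).
case/orP: (fo_total e) => // h'; have [-> //|yx] := eqVneq y x; first exact: fo_refl.
by have := pos_lt h' yx; rewrite ltnNge h.
Qed.

Definition pos_slot (m : V -> nat) (hm : forall v, #|[pred e | f e == v]| = m v) x : slot m :=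
  Tagged (fun v => 'I_(m v)) (Ordinal (etrans (congr1 _ (esym (hm (f x)))) (pos_ltn x))).

(** Ranks are distinct inside a fibre, and both sides have the sum of the sizes of the fibres as
    cardinal. *)
Lemma pos_slot_bij m hm : bijective (@pos_slot m hm).
Proof.
apply: inj_card_bij => [x y /(congr1 (@slotv _ _)) [e1 e2]|]; first exact: pos_inj.
rewrite card_tagged sumnE big_map big_enum /= -sum1_card.
rewrite (partition_big f predT) //=; apply: eq_leq.
by apply: eq_bigr => v _; rewrite card_ord -hm -sum1_card.
Qed.

Definition bpos m hm : A <~> slot m := bij_of (@pos_slot_bij m hm).
End Position.

Lemma pos_map (A A' : finType) (r : rel A) (r' : rel A') (h : A -> A') :
  bijective h -> (forall x y, r' (h x) (h y) = r x y) -> forall x, pos r' (h x) = pos r x.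
Proof.
move=> hb hr x; rewrite /pos -(card_image (bij_inj hb)); apply: eq_card => y.
have [g gK Kg] := hb; rewrite !inE; apply/idP/imageP => [|[z hz ->]].
  rewrite -(Kg y) hr (inj_eq (bij_inj hb)) => h'; by exists (g y).
by rewrite hr (inj_eq (bij_inj hb)).
Qed.

Section GraphPos.
Variables (V : finS) (ain aout : V -> nat) (k l : nat) (G : pgraph ain aout k l).
Definition posT : gE G + gI G -> nat := pos (rin G).
Definition posS : gE G + gO G -> nat := pos (rout G).
Definition btgt : gE G + gI G <~> slot ain := bpos (rinP G) (ainP G).
Definition bsrc : gE G + gO G <~> slot aout := bpos (routP G) (aoutP G).
Lemma btgtE e : slotv (btgt e) = (tgt G e, posT e). Proof. by []. Qed.
Lemma bsrcE e : slotv (bsrc e) = (src G e, posS e). Proof. by []. Qed.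
Definition balpha : gI G + gIO G <~> 'I_k := bij_of (alpha_bij G).
Definition bbeta : gO G + gIO G <~> 'I_l := bij_of (beta_bij G).
End GraphPos.

Definition bstrand (C : Type) : C <~> slot (fun _ : C => 1%N).
Proof.
exists (fun c : C => existT (fun _ : C => 'I_1 : Type) c ord0) (fun x => tag x) => // -[c a].
by rewrite [a]ord1.
Defined.

(* I, IO, E and L are the inputs, input-output edges, internal edges and loops:
   E + L is what gets traced. *)
Definition bends I IO E L : (I + IO) + (E + L) <~> (E + I) + (IO + L).
Proof.
exists (fun x => match x with
  | inl (inl i) => inl (inr i) | inl (inr j) => inr (inl j)
  | inr (inl e) => inl (inl e) | inr (inr u) => inr (inr u) end)
 (fun x => match x with
  | inl (inr i) => inl (inl i) | inr (inl j) => inl (inr j)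
  | inl (inl e) => inr (inl e) | inr (inr u) => inr (inr u) end).
- by move=> [[]|[]].
- by move=> [[]|[]].
Defined.

Section Value.
Variables (K : fieldType) (X : ssdata K) (P : trap K).
Variable phi : forall k l : nat, X k l -> P k l.

Section Def.
Variables (k l : nat) (D : dgraph X k l).

(* Loops and input-output edges count as additional vertices, decorated by the
   unit of P. *)
Definition gW : finType := (gV D + (gIO D + gL D))%type.
Definition gwin (w : gW) : nat := if w is inl v then gin D v else 1%N.
Definition gwout (w : gW) : nat := if w is inl v then gout D v else 1%N.
Definition gdec (w : gW) : P (gwin w) (gwout w) :=
  match w with inl v => phi (dec D v) | inr _ => trap1 P end.
Definition gelt : gW -> elt P := mkdec gdec.

(** An input of a factor is either an outer input of [D] or the input end of a pair to be traced: an
    internal edge enters its target at its rank there, and an input-output edge or a loop enters the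
    only input of its copy of I. *)
Definition slin : (gI D + gIO D) + (gE D + gL D) <~> slot gwin :=
  bslotD gwin \b bsum (btgt D) (bstrand _) \b bends _ _ _ _.
Definition slout : (gO D + gIO D) + (gE D + gL D) <~> slot gwout :=
  bslotD gwout \b bsum (bsrc D) (bstrand _) \b bends _ _ _ _.

Lemma slinE x : slotv (slin x) = match x with
  | inl (inl i) => (inl (tgt D (inr i)), posT (inr i))
  | inl (inr c) => (inr (inl c), 0%N)
  | inr (inl e) => (inl (tgt D (inl e)), posT (inl e))
  | inr (inr c) => (inr (inr c), 0%N) end.
Proof. by case: x => -[]. Qed.

Lemma sloutE x : slotv (slout x) = match x with
  | inl (inl i) => (inl (src D (inr i)), posS (inr i))
  | inl (inr c) => (inr (inl c), 0%N)
  | inr (inl e) => (inl (src D (inl e)), posS (inl e))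
  | inr (inr c) => (inr (inr c), 0%N) end.
Proof. by case: x => -[]. Qed.

(** The traced pair labelled by an internal edge joins the output slot at its source to the input
    slot at its target; the pair of a loop joins the two ends of one copy of I. *)
Definition core : lab P (gI D + gIO D)%type (gO D + gIO D)%type :=
  mtrace (ren (binv slin) (binv slout) (tensor gelt)).

Definition dval : P k l := out (ren (balpha D) (bbeta D) core).

End Def.
End Value.

(** * Gluing a copy of the unit to an element *)

Section Strand.
Variables (K : fieldType) (P : trap K).

(** The label [f] is brought to [None] by [bpick]; the hypotheses then force the bijections to be
    those of [tr_idl_out]. *)
Lemma tr_strand_out (A B : finType) (p : lab P A B) (f : B) (s : unit + A <~> option A)
  (t : unit + B <~> option B) :
  s (inl tt) = None -> (forall a, s (inr a) = Some a) ->
  t (inl tt) = Some f -> t (inr f) = None -> (forall b, b != f -> t (inr b) = Some b) ->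
  tr (ren s t (hc (idl P) p)) = p.
Proof.
move=> s0 sS t0 tf tS; pose h := bpick f.
have [q ->] := ren_surj (bid A) h p.
rewrite -{2}(tr_idl_out q) -tr_ren hc_renr !ren_comp; congr (tr _).
apply: ren_ext => -[[]|]; rewrite ?fwE ?s0 //.
by move=> [[b bf]|] /=; [rewrite tS | exact: tf].
Qed.

Lemma tr_strand_in (A B : finType) (p : lab P A B) (f : A) (s : unit + A <~> option A)
  (t : unit + B <~> option B) :
  t (inl tt) = None -> (forall a, t (inr a) = Some a) ->
  s (inl tt) = Some f -> s (inr f) = None -> (forall b, b != f -> s (inr b) = Some b) ->
  tr (ren s t (hc (idl P) p)) = p.
Proof.
move=> s0 sS t0 tf tS; pose h := bpick f.
have [q ->] := ren_surj h (bid B) p.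
rewrite -{2}(tr_idl_in q) -tr_ren hc_renr !ren_comp; congr (tr _).
apply: ren_ext => -[[]|]; rewrite ?fwE ?s0 //.
by move=> [[b bf]|] /=; [rewrite tS | exact: tf].
Qed.

(** Splits off the unit factor at the vertex [g None]. The equations on [slotv] are all that is kept
    of [F] and [G], and they determine them because [slotv] is injective. *)
Lemma tensor_strand (W W' : finType) (y : W -> elt P) (y' : W' -> elt P) (g : option W' <~> W) :
  y (g None) = mkelt (trap1 P) -> (forall w, y (g (Some w)) = y' w) ->
  exists (F : unit + slot (arin y') <~> slot (arin y))
    (G : unit + slot (arout y') <~> slot (arout y)),
  [/\ slotv (F (inl tt)) = (g None, 0%N), forall s,
    slotv (F (inr s)) = (g (Some (slotv s).1), (slotv s).2),
      slotv (G (inl tt)) = (g None, 0%N), forall s,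
        slotv (G (inr s)) = (g (Some (slotv s).1), (slotv s).2)
    & tensor y = ren F G (hc (idl P) (tensor y'))].
Proof.
move=> y0 yS; pose z := y \o g; have z0 : mkelt (trap1 P) = z None by rewrite /z /= y0.
have zS u : (z \o some) u = y' u by rewrite /z /= yS.
have e1 := elt_in z0.
have e2 := elt_out z0.
pose zi v : arin (z \o some) v = arin y' v := elt_in (zS v).
pose zo v : arout (z \o some) v = arout y' v := elt_out (zS v).
exists (@bslot _ _ (arin z) (arin y) g (fun=> erefl) \b bcons (arin z) \b
   bsum (bcast e1 \b binv bord1) (bslot (f := bid W') zi)).
exists (@bslot _ _ (arout z) (arout y) g (fun=> erefl) \b bcons (arout z) \b
   bsum (bcast e2 \b binv bord1) (bslot (f := bid W') zo)).
split=> [|[s a]||[s a]|] //.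
rewrite (@tensor_ren _ _ _ _ g z y (fun=> erefl) (fun=> erefl)) // tensor_opt
  (inn_elt z0 e1 e2) /=.
rewrite (tensor_eq zi zo zS) inn_trap1 hc_ren hc_renl !ren_comp.
by apply: ren_ext => -[a|[w a]].
Qed.
End Strand.

Lemma bw_eq A B (f : A <~> B) a b : f a = b -> bw f b = a.
Proof. by move=> <-; rewrite fwK. Qed.

(** * The value under isomorphism, cutting and absorption of a strand *)

Section Compat.
Variables (K : fieldType) (X : ssdata K) (P : trap K).
Variable phi : forall k l : nat, X k l -> P k l.

(** Only slots matter: the tensor products agree by [tensor_ren], so it suffices that the
    relabellings carry each end to the slot at the corresponding vertex with the same position. *)
Lemma core_map k l k' l' (D : dgraph X k l) (D' : dgraph X k' l') (g : gW D <~> gW D')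
    (kI : gI D + gIO D <~> gI D' + gIO D') (kO : gO D + gIO D <~> gO D' + gIO D')
    (c : gE D + gL D <~> gE D' + gL D') :
  (forall w, gelt phi (g w) = gelt phi w) ->
  (forall z, slotv (slin D' (bsum kI c z)) = (g (slotv (slin D z)).1, (slotv (slin D z)).2)) ->
  (forall z, slotv (slout D' (bsum kO c z)) =
    (g (slotv (slout D z)).1, (slotv (slout D z)).2)) ->
  core phi D' = ren kI kO (core phi D).
Proof.
move=> ey sI sO; rewrite /core -(mtrace_ren _ _ c).
rewrite (tensor_ren (fun w => elt_in (ey w)) (fun w => elt_out (ey w)) ey).
rewrite !ren_comp; congr mtrace; apply: ren_ext => y.
- rewrite -[y](bwK (slin D)); move: (bw _ y) => z.
  apply: (etrans (bw_eq (a := bsum kI c z) _));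
    last exact: (congr1 (bsum kI c) (esym (fwK (slin D) z))).
  by apply: slotv_inj; rewrite sI.
- rewrite -[y](bwK (slout D)); move: (bw _ y) => z.
  apply: (etrans (bw_eq (a := bsum kO c z) _));
    last exact: (congr1 (bsum kO c) (esym (fwK (slout D) z))).
  by apply: slotv_inj; rewrite sO.
Qed.

Lemma dval_out k l (D : dgraph X k l) (k' l' : nat) (D' : dgraph X k' l')
   (kI : gI D + gIO D <~> gI D' + gIO D') (kO : gO D + gIO D <~> gO D' + gIO D')
   (f : 'I_k <~> 'I_k') (g : 'I_l <~> 'I_l') :
  core phi D' = ren kI kO (core phi D) ->
  (forall x, alpha D' (kI x) = f (alpha D x)) -> (forall x, beta D' (kO x) = g (beta D x)) ->
  dval phi D' = relab f g (dval phi D).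
Proof.
move=> e ea eb; apply: (can_inj (@innK _ _ _ _)); rewrite inn_relab !outK e !ren_comp.
by apply: ren_ext => x; rewrite /= ?ea ?eb.
Qed.

(** Transports an equality of decorations from [X] to [P], arities included, so that [diso_dec] can
    be used through [congr1]. *)
Definition liftelt (x : {n : nat * nat & X n.1 n.2 : Type}) : elt P := mkelt (phi (tagged x)).

Lemma dval_iso k l (D D' : dgraph X k l) : diso D D' -> dval phi D = dval phi D'.
Proof.
move=> i; pose bfV := bij_of (fV_bij i).
have TT e : tgt D' (sum_map (fE i) (fI i) e) = fV i (tgt D e) by exact: diso_tgt.
have PT e : posT (sum_map (fE i) (fI i) e) = posT e.
  by apply: (pos_map (sum_map_bij (fE_bij i) (fI_bij i))); exact: diso_rin.
have PS e : posS (sum_map (fE i) (fO i) e) = posS e.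
  by apply: (pos_map (sum_map_bij (fE_bij i) (fO_bij i))); exact: diso_rout.
pose bI := bij_of (fI_bij i). pose bO := bij_of (fO_bij i). pose bE := bij_of (fE_bij i).
pose bIO := bij_of (fIO_bij i). pose bL := bij_of (fL_bij i).
rewrite (@dval_out _ _ D _ _ D' (bsum bI bIO) (bsum bO bIO) (bid _) (bid _)).
- by rewrite relab_id.
- apply: (@core_map _ _ _ _ D D' (bsum bfV (bsum bIO bL)) _ _ (bsum bE bL)).
  + move=> [v|//]; exact: (congr1 liftelt (diso_dec i v)).
  + by move=> [[e|e]|[e|e]]; rewrite !slinE //= -?PT -?diso_tgt.
  + by move=> [[e|e]|[e|e]]; rewrite !sloutE //= -?PS -?diso_src.
- by move=> x; rewrite -(diso_alpha i).
- by move=> x; rewrite -(diso_beta i).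
Qed.

Lemma dval_ptr k l (D : dgraph X k.+1 l.+1) (D' : dgraph X k l) i j
    (kI : gI D + gIO D <~> option (gI D' + gIO D'))
      (kO : gO D + gIO D <~> option (gO D' + gIO D')) :
  core phi D' = tr (ren kI kO (core phi D)) ->
  alpha D (bw kI None) = i -> (forall x, alpha D (bw kI (Some x)) = lift i (alpha D' x)) ->
  beta D (bw kO None) = j -> (forall x, beta D (bw kO (Some x)) = lift j (beta D' x)) ->
  dval phi D' = ptr i j (dval phi D).
Proof.
move=> e a0 aS b0 bS; apply: (can_inj (@innK _ _ _ _));
  rewrite inn_ptr !outK e -tr_ren !ren_comp.
congr tr; apply: ren_ext => x.
- by rewrite -[x](fwK kI) !fwE bwK; case: (kI x) => [y|] /=;
    rewrite ?aS ?a0 ?liftK ?unlift_none.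
- by rewrite -[x](fwK kO) !fwE bwK; case: (kO x) => [y|] /=;
    rewrite ?bS ?b0 ?liftK ?unlift_none.
Qed.

(** Sends an end in the glued graph to the end in [D] it comes from. The traced pair that [c] maps
    to [None] is the new one; its end in [D] is the outer end being glued. *)
Definition cutmap A B C C' (k : A <~> option B) (c : C' <~> option C) (z : B + C') : A + C :=
  match z with
  | inl x => inl (bw k (Some x))
  | inr u => if c u is Some v then inr v else inl (bw k None)
  end.

(* D' has the same half-edges as D, with one more traced pair: None on both sides. *)
Lemma dval_cut k l (D : dgraph X k.+1 l.+1) (D' : dgraph X k l) i j
    (g : gW D' <~> gW D) (c : gE D' + gL D' <~> option (gE D + gL D))
    (kI : gI D + gIO D <~> option (gI D' + gIO D'))
      (kO : gO D + gIO D <~> option (gO D' + gIO D')) :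
  (forall w, gelt phi (g w) = gelt phi w) ->
  (forall z, slotv (slin D (cutmap kI c z)) =
    (g (slotv (slin D' z)).1, (slotv (slin D' z)).2)) ->
  (forall z, slotv (slout D (cutmap kO c z)) =
    (g (slotv (slout D' z)).1, (slotv (slout D' z)).2)) ->
  alpha D (bw kI None) = i -> (forall x, alpha D (bw kI (Some x)) = lift i (alpha D' x)) ->
  beta D (bw kO None) = j -> (forall x, beta D (bw kO (Some x)) = lift j (beta D' x)) ->
  dval phi D' = ptr i j (dval phi D).
Proof.
move=> ey sI sO a0 aS b0 bS; apply: (dval_ptr (kI := kI) (kO := kO)) => //.
rewrite /core -(mtrace_ren _ _ (bid _)) tr_mtrace.
rewrite (tensor_ren (fun w => elt_in (ey w)) (fun w => elt_out (ey w)) ey).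
(* On the left the extra pair is singled out by [c]; on the right it is the pair of the outer trace,
   already moved inside by [tr_mtrace]. Only label bijections remain to be compared. *)
rewrite -[LHS](ren_id (f := bid _) (g := bid _)) // -(mtrace_ren _ _ c) mtrace_opt !ren_comp.
congr (mtrace (tr _)); apply: ren_ext => y.
- rewrite -[y](bwK (slin D')); move: (bw _ y) => z.
  transitivity (boptsum _ (gE D + gL D)%type (bsum kI (bid _) (cutmap kI c z))).
    rewrite -[LHS]/(bsumo _ _ (bsum (bid _) c (bw (slin D') (slin D' z)))) fwK.
    case: z => [x|u] /=; first by rewrite bwK.
    by case: (c u) => //=; rewrite bwK.
  by congr (boptsum _ _ (bsum _ _ _)); apply/esym/bw_eq/slotv_inj; rewrite sI.
- rewrite -[y](bwK (slout D')); move: (bw _ y) => z.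
  transitivity (boptsum _ (gE D + gL D)%type (bsum kO (bid _) (cutmap kO c z))).
    rewrite -[LHS]/(bsumo _ _ (bsum (bid _) c (bw (slout D') (slout D' z)))) fwK.
    case: z => [x|u] /=; first by rewrite bwK.
    by case: (c u) => //=; rewrite bwK.
  by congr (boptsum _ _ (bsum _ _ _)); apply/esym/bw_eq/slotv_inj; rewrite sO.
Qed.

(* The copy of I at g None has its input glued to an output; that output, f in D',
   takes over the place of the output of I. *)
Lemma dval_strand_out k l (D : dgraph X k.+1 l.+1) (D' : dgraph X k l) i j
    (g : option (gW D') <~> gW D) (c : gE D' + gL D' <~> gE D + gL D) f
    (kI : gI D + gIO D <~> option (gI D' + gIO D'))
      (kO : gO D + gIO D <~> option (gO D' + gIO D')) :
  gelt phi (g None) = mkelt (trap1 P) -> (forall w, gelt phi (g (Some w)) = gelt phi w) ->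
  slotv (slin D (inl (bw kI None))) = (g None, 0%N) ->
  (forall x, slotv (slin D (inl (bw kI (Some x)))) =
    (g (Some (slotv (slin D' (inl x))).1), (slotv (slin D' (inl x))).2)) ->
  (forall u, slotv (slin D (inr (c u))) = (g (Some (slotv (slin D' (inr u))).1),
    (slotv (slin D' (inr u))).2)) ->
  slotv (slout D (inl (bw kO None))) = (g (Some (slotv (slout D' (inl f))).1),
    (slotv (slout D' (inl f))).2) ->
  slotv (slout D (inl (bw kO (Some f)))) = (g None, 0%N) ->
  (forall x, x != f -> slotv (slout D (inl (bw kO (Some x)))) =
    (g (Some (slotv (slout D' (inl x))).1), (slotv (slout D' (inl x))).2)) ->
  (forall u, slotv (slout D (inr (c u))) = (g (Some (slotv (slout D' (inr u))).1),
    (slotv (slout D' (inr u))).2)) ->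
  alpha D (bw kI None) = i -> (forall x, alpha D (bw kI (Some x)) = lift i (alpha D' x)) ->
  beta D (bw kO None) = j -> (forall x, beta D (bw kO (Some x)) = lift j (beta D' x)) ->
  dval phi D' = ptr i j (dval phi D).
Proof.
move=> ey0 ey sI0 sI sIc sO0 sOf sO sOc a0 aS b0 bS;
  apply: (dval_ptr (kI := kI) (kO := kO)) => //.
rewrite /core -(mtrace_ren _ _ (bid _)) tr_mtrace -[LHS](ren_id (f := bid _) (g := bid _)) //
  -(mtrace_ren _ _ c).
have [F [G [F0 FS G0 GS ->]]] := tensor_strand ey0 ey.
set y' := tensor _; congr mtrace; rewrite !ren_comp.
set a := (X in ren X _ y'); set b := (X in ren _ X y').
(* The tensor product of [D'] is written in outer and traced labels instead of slots, so that the
   right-hand side gets the form of [tr_strand_out]; what remains are the five conditions of that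
   lemma on labels. *)
have -> : y' = ren (binv a) (binv b) (ren a b y') by rewrite renK.
rewrite renKV hc_renr ren_comp.
have bwI z u : slotv (slin D z) = slotv (F u) -> bw (slin D) (F u) = z.
  by move=> e; apply/bw_eq/slotv_inj.
have bwO z u : slotv (slout D z) = slotv (G u) -> bw (slout D) (G u) = z.
  by move=> e; apply/bw_eq/slotv_inj.
have binl x : bw a (inl x) = slin D' (inl x) by apply: bw_eq;
  rewrite -[LHS]/(bsum (bid _) c (bw (slin D') (slin D' (inl x)))) fwK.
have binr u : bw a (inr (c u)) = slin D' (inr u) by apply: bw_eq;
  rewrite -[LHS]/(bsum (bid _) c (bw (slin D') (slin D' (inr u)))) fwK.
have bonl x : bw b (inl x) = slout D' (inl x) by apply: bw_eq;
  rewrite -[LHS]/(bsum (bid _) c (bw (slout D') (slout D' (inl x)))) fwK.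
have bonr u : bw b (inr (c u)) = slout D' (inr u) by apply: bw_eq;
  rewrite -[LHS]/(bsum (bid _) c (bw (slout D') (slout D' (inr u)))) fwK.
apply/esym/(@tr_strand_out _ _ _ _ _ (inl f)) => [|z|||z hz].
- transitivity (boptsum _ (gE D + gL D)%type (bsum kI (bid _) (bw (slin D) (F (inl tt)))));
    first by [].
  by rewrite (bwI (inl (bw kI None))) ?F0 //= bwK.
- transitivity (boptsum _ (gE D + gL D)%type (bsum kI (bid _)
    (bw (slin D) (F (inr (bw a z)))))); first by [].
  case: z => [x|u]; first by rewrite binl (bwI (inl (bw kI (Some x)))) /= ?bwK // FS sI.
  by rewrite -[u](bwK c) binr (bwI (inr (c (bw c u)))) // FS sIc.
- transitivity (boptsum _ (gE D + gL D)%type (bsum kO (bid _) (bw (slout D) (G (inl tt)))));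
    first by [].
  by rewrite (bwO (inl (bw kO (Some f)))) ?G0 //= bwK.
- transitivity (boptsum _ (gE D + gL D)%type (bsum kO (bid _)
    (bw (slout D) (G (inr (bw b (inl f))))))); first by [].
  by rewrite bonl (bwO (inl (bw kO None))) /= ?bwK // GS sO0.
- transitivity (boptsum _ (gE D + gL D)%type (bsum kO (bid _)
    (bw (slout D) (G (inr (bw b z)))))); first by [].
  case: z hz => [x xf|u _]; last by rewrite -[u](bwK c) bonr (bwO (inr (c (bw c u)))) // GS sOc.
  by rewrite bonl (bwO (inl (bw kO (Some x)))) /= ?bwK // GS sO.
Qed.

(** Mirror image: the output of the copy of I at [g None] is glued to an input, and that input, [f]
    in [D'], takes over the place of the input of the copy of I. *)
Lemma dval_strand_in k l (D : dgraph X k.+1 l.+1) (D' : dgraph X k l) i j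
    (g : option (gW D') <~> gW D) (c : gE D' + gL D' <~> gE D + gL D) f
    (kI : gI D + gIO D <~> option (gI D' + gIO D'))
      (kO : gO D + gIO D <~> option (gO D' + gIO D')) :
  gelt phi (g None) = mkelt (trap1 P) -> (forall w, gelt phi (g (Some w)) = gelt phi w) ->
  slotv (slout D (inl (bw kO None))) = (g None, 0%N) ->
  (forall x, slotv (slout D (inl (bw kO (Some x)))) =
    (g (Some (slotv (slout D' (inl x))).1), (slotv (slout D' (inl x))).2)) ->
  (forall u, slotv (slout D (inr (c u))) = (g (Some (slotv (slout D' (inr u))).1),
    (slotv (slout D' (inr u))).2)) ->
  slotv (slin D (inl (bw kI None))) = (g (Some (slotv (slin D' (inl f))).1),
    (slotv (slin D' (inl f))).2) ->
  slotv (slin D (inl (bw kI (Some f)))) = (g None, 0%N) ->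
  (forall x, x != f -> slotv (slin D (inl (bw kI (Some x)))) =
    (g (Some (slotv (slin D' (inl x))).1), (slotv (slin D' (inl x))).2)) ->
  (forall u, slotv (slin D (inr (c u))) = (g (Some (slotv (slin D' (inr u))).1),
    (slotv (slin D' (inr u))).2)) ->
  alpha D (bw kI None) = i -> (forall x, alpha D (bw kI (Some x)) = lift i (alpha D' x)) ->
  beta D (bw kO None) = j -> (forall x, beta D (bw kO (Some x)) = lift j (beta D' x)) ->
  dval phi D' = ptr i j (dval phi D).
Proof.
move=> ey0 ey sO0 sO sOc sI0 sIf sI sIc a0 aS b0 bS;
  apply: (dval_ptr (kI := kI) (kO := kO)) => //.
rewrite /core -(mtrace_ren _ _ (bid _)) tr_mtrace -[LHS](ren_id (f := bid _) (g := bid _)) //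
  -(mtrace_ren _ _ c).
have [F [G [F0 FS G0 GS ->]]] := tensor_strand ey0 ey.
set y' := tensor _; congr mtrace; rewrite !ren_comp.
set a := (X in ren X _ y'); set b := (X in ren _ X y').
have -> : y' = ren (binv a) (binv b) (ren a b y') by rewrite renK.
rewrite renKV hc_renr ren_comp.
have bwI z u : slotv (slin D z) = slotv (F u) -> bw (slin D) (F u) = z.
  by move=> e; apply/bw_eq/slotv_inj.
have bwO z u : slotv (slout D z) = slotv (G u) -> bw (slout D) (G u) = z.
  by move=> e; apply/bw_eq/slotv_inj.
have binl x : bw a (inl x) = slin D' (inl x) by apply: bw_eq;
  rewrite -[LHS]/(bsum (bid _) c (bw (slin D') (slin D' (inl x)))) fwK.
have binr u : bw a (inr (c u)) = slin D' (inr u) by apply: bw_eq;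
  rewrite -[LHS]/(bsum (bid _) c (bw (slin D') (slin D' (inr u)))) fwK.
have bonl x : bw b (inl x) = slout D' (inl x) by apply: bw_eq;
  rewrite -[LHS]/(bsum (bid _) c (bw (slout D') (slout D' (inl x)))) fwK.
have bonr u : bw b (inr (c u)) = slout D' (inr u) by apply: bw_eq;
  rewrite -[LHS]/(bsum (bid _) c (bw (slout D') (slout D' (inr u)))) fwK.
apply/esym/(@tr_strand_in _ _ _ _ _ (inl f)) => [|z|||z hz].
- transitivity (boptsum _ (gE D + gL D)%type (bsum kO (bid _) (bw (slout D) (G (inl tt)))));
    first by [].
  by rewrite (bwO (inl (bw kO None))) ?G0 //= bwK.
- transitivity (boptsum _ (gE D + gL D)%type (bsum kO (bid _)
    (bw (slout D) (G (inr (bw b z)))))); first by [].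
  case: z => [x|u]; first by rewrite bonl (bwO (inl (bw kO (Some x)))) /= ?bwK // GS sO.
  by rewrite -[u](bwK c) bonr (bwO (inr (c (bw c u)))) // GS sOc.
- transitivity (boptsum _ (gE D + gL D)%type (bsum kI (bid _) (bw (slin D) (F (inl tt)))));
    first by [].
  by rewrite (bwI (inl (bw kI (Some f)))) ?F0 //= bwK.
- transitivity (boptsum _ (gE D + gL D)%type (bsum kI (bid _)
    (bw (slin D) (F (inr (bw a (inl f))))))); first by [].
  by rewrite binl (bwI (inl (bw kI None))) /= ?bwK // FS sI0.
- transitivity (boptsum _ (gE D + gL D)%type (bsum kI (bid _)
    (bw (slin D) (F (inr (bw a z)))))); first by [].
  case: z hz => [x xf|u _]; last by rewrite -[u](bwK c) binr (bwI (inr (c (bw c u)))) // FS sIc.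
  by rewrite binl (bwI (inl (bw kI (Some x)))) /= ?bwK // FS sI.
Qed.
End Compat.

(** * The value of a glued graph *)

Section GluePos.
Variables (V : finS) (ain aout : V -> nat) (k l k' l' : nat).
Variables (G : pgraph ain aout k l) (E I O IO L : finS).
Variables (hT : E + I -> gE G + gI G) (hS : E + O -> gE G + gO G).
Variables (a : I + IO -> 'I_k') (b : O + IO -> 'I_l').
Hypotheses (hTb : bijective hT) (hSb : bijective hS).
Hypotheses (ab : bijective a) (bb : bijective b).
Let G' := rewire L hTb hSb ab bb.

Lemma posT_rewire (e : E + I) : posT (e : gE G' + gI G') = posT (hT e).
Proof. by apply/esym; apply: (@pos_map _ _ (relpre hT (rin G)) _ hT hTb). Qed.

Lemma posS_rewire (e : E + O) : posS (e : gE G' + gO G') = posS (hS e).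
Proof. by apply/esym; apply: (@pos_map _ _ (relpre hS (rout G)) _ hS hSb). Qed.
End GluePos.

Definition brest (A : finS) (a : A) : A <~> option (rest a) := binv (bpick a).

Definition btperm (A : finType) (x y : A) : A <~> A := Bij (tpermK x y) (tpermK x y).

Section Glue.
Variables (K : fieldType) (X : ssdata K) (P : trap K).
Variable phi : forall k l : nat, X k l -> P k l.
Variables (k l : nat) (D : dgraph X k.+1 l.+1).

Lemma dval_glue_internal (a : gI D) (b : gO D) :
  dval phi (@dgraph_glue _ _ _ _ D (inl a) (inl b)) = ptr (alpha D (inl a)) (beta D (inl b))
    (dval phi D).
Proof.
pose D' := @dgraph_glue _ _ _ _ D (inl a) (inl b).
apply: (@dval_cut _ _ _ _ _ _ D D' _ _ (bid (gW D)) (boptsum (gE D) (gL D))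
   (boptsum (rest a) (gIO D) \b bsum (brest a) (bid (gIO D)))
   (boptsum (rest b) (gIO D) \b bsum (brest b) (bid (gIO D)))).
- by [].
- by move=> [[x|x]|[[x|]|x]]; rewrite !slinE //= posT_rewire.
- by move=> [[x|x]|[[x|]|x]]; rewrite !sloutE //= posS_rewire.
- by [].
- by case=> x; rewrite /= lift_drop.
- by [].
- by case=> x; rewrite /= lift_drop.
Qed.

Lemma dval_glue_loop (a : gIO D) :
  dval phi (@dgraph_glue _ _ _ _ D (inr a) (inr a)) = ptr (alpha D (inr a)) (beta D (inr a))
    (dval phi D).
Proof.
pose D' := @dgraph_glue _ _ _ _ D (inr a) (inr a).
(* The set of loops of the glued graph is a conditional on whether [f] is [inr a]; [inhabited]
   allows rewriting that condition before the bijection is chosen. *)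
have [cL] : inhabited (gL D' <~> option (gL D)).
  by rewrite /= eqxx; exists; exact: bid.
(* The copy of I at the input-output edge [a] becomes the copy at the new loop, which [cL] sends to
   [None]. *)
pose h : rest a + gL D' <~> gIO D + gL D :=
  bsum (binv (brest a)) (bid _) \b binv (boptsum _ _) \b bsumo _ _ \b bsum (bid _) cL.
apply: (@dval_cut _ _ _ _ _ _ D D' _ _ (bsum (bid (gV D)) h) (bsumo _ _ \b bsum (bid (gE D)) cL)
   (bsumo _ _ \b bsum (bid (gI D)) (brest a))
   (bsumo _ _ \b bsum (bid (gO D)) (brest a))).
- by case.
- by move=> [[x|x]|[x|x]]; rewrite ?slinE /= ?posT_rewire //; case: (cL x).
- by move=> [[x|x]|[x|x]]; rewrite ?sloutE /= ?posS_rewire //; case: (cL x).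
- by [].
- by case=> x; rewrite /= lift_drop.
- by [].
- by case=> x; rewrite /= lift_drop /io_beta //=; case: eqP => // -[e]; case/eqP: (valP x).
Qed.

(** One argument for both kinds of [f]: the copy of I at [a] is absorbed, whatever carries [f]
    survives, and its output takes the number of the output of [a]. *)
Lemma dval_glue_io (a : gIO D) (f : gO D + gIO D) : f != inr a ->
  dval phi (@dgraph_glue _ _ _ _ D (inr a) f) = ptr (alpha D (inr a)) (beta D f) (dval phi D).
Proof.
move=> fa; pose D' := @dgraph_glue _ _ _ _ D (inr a) f.
have [cL] : inhabited (gL D' <~> gL D).
  by rewrite /= (negPf fa); exists; exact: bid.
pose g : gV D + (gIO D + gL D) <~> option (gV D + (rest a + gL D')) :=
  bsumo _ _ \b bsum (bid _) (boptsum _ _ \b bsum (brest a) (binv cL)).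
have [f' fE] := io_surj fa.
pose k0 B : B + gIO D <~> option (B + rest a) := bsumo _ _ \b bsum (bid B) (brest a).
have kS (x : gO D + rest a) : bw (k0 (gO D)) (Some x) = sum_map id val x by case: x.
(* The transposition acts on outputs: [f] is the output that gets traced, and the output of [a] is
   the one that survives, under the label [f']. *)
apply: (@dval_strand_out _ _ _ _ _ _ D D' _ _ (binv g) (bsum (bid _) cL) f' (k0 _)
   (k0 _ \b btperm (inr a) f)).
- by [].
- by move=> [v|[c|c]].
- by rewrite slinE.
- by move=> [x|x]; rewrite !slinE //= posT_rewire.
- by move=> [x|x]; rewrite !slinE //= ?posT_rewire ?fwK.
- have -> : bw (k0 _ \b btperm (inr a) f) None = sum_map id val f' by rewrite fE; exact: tpermL.
  by case: (f') => x; rewrite !sloutE //= posS_rewire.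
- have -> : bw (k0 _ \b btperm (inr a) f) (Some f') = inr a.
    by rewrite -[LHS]/(tperm (inr a) f (bw (k0 _) (Some f'))) kS fE tpermR.
  by rewrite sloutE.
- move=> x xf; have -> : bw (k0 _ \b btperm (inr a) f) (Some x) = sum_map id val x.
    rewrite -[LHS]/(tperm (inr a) f (bw (k0 _) (Some x))) kS tpermD //.
      by rewrite eq_sym io_sum_ne.
    by apply: contra xf; rewrite -fE => /eqP /(sum_map_inj (fun _ _ h => h) val_inj) ->.
  by case: (x) => y; rewrite !sloutE //= posS_rewire.
- by move=> [x|x]; rewrite !sloutE //= ?posS_rewire ?fwK.
- by [].
- by case=> x; rewrite /= lift_drop.
- by rewrite -[bw _ _]/(tperm (inr a) f (inr a)) tpermL.
- move=> x; rewrite lift_drop /io_beta -[bw _ _]/(tperm (inr a) f (bw (k0 _) (Some x))) kS.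
  case: eqP => [->|/eqP xf]; first by rewrite tpermR.
  by rewrite tpermD // eq_sym // io_sum_ne.
Qed.

Lemma dval_glue_oi (a : gI D) (b : gIO D) :
  dval phi (@dgraph_glue _ _ _ _ D (inl a) (inr b)) = ptr (alpha D (inl a)) (beta D (inr b))
    (dval phi D).
Proof.
pose D' := @dgraph_glue _ _ _ _ D (inl a) (inr b).
pose g : gV D + (gIO D + gL D) <~> option (gV D + (rest b + gL D')) :=
  bsumo _ _ \b bsum (bid _) (boptsum _ _ \b bsum (brest b) (bid _)).
pose f' : gI D + rest b := inl a.
pose k0 B : B + gIO D <~> option (B + rest b) := bsumo _ _ \b bsum (bid B) (brest b).
have kS (x : gI D + rest b) : bw (k0 (gI D)) (Some x) = sum_map id val x by case: x.
(* The same exchange on inputs: the input [a] is traced, and the input of [b] survives under the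
   label [f']. *)
pose kI := k0 (gI D) \b btperm (inr b) (inl a).
have kI0 : bw kI None = inl a by exact: tpermL.
have kIf : bw kI (Some f') = inr b by exact: tpermR.
have kIS x : x != f' -> bw kI (Some x) = sum_map id val x.
  move=> xf; rewrite -[LHS]/(tperm (inr b) (inl a) (bw (k0 _) (Some x))) kS tpermD //.
    by rewrite eq_sym oi_sum_ne.
  apply: contra xf; rewrite -[inl a]/(sum_map id val (f' : gI D + rest b)) => /eqP.
  by move=> /(sum_map_inj (fun _ _ h => h) val_inj) ->.
apply: (@dval_strand_in _ _ _ _ _ _ D D' _ _ (binv g) (bid _) f' kI (k0 _)).
- by [].
- by move=> [v|[c|c]].
- by rewrite sloutE.
- by move=> [x|x]; rewrite !sloutE //= posS_rewire.
- by move=> [x|x]; rewrite !sloutE //= ?posS_rewire.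
- by rewrite kI0 !slinE /= posT_rewire.
- by rewrite kIf slinE.
- by move=> x xf; rewrite kIS //; case: (x) => y; rewrite !slinE //= posT_rewire.
- by move=> [x|x]; rewrite !slinE //= ?posT_rewire.
- by rewrite kI0.
- move=> x; rewrite lift_drop /oi_alpha; have [->|xf] := eqVneq x f'; first by rewrite kIf eqxx.
  rewrite kIS // ifN //; apply: contra xf; rewrite
    -[inl a]/(sum_map id val (f' : gI D + rest b)) => /eqP.
  by move=> /(sum_map_inj (fun _ _ h => h) val_inj) ->.
- by [].
- by case=> x; rewrite /= lift_drop.
Qed.

Lemma dval_tr i j : dval phi (dgraph_tr i j D) = ptr i j (dval phi D).
Proof.
rewrite /dgraph_tr /pgraph_tr -[in RHS](bij_invK (alpha_bij D) i)
  -[in RHS](bij_invK (beta_bij D) j).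
move: (bij_inv _ i) (bij_inv _ j) => e f; case: e => [a|a]; last first.
  by have [->|fa] := eqVneq f (inr a); [exact: dval_glue_loop | exact: dval_glue_io].
by case: f => b; [exact: dval_glue_internal | exact: dval_glue_oi].
Qed.
End Glue.

(** * The value under the actions and unions, and its multilinearity *)

Definition bsum4 A C A' C' : (A + C) + (A' + C') <~> (A + A') + (C + C') :=
  @Bij _ _ (@shuffle A C A' C') (@shuffle A A' C C') (@shuffleK _ _ _ _) (@shuffleK _ _ _ _).

Lemma hc_mtrace2 (K : fieldType) (P : trap K) (A B C A' B' C' : finType)
   (p : lab P (A + C)%type (B + C)%type) (q : lab P (A' + C')%type (B' + C')%type) :
  hc (mtrace p) (mtrace q) = mtrace (ren (bsum4 _ _ _ _) (bsum4 _ _ _ _) (hc p q)).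
Proof.
rewrite hc_mtrace (hcC (mtrace q)) hc_mtrace ren_comp -(mtrace_ren _ _ (bid _)) mtrace_mtrace
  (hcC p) !ren_comp.
by congr mtrace; apply: ren_ext => -[[]|[]].
Qed.

(** A rank counts predecessors, so an order-preserving injection keeps it as soon as its image is
    closed under predecessors; this is the situation of one graph inside a union. *)
Lemma pos_map_inj (A A' : finType) (r : rel A) (r' : rel A') (h : A -> A') :
  injective h -> (forall x y, r' (h x) (h y) = r x y) ->
  (forall x y', r' y' (h x) -> exists y, y' = h y) -> forall x, pos r' (h x) = pos r x.
Proof.
move=> hI hr hc x; rewrite /pos -(card_image hI); apply: eq_card => y.
rewrite !inE; apply/idP/imageP => [|[z hz ->]]; last by rewrite hr (inj_eq hI).
by case/andP=> r1; have [z e] := hc _ _ r1; move: r1; rewrite e hr (inj_eq hI) => r1 r2;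
  exists z; rewrite ?inE ?r1.
Qed.

Section UnionPos.
Variables (V V' : finS) (ain aout : V -> nat) (ain' aout' : V' -> nat).
Variables (k l k' l' : nat) (G : pgraph ain aout k l) (G' : pgraph ain' aout' k' l').
Let U := pgraph_union G G'.

Lemma posT_unionl e : posT (sum_map inl inl e : gE U + gI U) = posT e.
Proof.
apply: (@pos_map_inj _ _ (rin G) (rin U) (sum_map inl inl)).
- by move=> [x|x] [y|y] //= [->].
- by move=> [x|x] [y|y].
- by move=> [x|x] [[y|y]|[y|y]] //= _; first [by exists (inl y) | by exists (inr y)].
Qed.

Lemma posT_unionr e : posT (sum_map inr inr e : gE U + gI U) = posT e.
Proof.
apply: (@pos_map_inj _ _ (rin G') (rin U) (sum_map inr inr)).
- by move=> [x|x] [y|y] //= [->].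
- by move=> [x|x] [y|y].
- by move=> [x|x] [[y|y]|[y|y]] //= _; first [by exists (inl y) | by exists (inr y)].
Qed.

Lemma posS_unionl e : posS (sum_map inl inl e : gE U + gO U) = posS e.
Proof.
apply: (@pos_map_inj _ _ (rout G) (rout U) (sum_map inl inl)).
- by move=> [x|x] [y|y] //= [->].
- by move=> [x|x] [y|y].
- by move=> [x|x] [[y|y]|[y|y]] //= _; first [by exists (inl y) | by exists (inr y)].
Qed.

Lemma posS_unionr e : posS (sum_map inr inr e : gE U + gO U) = posS e.
Proof.
apply: (@pos_map_inj _ _ (rout G') (rout U) (sum_map inr inr)).
- by move=> [x|x] [y|y] //= [->].
- by move=> [x|x] [y|y].
- by move=> [x|x] [[y|y]|[y|y]] //= _; first [by exists (inl y) | by exists (inr y)].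
Qed.
End UnionPos.

Section Ops.
Variables (K : fieldType) (X : ssdata K) (P : trap K).
Variable phi : forall k l : nat, X k l -> P k l.

Lemma dval_actl k l (s : 'S_l) (D : dgraph X k l) :
  dval phi (dgraph_actl s D) = actl s (dval phi D).
Proof.
rewrite actl_relab; apply: (@dval_out _ _ _ _ _ _ D _ _ (dgraph_actl s D) (bid _) (bid _)) =>
  //.
apply: (@core_map _ _ _ _ _ _ _ _ D (dgraph_actl s D) (bid _) _ _ (bid _)).
- by [].
- by move=> [[x|x]|[x|x]]; rewrite !slinE //= posT_rewire.
- by move=> [[x|x]|[x|x]]; rewrite !sloutE //= posS_rewire.
Qed.

Lemma dval_actr k l (s : 'S_k) (D : dgraph X k l) :
  dval phi (dgraph_actr D s) = actr (dval phi D) s.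
Proof.
rewrite actr_relab; apply: (@dval_out _ _ _ _ _ _ D _ _ (dgraph_actr D s) (bid _) (bid _)) =>
  //.
apply: (@core_map _ _ _ _ _ _ _ _ D (dgraph_actr D s) (bid _) _ _ (bid _)).
- by [].
- by move=> [[x|x]|[x|x]]; rewrite !slinE //= posT_rewire.
- by move=> [[x|x]|[x|x]]; rewrite !sloutE //= posS_rewire.
Qed.

Hypothesis phi_linear : forall k l, linear (@phi k l).

Lemma core_redec k l (D : dgraph X k l) v (x : X (gin D v) (gout D v)) :
  core phi (redec x) = mtrace (ren (binv (slin D)) (binv (slout D))
     (tensor (mkdec (dfwith (gdec phi (D := D)) (phi x : P (gwin (inl v)) (gwout (inl v))))))).
Proof.
have E w : gelt phi (D := redec x) w = mkdec (dfwith (gdec phi (D := D))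
  (phi x : P (gwin (inl v)) (gwout (inl v)))) w.
  rewrite /gelt /mkdec; congr mkelt; case: w => [w|w]; last by rewrite dfwith_out.
  have [e|vw] := eqVneq v w; last by rewrite /= !dfwith_out.
  by subst w; rewrite /= !dfwith_in.
rewrite /core (@tensor_eq _ _ _ (mkdec (dfwith (gdec phi (D := D))
  (phi x : P (gwin (inl v)) (gwout (inl v))))) (gelt phi (D := redec x)) (fun=> erefl)
  (fun=> erefl) E).
by rewrite ren_comp; congr mtrace; apply: ren_ext => y; congr (bw _ _); exact: slotv_inj.
Qed.

Lemma dval_multi k l (D : dgraph X k l) v a (x y : X (gin D v) (gout D v)) :
  dval phi (redec (a *: x + y)) = a *: dval phi (redec x) + dval phi (redec y).
Proof.
rewrite /dval -[RHS]out_linear -ren_linear !core_redec phi_linear.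
congr (out (ren _ _ _)); rewrite -mtrace_linear -ren_linear.
by congr (mtrace (ren _ _ _)); exact: tensor_multi.
Qed.

Lemma dval_union k l k' l' (D : dgraph X k l) (D' : dgraph X k' l') :
  dval phi (dgraph_union D D') = hcat (dval phi D) (dval phi D').
Proof.
apply: (can_inj (@innK _ _ _ _)); rewrite inn_hcat !outK hc_ren.
have -> : core phi (dgraph_union D D') = ren (bsum4 _ _ _ _) (bsum4 _ _ _ _)
  (hc (core phi D) (core phi D')).
  pose U := dgraph_union D D'.
  (* The vertices, input-output edges and loops of the union are grouped by kind, those of the two
     separate tensor products by graph; [g] passes from the second grouping to the first. *)
  pose g : gW D + gW D' <~> gW U := bsum (bid _) (bsum4 _ _ _ _) \b bsum4 _ _ _ _.
  rewrite hc_mtrace2 hc_ren -(mtrace_ren _ _ (bsum4 _ _ _ _)) /core.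
  rewrite (@tensor_ren _ _ _ _ g (gelt phi (D := U) \o g) (gelt phi (D := U)) (fun=> erefl)
    (fun=> erefl)) // tensor_sum.
  have El w : ((gelt phi (D := U) \o g) \o inl) w = gelt phi (D := D) w by case: w => [v|[]].
  have Er w : ((gelt phi (D := U) \o g) \o inr) w = gelt phi (D := D') w by case: w => [v|[]].
  rewrite (tensor_eq (fun w => elt_in (El w)) (fun w => elt_out (El w)) El).
  rewrite (tensor_eq (fun w => elt_in (Er w)) (fun w => elt_out (Er w)) Er).
  rewrite hc_ren !ren_comp; congr mtrace; apply: ren_ext => y.
  - have [z ->] : exists z, y = bsum (slin D) (slin D') z by exists
      (bw (bsum (slin D) (slin D')) y); rewrite bwK.
    apply: (etrans (bw_eq (a := bsum (bsum4 _ _ _ _) (bsum4 _ _ _ _) (bsum4 _ _ _ _ z)) _));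
      last first.
      exact: (congr1 (bsum (bsum4 _ _ _ _) (bsum4 _ _ _ _) \b bsum4 _ _ _ _)
        (esym (fwK (bsum (slin D) (slin D')) z))).
    apply: slotv_inj; case: z => [[[x|x]|[x|x]]|[[x|x]|[x|x]]]; rewrite slinE;
      (apply: injective_projections => //).
    + exact: (@posT_unionl _ _ _ _ _ _ _ _ _ _ D D' (inr x)).
    + exact: (@posT_unionl _ _ _ _ _ _ _ _ _ _ D D' (inl x)).
    + exact: (@posT_unionr _ _ _ _ _ _ _ _ _ _ D D' (inr x)).
    + exact: (@posT_unionr _ _ _ _ _ _ _ _ _ _ D D' (inl x)).
  - have [z ->] : exists z, y = bsum (slout D) (slout D') z by exists
      (bw (bsum (slout D) (slout D')) y); rewrite bwK.
    apply: (etrans (bw_eq (a := bsum (bsum4 _ _ _ _) (bsum4 _ _ _ _) (bsum4 _ _ _ _ z)) _));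
      last first.
      exact: (congr1 (bsum (bsum4 _ _ _ _) (bsum4 _ _ _ _) \b bsum4 _ _ _ _)
        (esym (fwK (bsum (slout D) (slout D')) z))).
    apply: slotv_inj; case: z => [[[x|x]|[x|x]]|[[x|x]|[x|x]]]; rewrite sloutE;
      (apply: injective_projections => //).
    + exact: (@posS_unionl _ _ _ _ _ _ _ _ _ _ D D' (inr x)).
    + exact: (@posS_unionl _ _ _ _ _ _ _ _ _ _ D D' (inl x)).
    + exact: (@posS_unionr _ _ _ _ _ _ _ _ _ _ D D' (inr x)).
    + exact: (@posS_unionr _ _ _ _ _ _ _ _ _ _ D D' (inl x)).
by rewrite !ren_comp; apply: ren_ext => x; rewrite /= shuffleK.
Qed.

End Ops.

(** * The value of the unit graphs and of corollas *)

Lemma pos_ord n (i : 'I_n) : pos (fun i j : 'I_n => (i <= j)%N) i = i.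
Proof.
have le_in : (i <= n)%N by exact: ltnW.
rewrite /pos -[RHS](card_ord i) -(card_codom (f := widen_ord le_in)); last first.
  by move=> a b /(congr1 val) /= /val_inj.
apply: eq_card => j; rewrite !inE; apply/andP/codomP => [[ji nji]|[a ->]].
  have lt_ji : (j < i)%N by rewrite ltn_neqAle ji andbT.
  by exists (Ordinal lt_ji); apply: val_inj.
by split=> /=; [exact: ltnW | rewrite -(inj_eq val_inj) /= neq_ltn ltn_ord].
Qed.

Section Generators.
Variables (K : fieldType) (X : ssdata K) (P : trap K).
Variable phi : forall k l : nat, X k l -> P k l.

Lemma dval_dgraph0 : dval phi (dgraph0 X) = trap0 P.
Proof.
apply: (can_inj (@innK _ _ _ _)); rewrite outK inn_trap0 /core.
pose h : void + void <~> void := bsumv void (bid void).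
pose h' : void + (void + void) <~> void := bsumv void h.
rewrite (mtrace_void (h : gE (dgraph0 X) + gL (dgraph0 X) <~> void)).
rewrite (tensor_void (h' : gW (dgraph0 X) <~> void)) !ren_comp.
by apply: ren_ext => -[].
Qed.

Lemma dval_dgraph1 : dval phi (dgraph1 X) = trap1 P.
Proof.
apply: (can_inj (@innK _ _ _ _)); rewrite outK /core.
pose h : void + void <~> void := bsumv void (bid void).
pose h' : void + (unit + void) <~> unit := bsumv unit (bid void) \b binv (bvoid _).
rewrite (mtrace_void (h : gE (dgraph1 X) + gL (dgraph1 X) <~> void)).
have [f [g [_ _ ->]]] := tensor_unit (h' : gW (dgraph1 X) <~> unit) (gelt phi (D := dgraph1 X)).
rewrite !ren_comp /inn /ren relab_comp.
apply: relab_ext => x; congr enum_rank; by rewrite [LHS]ord1 [RHS]ord1.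
Qed.

Lemma pos_void_sum n (a : 'I_n) :
  pos (relpre (@void_sum n) (fun i j : 'I_n => (i <= j)%N)) (inr (Iord a)) = a.
Proof.
rewrite -[RHS]pos_ord -(@pos_map_inj _ _ _ (fun i j : 'I_n => (i <= j)%N) (@void_sum n)).
- by rewrite /= IordK.
- exact: void_sum_inj.
- by [].
- by move=> x y' _; exists (inr (Iord y')); rewrite /= IordK.
Qed.

Lemma dval_corolla k l (x : X k l) : dval phi (dgraph_corolla x) = phi x.
Proof.
apply: (can_inj (@innK _ _ _ _)); rewrite outK /core.
pose D := dgraph_corolla x.
pose h : void + void <~> void := bsumv void (bid void).
pose h' : unit + (void + void) <~> unit := bsumv unit h.
rewrite (mtrace_void (h : gE D + gL D <~> void)).
have [f [g [fE gE ->]]] := tensor_unit (h' : gW D <~> unit) (gelt phi (D := D)).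
rewrite !ren_comp; apply: ren_id => a.
- have e : slin D (inl (inl (Iord a))) = f a.
    by apply: slotv_inj; rewrite slinE fE; congr (_, _); exact: pos_void_sum.
  by rewrite !fwE -e -[fw (binv _) _]/(bw (slin D) _) fwK /= IordK.
- have e : slout D (inl (inl (Iord a))) = g a.
    by apply: slotv_inj; rewrite sloutE gE; congr (_, _); exact: pos_void_sum.
  by rewrite !fwE -e -[fw (binv _) _]/(bw (slout D) _) fwK /= IordK.
Qed.
End Generators.

(** * Linear extension from decorated graphs *)

Section Extension.
Variables (K : fieldType) (X : ssdata K) (P : trap K).
Variable phi : forall k l : nat, X k l -> P k l.
Hypothesis phi_linear : forall k l, linear (@phi k l).

Lemma dval_compatible k l : pgr_compatible (@dval K X P phi k l).
Proof. by split=> [D D' /dval_iso //|D v a x y]; exact: dval_multi. Qed.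

Definition pgr_val k l : PGr X k l -> P k l := pgr_ext (@dval K X P phi k l).

Lemma pgr_val_cl k l (D : dgraph X k l) : pgr_val (pgr_cl D) = dval phi D.
Proof. exact: pgr_extE (@dval_compatible k l) D. Qed.
End Extension.

Section PGrInd.
Variables (K : fieldType) (X : ssdata K).

Lemma pgr_ind k l (Q : pgr X k l -> Prop) :
  Q 0 -> (forall a x y, Q x -> Q y -> Q (a *: x + y)) -> (forall D, Q (pgr_cl D)) -> forall x,
    Q x.
Proof.
move=> q0 ql qc x; rewrite -(pgr_reprK x) -(freeg_sumE (pgr_repr x)) raddf_sum /=.
elim/big_ind: _ => // [u v qu qv|D _]; first by rewrite -[u]scale1r; exact: ql.
have -> : << coeff D (pgr_repr x) *g D >> = coeff D (pgr_repr x) *: << D >> :>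
  {freeg (dgraph X k l) / K}.
  by apply/eqP/freeg_eqP => z; rewrite coeffZ !coeffU mul1r.
rewrite pgr_piZ -[pgr_scale _ _]addr0.
exact: (ql _ _ _ (qc D) q0).
Qed.

(** Reduces an identity between linear maps to classes of decorated graphs. It is applied one
    argument at a time to the TraP axioms and to the morphism laws. *)
Lemma pgr_lin_ext k l (W : lmodType K) (f g : pgr X k l -> W) :
  linear f -> linear g -> (forall D, f (pgr_cl D) = g (pgr_cl D)) -> f =1 g.
Proof.
move=> lf lg e; apply: pgr_ind => // [|a x y ex ey]; last by rewrite lf lg ex ey.
have z (h : pgr X k l -> W) : linear h -> h 0 = 0.
  by move=> lh; have := lh (-1) 0 0; rewrite scaler0 addr0 scaleN1r addNr.
by rewrite !z.
Qed.
End PGrInd.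

(** * Wires *)

Section Wire.
Variables (V : finS) (ain aout : V -> nat) (k l : nat) (G : pgraph ain aout k l).

(** Ends are named by vertices, ranks and outer numbers, never by edges: the wires of two graphs
    with the same vertices and different edge sets are relations between the same types. Loops have
    no ends and are only counted. *)
Inductive wire : (V * nat) + 'I_k -> (V * nat) + 'I_l -> Prop :=
| wireE e : wire (inl (src G (inl e), posS (inl e))) (inl (tgt G (inl e), posT (inl e)))
| wireI e : wire (inr (alpha G (inl e))) (inl (tgt G (inr e), posT (inr e)))
| wireO e : wire (inl (src G (inr e), posS (inr e))) (inr (beta G (inl e)))
| wireIO e : wire (inr (alpha G (inr e))) (inr (beta G (inr e))).

Lemma src_pos_inj : injective (fun e => (src G e, posS e)).
Proof. exact: inj_comp (@slotv_inj _ _) (fw_inj (bsrc G)). Qed.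

Lemma tgt_pos_inj : injective (fun e => (tgt G e, posT e)).
Proof. exact: inj_comp (@slotv_inj _ _) (fw_inj (btgt G)). Qed.

Definition wire_src (e : (gE G + gO G) + (gI G + gIO G)) : (V * nat) + 'I_k :=
  match e with inl e => inl (src G e, posS e) | inr e => inr (alpha G e) end.
Definition wire_tgt (e : (gE G + gI G) + (gO G + gIO G)) : (V * nat) + 'I_l :=
  match e with inl e => inl (tgt G e, posT e) | inr e => inr (beta G e) end.

Lemma wire_src_inj : injective wire_src.
Proof.
move=> [x|x] [y|y] //= []; first by move=> e1 e2; congr inl; apply: src_pos_inj; rewrite e1 e2.
by move/(bij_inj (alpha_bij G)) ->.
Qed.

Lemma wire_tgt_inj : injective wire_tgt.
Proof.
move=> [x|x] [y|y] //= []; first by move=> e1 e2; congr inl; apply: tgt_pos_inj; rewrite e1 e2.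
by move/(bij_inj (beta_bij G)) ->.
Qed.

Definition ends : (gE G + gO G) + (gI G + gIO G) -> (gE G + gI G) + (gO G + gIO G) :=
  @shuffle _ _ _ _.

Lemma wireP s t : wire s t <-> exists e, s = wire_src e /\ t = wire_tgt (ends e).
Proof.
split=> [[e|e|e|e]|[[[e|e]|[e|e]] [-> ->]]]; try by constructor.
- by exists (inl (inl e)).
- by exists (inr (inl e)).
- by exists (inl (inr e)).
- by exists (inr (inr e)).
Qed.

Lemma wire_fun s t t' : wire s t -> wire s t' -> t = t'.
Proof. by move=> /wireP [e [-> ->]] /wireP [e' [/wire_src_inj <- ->]]. Qed.

Lemma wire_inj s s' t : wire s t -> wire s' t -> s = s'.
Proof.
by move=> /wireP [e [-> ->]] /wireP [e' [-> /wire_tgt_inj /(can_inj (@shuffleK _ _ _ _)) <-]].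
Qed.

(** Ranks are unbounded in the type of ends; this singles out the ends that exist, a condition on
    the arities alone and not on the graph. *)
Definition source (s : (V * nat) + 'I_k) : bool := if s is inl x then (x.2 < aout x.1)%N else
  true.

Lemma wire_source s t : wire s t -> source s.
Proof. by case=> e //=; exact: (ltn_ord (tagged (bsrc G _))). Qed.

Lemma wire_total s : source s -> exists t, wire s t.
Proof.
move=> hs; suff [e ->] : exists e, s = wire_src e by exists (wire_tgt (ends e)); apply/wireP;
  exists e.
case: s hs => [[v n] /= h|i _].
  have [x xE] := slotv_surj h; exists (inl (bw (bsrc G) x)).
  by rewrite /= -bsrcE bwK xE.
by have [x <-] := bij_surj (alpha_bij G) i; exists (inr x).
Qed.
End Wire.

Definition wmap A B (f : A -> B) n (s : (A * nat) + 'I_n) : (B * nat) + 'I_n :=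
  match s with inl x => inl (f x.1, x.2) | inr i => inr i end.

Lemma wmap_id A n (s : (A * nat) + 'I_n) : wmap id s = s.
Proof. by case: s => // -[]. Qed.

Section WireIso.
Variables (K : fieldType) (X : ssdata K) (k l : nat) (D D' : dgraph X k l).
Variable f : gV D -> gV D'.
Hypothesis fb : bijective f.
Hypothesis fdec : forall v, decv (f v) = decv v.

Local Notation wmap := (wmap f).

Hypothesis fwire : forall s t, wire D s t <-> wire D' (wmap s) (wmap t).
Hypothesis floop : #|{: gL D}| = #|{: gL D'}|.

Lemma wmap_inj n : injective (wmap (n := n)).
Proof. by move=> [[v m]|i] [[w m']|j] //= []; [move/(bij_inj fb) => -> -> | move=> ->]. Qed.

Lemma wmap_surj n s : exists s0, s = wmap (n := n) s0.
Proof.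
case: s => [[v m]|i]; last by exists (inr i).
by have [w <-] := bij_surj fb v; exists (inl (w, m)).
Qed.

(* [c] and [c'] embed the edges of a given kind into all the edges. *)
Lemma wire_edge_map (A A' : finType) (c : A -> (gE D + gO D) + (gI D + gIO D))
    (c' : A' -> (gE D' + gO D') + (gI D' + gIO D')) :
  injective c -> injective c' ->
  (forall e u, wire_src u = wmap (wire_src (c e)) -> wire_tgt (ends u) = wmap
    (wire_tgt (ends (c e))) ->
     exists e', u = c' e') ->
  (forall e' u, wmap (wire_src u) = wire_src (c' e') -> wmap (wire_tgt (ends u)) = wire_tgt
    (ends (c' e')) ->
     exists e, u = c e) ->
  exists2 h : A -> A', bijective h & forall e, wire_src (c' (h e)) = wmap (wire_src (c e)) /\
    wire_tgt (ends (c' (h e))) = wmap (wire_tgt (ends (c e))).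
Proof.
move=> cI cI' to from.
have key e : {e' | wire_src (c' e') = wmap (wire_src (c e)) /\
    wire_tgt (ends (c' e')) = wmap (wire_tgt (ends (c e)))}.
  apply: cid; have /fwire/wireP [u [us ut]] : wire D (wire_src (c e)) (wire_tgt (ends (c e))).
    by apply/wireP; exists (c e).
  by have [e' e'E] := to e u (esym us) (esym ut); exists e'; rewrite -e'E.
exists (fun e => sval (key e)) => [|e]; last exact: (svalP (key e)).
apply: inj_surj_bij => [e1 e2 h|e'].
  have [h1 _] := svalP (key e1); have [h2 _] := svalP (key e2).
  by apply/cI/(@wire_src_inj _ _ _ _ _ D)/wmap_inj; rewrite -h1 -h2 h.
have [s sE] := wmap_surj (wire_src (c' e')); have [t tE] := wmap_surj (wire_tgt (ends (c' e'))).
have : wire D' (wire_src (c' e')) (wire_tgt (ends (c' e'))) by apply/wireP; exists (c' e').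
rewrite sE tE => /fwire/wireP [u [us ut]]; subst s t.
have [e eE] := from e' u (esym sE) (esym tE).
exists e; apply/cI'/(@wire_src_inj _ _ _ _ _ D'); have [-> _] := svalP (key e).
by rewrite sE eE.
Qed.

(** The kind of an edge is visible in its two ends, which gives bijections kind by kind, and ranks
    recover the orders by [posE]. Loops are attached to nothing, so any bijection between them will
    do. *)
Lemma diso_wire : inhabited (diso D D').
Proof.
have [fE fEb fEE] := @wire_edge_map _ _ (fun e => inl (inl e)) (fun e => inl (inl e))
  ltac:(by move=> ? ? []) ltac:(by move=> ? ? [])
  ltac:(by move=> e [[u|u]|[u|u]] //= _ _; exists u)
    ltac:(by move=> e [[u|u]|[u|u]] //= _ _; exists u).
have [fO fOb fOE] := @wire_edge_map _ _ (fun e => inl (inr e)) (fun e => inl (inr e))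
  ltac:(by move=> ? ? []) ltac:(by move=> ? ? [])
  ltac:(by move=> e [[u|u]|[u|u]] //= _ _; exists u)
    ltac:(by move=> e [[u|u]|[u|u]] //= _ _; exists u).
have [fI fIb fIE] := @wire_edge_map _ _ (fun e => inr (inl e)) (fun e => inr (inl e))
  ltac:(by move=> ? ? []) ltac:(by move=> ? ? [])
  ltac:(by move=> e [[u|u]|[u|u]] //= _ _; exists u)
    ltac:(by move=> e [[u|u]|[u|u]] //= _ _; exists u).
have [fIO fIOb fIOE] := @wire_edge_map _ _ (fun e => inr (inr e)) (fun e => inr (inr e))
  ltac:(by move=> ? ? []) ltac:(by move=> ? ? [])
  ltac:(by move=> e [[u|u]|[u|u]] //= _ _; exists u)
    ltac:(by move=> e [[u|u]|[u|u]] //= _ _; exists u).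
pose bL : gL D <~> gL D' := binv (brank (gL D')) \b (bcast floop \b brank (gL D)).
have sE e : (src D' (sum_map fE fO e), posS (sum_map fE fO e)) = (f (src D e), posS e).
  by case: e => e; [have [/= [-> ->] _] := fEE e | have [/= [-> ->] _] := fOE e].
have tE e : (tgt D' (sum_map fE fI e), posT (sum_map fE fI e)) = (f (tgt D e), posT e).
  by case: e => e; [have [_ /= [-> ->]] := fEE e | have [_ /= [-> ->]] := fIE e].
constructor; apply: (@DIso _ _ _ _ D D' f fE fI fO fIO bL) => //.
- exact: fw_bij.
- by move=> e; have [] := sE e.
- by move=> e; have [] := tE e.
- by case=> e; [have [/= []] := fIE e | have [/= []] := fIOE e].
- by case=> e; [have [_ /= []] := fOE e | have [_ /= []] := fIOE e].
- move=> e e'; rewrite (posE (rinP D')) (posE (rinP D)).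
  have [-> p1] := tE e; have [-> p2] := tE e'; rewrite (inj_eq (bij_inj fb)).
  by move: p1 p2; rewrite /posT => -> ->.
- move=> e e'; rewrite (posE (routP D')) (posE (routP D)).
  have [-> p1] := sE e; have [-> p2] := sE e'; rewrite (inj_eq (bij_inj fb)).
  by move: p1 p2; rewrite /posS => -> ->.
Qed.
End WireIso.

Notation imap f := (sum_map id f).

Lemma imapK A B C (f : B -> C) g : cancel f g -> cancel (@sum_map A B A C id f) (imap g).
Proof. by move=> fK [x|x] //=; rewrite fK. Qed.

(** * Wires under renumbering, gluing and union *)

Section WireOps.
Variables (V : finS) (ain aout : V -> nat).

Lemma wire_renumber k l k' l' (G : pgraph ain aout k l) a b (ab : bijective a)
  (bb : bijective b)
    (f : 'I_k -> 'I_k') (g : 'I_l -> 'I_l') :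
  injective f -> injective g -> a =1 f \o alpha G -> b =1 g \o beta G -> forall s t,
  wire (rewire (gL G) (bij_id _) (bij_id _) ab bb) (imap f s) (imap g t) <-> wire G s t.
Proof.
move=> fI0 gI0 aE bE s t; set G' := rewire _ _ _ _ _.
have fI : injective (@sum_map (V * nat) 'I_k _ _ id f) by apply: sum_map_inj.
have gI : injective (@sum_map (V * nat) 'I_l _ _ id g) by apply: sum_map_inj.
have sE e : @wire_src _ _ _ _ _ G' e = imap f (wire_src (G := G) e).
  by case: e => e; rewrite /= ?posS_rewire // aE.
have tE e : @wire_tgt _ _ _ _ _ G' e = imap g (wire_tgt (G := G) e).
  by case: e => e; rewrite /= ?posT_rewire // bE.
split=> /wireP [e [es et]]; apply/wireP; exists e.
  by split; [apply: fI; rewrite es sE | apply: gI; rewrite et tE].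
by rewrite es et sE tE.
Qed.

Lemma imap_id A B (s : A + B) : imap id s = s. Proof. by case: s. Qed.

Lemma wire_actl k l (G : pgraph ain aout k l) u s t :
  wire (pgraph_actl u G) s t <-> wire G s (imap (u^-1)%g t).
Proof.
rewrite -[s in X in X <-> _]imap_id -[t in X in X <-> _](imapK (permKV u)).
exact: (wire_renumber _ _ (f := id) (g := u) (fun _ _ h => h) perm_inj).
Qed.

Lemma wire_actr k l (G : pgraph ain aout k l) u s t :
  wire (pgraph_actr G u) s t <-> wire G (imap u s) t.
Proof.
rewrite -[t in X in X <-> _]imap_id -[s in X in X <-> _](imapK (permK u)).
exact: (wire_renumber _ _ (f := (u^-1)%g) (g := id) perm_inj (fun _ _ h => h)).
Qed.

Lemma wire_glue k l (G : pgraph ain aout k.+1 l.+1) e f s t :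
  wire (glue e f) s t ->
  wire G (imap (lift (alpha G e)) s) (imap (lift (beta G f)) t) \/
  wire G (imap (lift (alpha G e)) s) (inr (beta G f)) /\ wire G (inr (alpha G e))
    (imap (lift (beta G f)) t).
Proof.
case: e => a; [case: f => b|].
- case=> [[x|]|x|x|x] /=; rewrite ?lift_drop ?posT_rewire ?posS_rewire; try by left;
    constructor.
  by right; split; constructor.
- case=> [x|x|x|x] /=; rewrite ?lift_drop ?posT_rewire ?posS_rewire; try by left; constructor.
  rewrite /oi_alpha /=; case: eqP => [[->]|_]; last by left; constructor.
    by right; split; constructor.
- case=> [x|x|x|x] /=; rewrite ?lift_drop ?posT_rewire ?posS_rewire; try by left; constructor.
  + rewrite /io_beta /=; case: eqP => [<-|_]; last by left; constructor.
    by right; split; constructor.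
  + rewrite /io_beta /=; case: eqP => [<-|_]; last by left; constructor.
    by right; split; constructor.
Qed.

(** The case analysis of [wire_glue] gives one implication. The converse is determinism: the source
    [s] has some wire in the glued graph, its target satisfies the same formula in [G], and a source
    of [G] has only one target. *)
Lemma wire_tr k l (G : pgraph ain aout k.+1 l.+1) i j s t :
  wire (pgraph_tr G i j) s t <->
  wire G (imap (lift i) s) (imap (lift j) t) \/
  wire G (imap (lift i) s) (inr j) /\ wire G (inr i) (imap (lift j) t).
Proof.
rewrite /pgraph_tr; set e := bij_inv _ i; set f := bij_inv _ j.
have ei : alpha G e = i by exact: bij_invK. have fj : beta G f = j by exact: bij_invK.
have glueW s' t' := @wire_glue _ _ G e f s' t'; rewrite ei fj in glueW.
split; first exact: glueW.
have lI : injective (@sum_map (V * nat) _ _ _ id (lift j)).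
  by apply: sum_map_inj => //; exact: lift_inj.
have lN u : imap (lift j) u <> inr j :> V * nat + _.
  by case: u => //= u [] /eqP; rewrite eq_sym (negPf (neq_lift _ _)).
move=> h; have hs : source aout s.
  by case: h => [/wire_source|[/wire_source]]; case: (s).
have [t' ht'] := wire_total (glue e f) hs; suff -> : t = t' by [].
apply: lI; case: (glueW _ _ ht') h => [h1|[h1 h2]] [h3|[h3 h4]].
- exact: wire_fun h3 h1.
- by case/lN: (wire_fun h1 h3).
- by case/lN: (wire_fun h3 h1).
- exact: wire_fun h4 h2.
Qed.

Lemma loops_tr k l (G : pgraph ain aout k.+1 l.+1) i j :
  #|{: gL (pgraph_tr G i j)}| = (#|{: gL G}| + `[< wire G (inr i) (inr j) >])%N.
Proof.
rewrite /pgraph_tr; set e := bij_inv _ i; set f := bij_inv _ j.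
have ei : alpha G e = i by exact: bij_invK. have fj : beta G f = j by exact: bij_invK.
rewrite -ei -fj; case: e {ei} => a.
  have -> : `[< wire G (inr (alpha G (inl a))) (inr (beta G f)) >] = false.
    by apply/asboolP => h; have := wire_fun h (wireI a).
  by rewrite addn0; case: (f).
have [-> /=|fa] := eqVneq f (inr a); first rewrite eqxx.
  have -> : `[< wire G (inr (alpha G (inr a))) (inr (beta G (inr a))) >] = true.
    by apply/asboolP; constructor.
  by rewrite card_option addn1.
have -> : `[< wire G (inr (alpha G (inr a))) (inr (beta G f)) >] = false.
  apply/asboolP => h; have [] := wire_fun h (wireIO a) => /(bij_inj (beta_bij G)) e.
  by rewrite e eqxx in fa.
by rewrite /= (negPf fa) addn0.
Qed.
End WireOps.

Section WireUnion.
Variables (V V' : finS) (ain aout : V -> nat) (ain' aout' : V' -> nat).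
Variables (k l k' l' : nat) (G : pgraph ain aout k l) (G' : pgraph ain' aout' k' l').

Definition usplit m n (s : (V + V') * nat + 'I_(m + n)) : (V * nat + 'I_m) +
  (V' * nat + 'I_n) :=
  match s with
  | inl (inl v, p) => inl (inl (v, p))
  | inl (inr v, p) => inr (inl (v, p))
  | inr x => sum_map inr inr (split x)
  end.

Lemma usplit_inj m n : injective (@usplit m n).
Proof.
have vs u : usplit (inr u) = sum_map inr inr (split u) :> (_ + 'I_m) + (_ + 'I_n) by [].
move=> [[[v|v] p]|x] [[[w|w] q]|y] //=; try (by case: (split _)); try by case=> -> ->.
by case E: (split x) => [a|a]; case E': (split y) => [b|b] //= [ab]; congr inr;
  apply: (can_inj (@splitK m n)); rewrite E E' ab.
Qed.

Lemma wire_union s t : wire (pgraph_union G G') s t <->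
  match usplit s, usplit t with
  | inl s, inl t => wire G s t | inr s, inr t => wire G' s t | _, _ => False end.
Proof.
have to s' t' : wire (pgraph_union G G') s' t' ->
    match usplit s', usplit t' with
    | inl s, inl t => wire G s t | inr s, inr t => wire G' s t | _, _ => False end.
  case=> -[] e; rewrite /usplit /= ?unsplitK /=.
  - rewrite (@posT_unionl _ _ _ _ _ _ _ _ _ _ G G' (inl e))
      (@posS_unionl _ _ _ _ _ _ _ _ _ _ G G' (inl e)).
    exact: wireE.
  - rewrite (@posT_unionr _ _ _ _ _ _ _ _ _ _ G G' (inl e))
      (@posS_unionr _ _ _ _ _ _ _ _ _ _ G G' (inl e)).
    exact: wireE.
  - rewrite (@posT_unionl _ _ _ _ _ _ _ _ _ _ G G' (inr e)); exact: wireI.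
  - rewrite (@posT_unionr _ _ _ _ _ _ _ _ _ _ G G' (inr e)); exact: wireI.
  - rewrite (@posS_unionl _ _ _ _ _ _ _ _ _ _ G G' (inr e)); exact: wireO.
  - rewrite (@posS_unionr _ _ _ _ _ _ _ _ _ _ G G' (inr e)); exact: wireO.
  - exact: wireIO.
  - exact: wireIO.
split; first exact: to.
move=> h; have hs : @source [finS of V + V'] (sum_arity aout aout') _ s.
  move: h; case: (s) => [[[v|v] p]|x] //=; case: (usplit t) => // u; exact: wire_source.
have [t' ht'] := wire_total (pgraph_union G G') hs; suff -> : t = t' by [].
apply: usplit_inj; move: (to _ _ ht') h; case: (usplit s) => u; case: (usplit t') => v //;
 by case: (usplit t) => w // h1 h2; rewrite (wire_fun h1 h2).
Qed.

Lemma loops_union : #|{: gL (pgraph_union G G')}| = (#|{: gL G}| + #|{: gL G'}|)%N.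
Proof. exact: card_sum. Qed.
End WireUnion.

(** * Classes of decorated graphs: casts, equality and linearity *)

Section PGrGen.
Variables (K : fieldType) (X : ssdata K).

Lemma cast_ord_bij m n (e : m = n) : bijective (cast_ord e).
Proof. exact: fw_bij (bcast e). Qed.

Definition dgraph_cast k l k' l' (e : k = k') (e' : l = l') (D : dgraph X k l) : dgraph X k'
  l' :=
  DGraph (dec D) (rewire (gL D) (bij_id _) (bij_id _) (bij_comp (cast_ord_bij e) (alpha_bij D))
    (bij_comp (cast_ord_bij e') (beta_bij D))).

Lemma castP_cl k l k' l' (e : k = k') (e' : l = l') (D : dgraph X k l) :
  castP (e, e') (pgr_cl D : PGr X k l) = pgr_cl (dgraph_cast e e' D).
Proof.
subst k' l'; apply: pgr_cl_iso.
apply: (@DIso _ _ _ _ D (dgraph_cast erefl erefl D) id id id id id id);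
  first [exact: bij_id | by [] | by case | by move=> [x|x] [y|y] | idtac].
- by move=> [x|x]; exact: cast_ord_id.
- by move=> [x|x]; exact: cast_ord_id.
Qed.

Lemma wire_cast k l k' l' (e : k = k') (e' : l = l') (D : dgraph X k l) s t :
  wire (dgraph_cast e e' D) s t <-> wire D (imap (cast_ord (esym e)) s)
    (imap (cast_ord (esym e')) t).
Proof.
rewrite -[s in X in X <-> _](imapK (cast_ordKV e)) -[t in X in X <-> _](imapK (cast_ordKV e')).
by apply: wire_renumber => //; exact: cast_ord_inj.
Qed.

Lemma pgr_cl_wire k l (D D' : dgraph X k l) (f : gV D -> gV D') :
  bijective f -> (forall v, decv (f v) = decv v) ->
  (forall s t, wire D s t <-> wire D' (wmap f s) (wmap f t)) ->
  #|{: gL D}| = #|{: gL D'}| -> pgr_cl D = pgr_cl D'.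
Proof. by move=> fb fd fw fl; have [i] := diso_wire fb fd fw fl; exact: pgr_cl_iso. Qed.

(** For the operations that keep vertices, arities and decorations on the nose: the identity on
    vertices makes the condition on decorations trivial. *)
Lemma pgr_cl_wire_id k l (V : finS) (ain aout : V -> nat) (d : forall v, X (ain v) (aout v))
    (G G' : pgraph ain aout k l) :
  (forall s t, wire G s t <-> wire G' s t) -> #|{: gL G}| = #|{: gL G'}| ->
  pgr_cl (DGraph d G) = pgr_cl (DGraph d G').
Proof.
move=> w n; apply: (@pgr_cl_wire _ _ (DGraph d G) (DGraph d G') id) => //; first exact: bij_id.
by move=> s t; rewrite w; case: s => [[]|]; case: t => [[]|].
Qed.

Lemma castP_linear (Y : ssdata K) k l k' l' (e : (k = k') * (l = l')) : linear
  (@castP K Y k l k' l' e).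
Proof. by case: e => e e'; subst. Qed.

Lemma pgr_actl_linear k l s : linear (@pgr_actl K X k l s).
Proof. exact/pgr_ext_linear/actl_compatible. Qed.
Lemma pgr_actr_linear k l s : linear (fun x => @pgr_actr K X k l x s).
Proof. exact/pgr_ext_linear/actr_compatible. Qed.
Lemma pgr_tr_linear k l i j : linear (@pgr_tr K X k l i j).
Proof. exact/pgr_ext_linear/tr_compatible. Qed.
Lemma pgr_hcat_linearl k l k' l' x' : linear (fun x => @pgr_hcat K X k l k' l' x x').
Proof. exact/pgr_ext_linear/unionl_compatible. Qed.

Lemma comp_linear (U V W : lmodType K) (f : U -> V) (g : V -> W) :
  linear f -> linear g -> linear (g \o f).
Proof. by move=> lf lg a x y; rewrite /= lf lg. Qed.

(** In [pgr_hcat] the extension in the second argument sits inside the extension in the first, so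
    linearity on the right is not immediate; it is obtained by induction on the first argument. *)
Lemma pgr_hcat_linearr k l k' l' x : linear (@pgr_hcat K X k l k' l' x).
Proof.
move=> a y z; elim/pgr_ind: x => [|b u v hu hv|D].
- have h0 w : @pgr_hcat K X k l k' l' 0 w = 0.
    by have := @pgr_hcat_linearl k l k' l' w (-1) 0 0; rewrite scaler0 addr0 scaleN1r addNr.
  by rewrite !h0 scaler0 addr0.
- rewrite !pgr_hcat_linearl hu hv !scalerDr !scalerA [b * a]mulrC -!addrA; congr (_ + _).
  by rewrite addrCA.
- have hE (w : pgr X k' l') : pgr_hcat (pgr_cl D) w = pgr_ext
    (fun D' => pgr_cl (dgraph_union D D')) w.
    by rewrite /pgr_hcat (pgr_extE (@unionl_compatible K X k l k' l' w)).
  by rewrite !hE; apply/pgr_ext_linear/unionr_compatible.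
Qed.

End PGrGen.

(** * PGr X is a TraP *)

Section PGrTrap.
Variables (K : fieldType) (X : ssdata K).

Lemma PGr_ssmod : is_ssmod (PGr X).
Proof.
split=> /=.
- exact: pgr_actl_linear.
- exact: pgr_actr_linear.
- move=> k l; apply: pgr_lin_ext => [||D]; [exact: pgr_actl_linear|by []|].
  rewrite pgr_actlE; case: D => V ai ao d G; apply: pgr_cl_wire_id => // s t.
  by rewrite wire_actl invg1; case: t => // x; rewrite /= perm1.
- move=> k l s s'; apply: pgr_lin_ext => [||D]; [exact: pgr_actl_linear| |].
    exact: comp_linear (pgr_actl_linear _) (pgr_actl_linear _).
  rewrite !pgr_actlE; case: D => V ai ao d G; apply: pgr_cl_wire_id => // u t.
  by rewrite !wire_actl invMg; case: t => // x; rewrite /= permM.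
- move=> k l; apply: pgr_lin_ext => [||D]; [exact: pgr_actr_linear|by []|].
  rewrite pgr_actrE; case: D => V ai ao d G; apply: pgr_cl_wire_id => // s t.
  by rewrite wire_actr; case: s => // x; rewrite /= perm1.
- move=> k l s s'; apply: pgr_lin_ext => [||D]; [exact: pgr_actr_linear| |].
    exact: (comp_linear (@pgr_actr_linear _ _ _ _ s) (@pgr_actr_linear _ _ _ _ s')).
  rewrite !pgr_actrE; case: D => V ai ao d G; apply: pgr_cl_wire_id => // u t.
  by rewrite !wire_actr; case: u => // x; rewrite /= permM.
- move=> k l s t; apply: pgr_lin_ext => [||D].
  + exact: (comp_linear (@pgr_actr_linear _ _ _ _ t) (@pgr_actl_linear _ _ _ _ s)).
  + exact: (comp_linear (@pgr_actl_linear _ _ _ _ s) (@pgr_actr_linear _ _ _ _ t)).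
  rewrite pgr_actrE pgr_actlE pgr_actlE pgr_actrE; case: D => V ai ao d G.
  by apply: pgr_cl_wire_id => // u v; rewrite wire_actl !wire_actr wire_actl.
Qed.

(** After reduction to three graphs, reassociating each set of edges and the vertices is an
    isomorphism; the cast only changes the type of the outer numbers. *)
Lemma PGr_hcatA k l k' l' k'' l'' (p : PGr X k l) (q : PGr X k' l') (r : PGr X k'' l'') :
  hcat p (hcat q r) = castP (esym (addnA k k' k''), esym (addnA l l' l'')) (hcat (hcat p q) r).
Proof.
move: p q r; rewrite /=.
move=> p q r; move: p.
apply: pgr_lin_ext => [||D1]; first exact: pgr_hcat_linearl.
  apply: (comp_linear _ (@castP_linear _ (PGr X) _ _ _ _ _)).
  exact: (comp_linear (@pgr_hcat_linearl _ _ _ _ _ _ q) (@pgr_hcat_linearl _ _ _ _ _ _ r)).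
move: q; apply: pgr_lin_ext => [||D2].
- exact: (comp_linear (@pgr_hcat_linearl _ _ _ _ _ _ r) (@pgr_hcat_linearr _ _ _ _ _ _ _)).
- apply: (comp_linear _ (@castP_linear _ (PGr X) _ _ _ _ _)).
  exact: (comp_linear (@pgr_hcat_linearr _ _ _ _ _ _ _) (@pgr_hcat_linearl _ _ _ _ _ _ r)).
move: r; apply: pgr_lin_ext => [||D3].
- exact: (comp_linear (@pgr_hcat_linearr _ _ _ _ _ _ _) (@pgr_hcat_linearr _ _ _ _ _ _ _)).
- apply: (comp_linear _ (@castP_linear _ (PGr X) _ _ _ _ _)).
  exact: (@pgr_hcat_linearr _ _ _ _ _ _ _).
rewrite !pgr_hcatE castP_cl; apply: pgr_cl_iso.
pose b A B C : A + (B + C) <~> (A + B) + C := binv (bsumA A B C).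
apply: (@DIso _ _ _ _ (dgraph_union D1 (dgraph_union D2 D3))
  (dgraph_cast _ _ (dgraph_union (dgraph_union D1 D2) D3))
  (b _ _ _) (b _ _ _) (b _ _ _) (b _ _ _) (b _ _ _) (b _ _ _)); try exact: fw_bij.
- by move=> [[e|[e|e]]|[e|[e|e]]].
- by move=> [[e|[e|e]]|[e|[e|e]]].
- by move=> [[e|[e|e]]|[e|[e|e]]]; apply: val_inj; rewrite /= ?unsplitK /= ?addnA.
- by move=> [[e|[e|e]]|[e|[e|e]]]; apply: val_inj; rewrite /= ?unsplitK /= ?addnA.
- by move=> [[e|[e|e]]|[e|[e|e]]] [[e'|[e'|e']]|[e'|[e'|e']]].
- by move=> [[e|[e|e]]|[e|[e|e]]] [[e'|[e'|e']]|[e'|[e'|e']]].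
- by move=> [v|[v|v]].
Qed.

Lemma PGr_hcat0p k l (p : PGr X k l) : hcat (trap0 (PGr X)) p = p.
Proof.
move: p => /=; apply: pgr_lin_ext => [||D]; [exact: pgr_hcat_linearr|by []|].
rewrite pgr_hcatE; apply: pgr_cl_iso.
pose b A : void + A <~> A := binv (bvoid A).
apply: (@DIso _ _ _ _ (dgraph_union (dgraph0 X) D) D
  (b _) (b _) (b _) (b _) (b _) (b _)); try exact: fw_bij.
- by move=> [[[]|e]|[[]|e]].
- by move=> [[[]|e]|[[]|e]].
- by move=> [[[]|e]|[[]|e]]; apply: val_inj.
- by move=> [[[]|e]|[[]|e]]; apply: val_inj.
- by move=> [[[]|e]|[[]|e]] [[[]|e']|[[]|e']].
- by move=> [[[]|e]|[[]|e]] [[[]|e']|[[]|e']].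
- by move=> [[]|v].
Qed.

Lemma PGr_hcatp0 k l (p : PGr X k l) :
  castP (addn0 k, addn0 l) (hcat p (trap0 (PGr X))) = p.
Proof.
move: p => /=; apply: pgr_lin_ext => [||D].
- apply: (comp_linear _ (@castP_linear _ (PGr X) _ _ _ _ _)); exact: pgr_hcat_linearl.
- by [].
rewrite pgr_hcatE castP_cl; apply: pgr_cl_iso.
pose b A : A + void <~> A := bsumv A (bid void).
apply: (@DIso _ _ _ _ (dgraph_cast _ _ (dgraph_union D (dgraph0 X))) D
  (b _) (b _) (b _) (b _) (b _) (b _)); try exact: fw_bij.
- by move=> [[e|[]]|[e|[]]].
- by move=> [[e|[]]|[e|[]]].
- by move=> [[e|[]]|[e|[]]]; apply: val_inj.
- by move=> [[e|[]]|[e|[]]]; apply: val_inj.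
- by move=> [[e|[]]|[e|[]]] [[e'|[]]|[e'|[]]].
- by move=> [[e|[]]|[e|[]]] [[e'|[]]|[e'|[]]].
- by move=> [v|[]].
Qed.

Lemma PGr_hcat_equiv k l k' l' (s : 'S_l) (t : 'S_k) (s' : 'S_l') (t' : 'S_k')
      (p : PGr X k l) (p' : PGr X k' l') :
    hcat (actr (actl s p) t) (actr (actl s' p') t') =
    actr (actl (perm_tens s s') (hcat p p')) (perm_tens t t').
Proof.
move: p p' => /= p p'; move: p; apply: pgr_lin_ext => [||D].
- apply: (comp_linear _ (@pgr_hcat_linearl _ _ _ _ _ _ _)).
  exact: (comp_linear (@pgr_actl_linear _ _ _ _ s) (@pgr_actr_linear _ _ _ _ t)).
- apply: (comp_linear _ (@pgr_actr_linear _ _ _ _ _)).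
  exact: (comp_linear (@pgr_hcat_linearl _ _ _ _ _ _ p') (@pgr_actl_linear _ _ _ _ _)).
move: p'; apply: pgr_lin_ext => [||D'].
- apply: (comp_linear _ (@pgr_hcat_linearr _ _ _ _ _ _ _)).
  exact: (comp_linear (@pgr_actl_linear _ _ _ _ s') (@pgr_actr_linear _ _ _ _ t')).
- apply: (comp_linear _ (@pgr_actr_linear _ _ _ _ _)).
  exact: (comp_linear (@pgr_hcat_linearr _ _ _ _ _ _ _) (@pgr_actl_linear _ _ _ _ _)).
rewrite !(pgr_actlE, pgr_hcatE, pgr_actrE); apply: pgr_cl_iso.
apply: (@DIso _ _ _ _ (dgraph_union (dgraph_actr (dgraph_actl s D) t)
  (dgraph_actr (dgraph_actl s' D') t'))
  (dgraph_actr (dgraph_actl (perm_tens s s') (dgraph_union D D')) (perm_tens t t')) id id id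
    id id id);
  try exact: bij_id.
- by move=> [[e|e]|[e|e]].
- by move=> [[e|e]|[e|e]].
- by move=> [[e|e]|[e|e]]; rewrite /= -perm_tensV permE /perm_tens_fun unsplitK.
- by move=> [[e|e]|[e|e]]; rewrite /= permE /perm_tens_fun unsplitK.
- by move=> [[e|e]|[e|e]] [[e'|e']|[e'|e']].
- by move=> [[e|e]|[e|e]] [[e'|e']|[e'|e']].
- by move=> [v|v].
Qed.

Lemma PGr_hcatC k l k' l' (p : PGr X k l) (p' : PGr X k' l') :
    actl (perm_braid l l') (hcat p p') =
    actr (castP (addnC k' k, addnC l' l) (hcat p' p)) (perm_braid k k').
Proof.
move: p p' => /= p p'; move: p; apply: pgr_lin_ext => [||D].
- exact: (comp_linear (@pgr_hcat_linearl _ _ _ _ _ _ p') (@pgr_actl_linear _ _ _ _ _)).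
- apply: (comp_linear _ (@pgr_actr_linear _ _ _ _ _)).
  exact: (comp_linear (@pgr_hcat_linearr _ _ _ _ _ _ p') (@castP_linear _ (PGr X) _ _ _ _ _)).
move: p'; apply: pgr_lin_ext => [||D'].
- exact: (comp_linear (@pgr_hcat_linearr _ _ _ _ _ _ _) (@pgr_actl_linear _ _ _ _ _)).
- apply: (comp_linear _ (@pgr_actr_linear _ _ _ _ _)).
  exact: (comp_linear (@pgr_hcat_linearl _ _ _ _ _ _ _) (@castP_linear _ (PGr X) _ _ _ _ _)).
rewrite !pgr_hcatE castP_cl pgr_actlE pgr_actrE; apply: pgr_cl_iso.
apply: (@DIso _ _ _ _ (dgraph_actl (perm_braid l l') (dgraph_union D D'))
   (dgraph_actr (dgraph_cast (addnC k' k) (addnC l' l) (dgraph_union D' D)) (perm_braid k k'))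
  (bsumC _ _) (bsumC _ _) (bsumC _ _) (bsumC _ _) (bsumC _ _) (bsumC _ _)); try exact: fw_bij.
- by move=> [[e|e]|[e|e]].
- by move=> [[e|e]|[e|e]].
- by move=> [[e|e]|[e|e]]; apply: (@perm_inj _ (perm_braid k k'));
   rewrite /= permKV permE /perm_braid_fun unsplitK; apply: val_inj.
- by move=> [[e|e]|[e|e]]; rewrite /= permE /perm_braid_fun unsplitK; apply: val_inj.
- by move=> [[e|e]|[e|e]] [[e'|e']|[e'|e']].
- by move=> [[e|e]|[e|e]] [[e'|e']|[e'|e']].
- by move=> [v|v].
Qed.

End PGrTrap.

(** * The axioms of the partial trace for graphs *)

Lemma lift_lift n (i i2 : 'I_n.+2) (i' i2' : 'I_n.+1) x :
  lift i i' = i2 -> lift i2 i2' = i -> lift i (lift i' x) = lift i2 (lift i2' x).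
Proof.
move=> /(congr1 val) /= e /(congr1 val) /= e2; apply: val_inj => /=.
by move: e e2; rewrite /bump; lia.
Qed.

Lemma imap_lift_ne A n (i : 'I_n.+1) (s : A + 'I_n) : imap (lift i) s <> inr i.
Proof. by case: s => //= u [] /eqP; rewrite eq_sym (negPf (neq_lift _ _)). Qed.

Section PtrPtr.
Variables (V : finS) (ain aout : V -> nat) (k l : nat) (G : pgraph ain aout k.+2 l.+2).
Variables (i i2 : 'I_k.+2) (j j2 : 'I_l.+2) (i' i2' : 'I_k.+1) (j' j2' : 'I_l.+1).
Hypotheses (ei : lift i i' = i2) (ei2 : lift i2 i2' = i).
Hypotheses (ej : lift j j' = j2) (ej2 : lift j2 j2' = j).

Lemma wire_tr_tr s t :
  wire (pgraph_tr (pgraph_tr G i j) i' j') s t <-> wire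
    (pgraph_tr (pgraph_tr G i2 j2) i2' j2') s t.
Proof.
have sE : imap (lift i) (imap (lift i') s) = imap (lift i2) (imap (lift i2') s).
  by case: s => //= x; rewrite (lift_lift x ei ei2).
have tE : imap (lift j) (imap (lift j') t) = imap (lift j2) (imap (lift j2') t).
  by case: t => //= x; rewrite (lift_lift x ej ej2).
rewrite !wire_tr /= ei ei2 ej ej2 sE tE.
(* The expansions of the two sides differ by one term each. Such a term contains two wires with a
   common target, one from [s] and one from a traced input, which injectivity of wires excludes. *)
have n1 : ~ (wire G (imap (lift i2) (imap (lift i2') s)) (inr j) /\ wire G (inr i2) (inr j)).
  by case=> h1 h2; case: (@imap_lift_ne _ _ _ _ (wire_inj h1 h2)).
have n2 : ~ (wire G (imap (lift i2) (imap (lift i2') s)) (inr j2) /\ wire G (inr i) (inr j2)).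
  by rewrite -sE; case=> h1 h2; case: (@imap_lift_ne _ _ _ _ (wire_inj h1 h2)).
tauto.
Qed.

Lemma loops_tr_tr :
  #|{: gL (pgraph_tr (pgraph_tr G i j) i' j')}| =
    #|{: gL (pgraph_tr (pgraph_tr G i2 j2) i2' j2')}|.
Proof.
rewrite !loops_tr !(asbool_equiv_eq (wire_tr _ _ _ _ _)) /= ei ei2 ej ej2 !asbool_or
  !asbool_and.
(* If the wires cross, from [i] to [j2] and from [i2] to [j], the straight ones are excluded and
   either order of gluing creates exactly one loop; otherwise each straight wire contributes a loop
   of its own. *)
have n1 : ~~ (`[< wire G (inr i) (inr j) >] && `[< wire G (inr i2) (inr j) >]).
  apply/andP => -[/asboolP h1 /asboolP h2]; have [] := wire_inj h1 h2.
  by rewrite -ei => /eqP; rewrite (negPf (neq_lift _ _)).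
have n2 : ~~ (`[< wire G (inr i) (inr j2) >] && `[< wire G (inr i2) (inr j2) >]).
  apply/andP => -[/asboolP h1 /asboolP h2]; have [] := wire_inj h1 h2.
  by rewrite -ei => /eqP; rewrite (negPf (neq_lift _ _)).
by rewrite -!addnA; congr (_ + _)%N; move: n1 n2; do 4 case: `[< _ >].
Qed.
End PtrPtr.

Lemma or_and_iff (A A' B B' C C' : Prop) :
  (A <-> A') -> (B <-> B') -> (C <-> C') -> (A \/ B /\ C <-> A' \/ B' /\ C').
Proof. tauto. Qed.

Section PGrPtr.
Variables (K : fieldType) (X : ssdata K).

Lemma PGr_ptr_ptr k l (i i2 : 'I_k.+2) (j j2 : 'I_l.+2) (i' i2' : 'I_k.+1) (j' j2' : 'I_l.+1)
    (p : PGr X k.+2 l.+2) :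
  lift i i' = i2 -> lift i2 i2' = i -> lift j j' = j2 -> lift j2 j2' = j ->
  ptr i' j' (ptr i j p) = ptr i2' j2' (ptr i2 j2 p).
Proof.
move=> ei ei2 ej ej2; move: p => /=; apply: pgr_lin_ext => [||D].
- exact: (comp_linear (@pgr_tr_linear _ _ _ _ _ _) (@pgr_tr_linear _ _ _ _ _ _)).
- exact: (comp_linear (@pgr_tr_linear _ _ _ _ _ _) (@pgr_tr_linear _ _ _ _ _ _)).
rewrite !pgr_trE; case: D => V ai ao d G; apply: pgr_cl_wire_id.
  exact: wire_tr_tr.
exact: loops_tr_tr.
Qed.

Lemma PGr_ptr_equiv k l (i : 'I_k.+1) (j : 'I_l.+1) (s : 'S_l.+1) (t : 'S_k.+1)
      (p : PGr X k.+1 l.+1) :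
    ptr i j (actr (actl s p) t) =
    actr (actl (perm_del s j) (ptr (t i) ((s^-1)%g j) p)) (perm_del t (t i)).
Proof.
move: p => /=; apply: pgr_lin_ext => [||D].
- apply: (comp_linear _ (@pgr_tr_linear _ _ _ _ _ _)).
  exact: (comp_linear (@pgr_actl_linear _ _ _ _ s) (@pgr_actr_linear _ _ _ _ t)).
- apply: (comp_linear _ (@pgr_actr_linear _ _ _ _ _)).
  exact: (comp_linear (@pgr_tr_linear _ _ _ _ _ _) (@pgr_actl_linear _ _ _ _ _)).
rewrite !(pgr_actlE, pgr_trE, pgr_actrE); case: D => V ai ao d G.
have tE x : lift (t i) (perm_del t (t i) x) = t (lift i x).
  by rewrite permE lift_drop permK.
have sE x : lift ((s^-1)%g j) (((perm_del s j)^-1)%g x) = (s^-1)%g (lift j x).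
  apply: (@perm_inj _ s); rewrite permKV -[in RHS](permKV (perm_del s j) x) [in RHS]permE.
  by rewrite lift_drop.
apply: pgr_cl_wire_id => [u v|].
  have uE : imap t (imap (lift i) u) = imap (lift (t i)) (imap (perm_del t (t i)) u).
    by case: u => //= x; rewrite tE.
  have vE : imap (s^-1)%g (imap (lift j) v) = imap (lift ((s^-1)%g j))
    (imap ((perm_del s j)^-1)%g v).
    by case: v => //= x; rewrite sE.
  rewrite wire_tr !wire_actr !wire_actl wire_tr /=.
  by rewrite uE vE.
rewrite loops_tr /= loops_tr; congr (_ + nat_of_bool _)%N.
by apply: asbool_equiv_eq; rewrite wire_actr wire_actl.
Qed.

Lemma split_lift_rshift a b (i : 'I_b.+1) (x : 'I_(a + b)) :
  split (cast_ord (esym (addnS a b)) (lift (cast_ord (addnS a b) (rshift a i)) x)) =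
  sum_map id (lift i) (split x).
Proof.
apply: (can_inj (@unsplitK _ _)); rewrite splitK -[x in LHS]splitK.
case: (split x) => y; apply: val_inj => /=; rewrite /bump.
  by move: (ltn_ord y); lia.
by lia.
Qed.

Lemma PGr_ptr_hcatl k l k' l' (i : 'I_k.+1) (j : 'I_l.+1) (p : PGr X k.+1 l.+1)
      (p' : PGr X k' l') :
    ptr (lshift k' i : 'I_(k + k').+1) (lshift l' j : 'I_(l + l').+1) (hcat p p') =
    hcat (ptr i j p) p'.
Proof.
move: p p' => /= p p'; move: p; apply: pgr_lin_ext => [||D].
- by move=> a x y; rewrite pgr_hcat_linearl; exact: (@pgr_tr_linear K X (k + k') (l + l')).
- exact: (comp_linear (@pgr_tr_linear _ _ _ _ _ _) (@pgr_hcat_linearl _ _ _ _ _ _ p')).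
move: p'; apply: pgr_lin_ext => [||D'].
- by move=> a x y; rewrite pgr_hcat_linearr; exact: (@pgr_tr_linear K X (k + k') (l + l')).
- exact: pgr_hcat_linearr.
rewrite pgr_trE !pgr_hcatE [LHS](pgr_trE (k := k + k') (l := l + l')).
apply: (@pgr_cl_wire _ _ _ _ (@dgraph_tr K X (k + k') (l + l') (lshift k' i) (lshift l' j)
  (dgraph_union D D'))
  (dgraph_union (dgraph_tr i j D) D') id) => //; first exact: bij_id.
- have uE a b (x : 'I_a.+1) (s : ([finS of gV D + gV D'] * nat) + 'I_(a + b)) :
    usplit (imap (@lift (a + b).+1 (lshift b x)) s : _ + 'I_(a.+1 + b)) = sum_map
      (imap (lift x)) id (usplit s).
    case: s => [[[v|v] n]|y] //=; rewrite split_lift_lshift.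
    by case: (split y).
  move=> s t; rewrite wire_tr wire_union !wmap_id.
  apply: (iff_trans (or_and_iff (wire_union D D' _ _) (wire_union D D' _ _)
    (wire_union D D' _ _))).
  rewrite !uE /= -![lshift _ _]/(unsplit (inl _)) !unsplitK.
  case: (usplit s) => u; case: (usplit t) => v /=; rewrite ?wire_tr; tauto.
- rewrite loops_tr !loops_union loops_tr addnAC; congr (_ + nat_of_bool _ + _)%N.
  apply: asbool_equiv_eq; apply: (iff_trans (wire_union D D' _ _)).
  by rewrite /= -![lshift _ _]/(unsplit (inl _)) !unsplitK.
Qed.

Lemma PGr_ptr_hcatr k l k' l' (i : 'I_k'.+1) (j : 'I_l'.+1) (p : PGr X k l)
      (p' : PGr X k'.+1 l'.+1) :
    ptr (cast_ord (addnS k k') (rshift k i)) (cast_ord (addnS l l') (rshift l j))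
      (castP (addnS k k', addnS l l') (hcat p p')) =
    hcat p (ptr i j p').
Proof.
move: p p' => /= p p'; move: p; apply: pgr_lin_ext => [||D].
- apply: (comp_linear _ (@pgr_tr_linear _ _ _ _ _ _)).
  exact: (comp_linear (@pgr_hcat_linearl _ _ _ _ _ _ p') (@castP_linear _ (PGr X) _ _ _ _ _)).
- exact: pgr_hcat_linearl.
move: p'; apply: pgr_lin_ext => [||D'].
- apply: (comp_linear _ (@pgr_tr_linear _ _ _ _ _ _)).
  exact: (comp_linear (@pgr_hcat_linearr _ _ _ _ _ _ _) (@castP_linear _ (PGr X) _ _ _ _ _)).
- exact: (comp_linear (@pgr_tr_linear _ _ _ _ _ _) (@pgr_hcat_linearr _ _ _ _ _ _ _)).
rewrite pgr_trE !pgr_hcatE castP_cl pgr_trE.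
apply: (@pgr_cl_wire _ _ _ _ (dgraph_tr _ _ (dgraph_cast (addnS k k') (addnS l l')
  (dgraph_union D D')))
  (dgraph_union D (dgraph_tr i j D')) id) => //; first exact: bij_id.
- have uE a b (x : 'I_b.+1) (s : ([finS of gV D + gV D'] * nat) + 'I_(a + b)) :
    usplit (imap (cast_ord (esym (addnS a b)))
      (imap (lift (cast_ord (addnS a b) (rshift a x))) s)) =
    sum_map id (imap (lift x)) (usplit s).
    case: s => [[[v|v] n]|y] //=; rewrite split_lift_rshift.
    by case: (split y).
  move=> s t; rewrite wire_tr !wire_cast !wire_union !wmap_id.
  rewrite !uE /= !cast_ordK -![rshift _ _]/(unsplit (inr _)) !unsplitK.
  case: (usplit s) => u; case: (usplit t) => v /=; rewrite ?wire_tr; tauto.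
- rewrite loops_tr !loops_union loops_tr addnA; congr (_ + nat_of_bool _)%N.
  apply: asbool_equiv_eq; rewrite wire_cast wire_union /= !cast_ordK.
  by rewrite -![rshift _ _]/(unsplit (inr _)) !unsplitK.
Qed.

Lemma wire_dgraph1 : wire (dgraph1 X) (inr ord0) (inr ord0).
Proof. exact: (wireIO (G := dgraph1 X) tt). Qed.

Lemma split1_0 n : split (ord0 : 'I_(1 + n)) = inl ord0.
Proof. by apply: (can_inj (@unsplitK _ _)); rewrite splitK; apply: val_inj. Qed.

Lemma split1_lift n (x : 'I_n) : split (lift ord0 x : 'I_(1 + n)) = inr x.
Proof. by apply: (can_inj (@unsplitK _ _)); rewrite splitK; apply: val_inj. Qed.

Lemma split_max n : split (cast_ord (esym (addn1 n)) (ord_max : 'I_n.+1)) = inr (ord0 : 'I_1).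
Proof. by apply: (can_inj (@unsplitK _ _)); rewrite splitK; apply: val_inj;
  rewrite /= addn0. Qed.

Lemma split_lift_max n (x : 'I_n) : split (cast_ord (esym (addn1 n)) (lift ord_max x)) = inl
  x :> _ + 'I_1.
Proof.
apply: (can_inj (@unsplitK _ _)); rewrite splitK; apply: val_inj => /=.
by move: (ltn_ord x); rewrite /bump; lia.
Qed.

Lemma cyc_id n (a b : 'I_n.+1) : cyc a b b = a.
Proof. exact: lift_perm_id. Qed.
Lemma cyc_lift n (a b : 'I_n.+1) x : cyc a b (lift b x) = lift a x.
Proof. by rewrite /cyc lift_perm_lift perm1. Qed.
Lemma cycV_id n (a b : 'I_n.+1) : (cyc a b)^-1%g a = b.
Proof. by apply: (@perm_inj _ (cyc a b)); rewrite permKV cyc_id. Qed.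
Lemma cycV_lift n (a b : 'I_n.+1) x : (cyc a b)^-1%g (lift a x) = lift b x.
Proof. by rewrite -(cyc_lift a b) permK. Qed.

Lemma PGr_unitl_out k l (j : 'I_l.+1) (p : PGr X k l.+1) :
    ptr (ord0 : 'I_k.+1) (lift ord0 j) (hcat (trap1 (PGr X)) p) = actl (cyc ord0 j) p.
Proof.
move: p => /=; apply: pgr_lin_ext => [||D].
- by move=> a x y; rewrite pgr_hcat_linearr; exact: (@pgr_tr_linear K X k l.+1).
- exact: pgr_actl_linear.
rewrite pgr_actlE !pgr_hcatE [LHS](pgr_trE (k := k) (l := l.+1)); apply/esym.
apply: (@pgr_cl_wire _ _ _ _ (dgraph_actl (cyc ord0 j) D)
  (@dgraph_tr K X k l.+1 ord0 (lift ord0 j) (dgraph_union (dgraph1 X) D)) inr) => //.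
- by exists (fun x : void + gV D => match x with inl v => match v with end | inr v => v end)
    => [v|[[]|v]].
- move=> s t; refine (iff_trans (wire_actl _ _ _ _) _); apply: iff_sym.
  refine (iff_trans (wire_tr _ _ _ _ _) _).
  refine (iff_trans (or_and_iff (wire_union (dgraph1 X) D _ _) (wire_union (dgraph1 X) D _ _)
    (wire_union (dgraph1 X) D _ _)) _).
  have sE : @usplit [finS of void] (gV D) 1 k (imap (@lift k.+1 ord0) (wmap inr s)) = inr s.
    by case: s => [[v n]|x] //=; rewrite split1_lift.
  rewrite [usplit (imap _ (wmap inr s))]sE /= split1_0 split1_lift /=.
  case: t => [[v n]|x] /=; first by tauto.
  (* Output 0 of the result is that of the strand, fed by what fed output [j] of [D]; the remaining
     outputs are those of [D] without [j], in order. This is the inverse of [cyc ord0 j]. *)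
  case: (unliftP ord0 x) => [y ->|->]; last first.
    have -> : lift (lift ord0 j) (ord0 : 'I_l.+1) = ord0 :> 'I_(1 + l.+1) by apply: val_inj.
    by rewrite split1_0 cycV_id /=; have := wire_dgraph1; tauto.
  have -> : lift (lift ord0 j) (lift ord0 y) = lift ord0 (lift j y) :> 'I_(1 + l.+1) by apply:
    val_inj; rewrite /= /bump; lia.
  by rewrite split1_lift cycV_lift /=; tauto.
- rewrite loops_tr loops_union card_void add0n; apply/eqP;
    rewrite -[X in X == _]addn0 eqn_add2l eq_sym eqb0.
  apply/asboolP => /(wire_union (dgraph1 X) D (inr _) (inr _)) /=.
  by rewrite split1_0 split1_lift.
Qed.

Lemma PGr_unitl_in k l (i : 'I_k.+1) (p : PGr X k.+1 l) :
    ptr (lift ord0 i) (ord0 : 'I_l.+1) (hcat (trap1 (PGr X)) p) = actr p (cyc ord0 i)^-1%g.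
Proof.
move: p => /=; apply: pgr_lin_ext => [||D].
- by move=> a x y; rewrite pgr_hcat_linearr; exact: (@pgr_tr_linear K X k.+1 l).
- exact: pgr_actr_linear.
rewrite pgr_actrE !pgr_hcatE [LHS](pgr_trE (k := k.+1) (l := l)); apply/esym.
apply: (@pgr_cl_wire _ _ _ _ (dgraph_actr D (cyc ord0 i)^-1%g)
  (@dgraph_tr K X k.+1 l (lift ord0 i) ord0 (dgraph_union (dgraph1 X) D)) inr) => //.
- by exists (fun x : void + gV D => match x with inl v => match v with end | inr v => v end)
    => [v|[[]|v]].
- move=> s t; refine (iff_trans (wire_actr _ _ _ _) _); apply: iff_sym.
  refine (iff_trans (wire_tr _ _ _ _ _) _).
  refine (iff_trans (or_and_iff (wire_union (dgraph1 X) D _ _) (wire_union (dgraph1 X) D _ _)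
    (wire_union (dgraph1 X) D _ _)) _).
  have tE : @usplit [finS of void] (gV D) 1 l (imap (@lift l.+1 ord0) (wmap inr t)) = inr t.
    by case: t => [[v n]|x] //=; rewrite split1_lift.
  rewrite [usplit (imap _ (wmap inr t))]tE /= split1_0 split1_lift /=.
  case: s => [[v n]|x] /=; first by tauto.
  case: (unliftP ord0 x) => [y ->|->]; last first.
    have -> : lift (lift ord0 i) (ord0 : 'I_k.+1) = ord0 :> 'I_(1 + k.+1) by apply: val_inj.
    by rewrite split1_0 cycV_id /=; have := wire_dgraph1; tauto.
  have -> : lift (lift ord0 i) (lift ord0 y) = lift ord0 (lift i y) :> 'I_(1 + k.+1) by apply:
    val_inj; rewrite /= /bump; lia.
  by rewrite split1_lift cycV_lift /=; tauto.
- rewrite loops_tr loops_union card_void add0n; apply/eqP;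
    rewrite -[X in X == _]addn0 eqn_add2l eq_sym eqb0.
  apply/asboolP => /(wire_union (dgraph1 X) D (inr _) (inr _)) /=.
  by rewrite split1_0 split1_lift.
Qed.

Lemma PGr_unitr_out k l (j : 'I_l.+1) (p : PGr X k l.+1) :
    ptr ord_max (lift ord_max j) (castP (addn1 k, addn1 l.+1) (hcat p (trap1 (PGr X)))) =
    actl (cyc j ord_max)^-1%g p.
Proof.
move: p => /=; apply: pgr_lin_ext => [||D].
- apply: (comp_linear _ (@pgr_tr_linear _ _ _ _ _ _)).
  exact: (comp_linear (@pgr_hcat_linearl _ _ _ _ _ _ _) (@castP_linear _ (PGr X) _ _ _ _ _)).
- exact: pgr_actl_linear.
rewrite pgr_actlE !pgr_hcatE castP_cl pgr_trE; apply/esym.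
apply: (@pgr_cl_wire _ _ _ _ (dgraph_actl (cyc j ord_max)^-1%g D)
  (dgraph_tr _ _ (dgraph_cast (addn1 k) (addn1 l.+1) (dgraph_union D (dgraph1 X)))) inl) => //.
- by exists (fun x : gV D + void => match x with inr v => match v with end | inl v => v end)
    => [v|[v|[]]].
- move=> s t; rewrite wire_actl wire_tr !wire_cast !wire_union /=.
  rewrite split_max split_lift_max /= invgK.
  have sE : @usplit (gV D) [finS of void] k 1
    (imap (cast_ord (esym (addn1 k))) (imap (lift ord_max) (wmap inl s))) = inl s.
    by case: s => [[v n]|x] //=; rewrite split_lift_max.
  rewrite [usplit (imap _ (imap _ (wmap inl s)))]sE; case: t => [[v n]|x] /=; first by tauto.
  (* Here the strand comes last, and its output is the last one of the result. *)
  case: (unliftP ord_max x) => [y ->|->].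
    have -> : lift (lift ord_max j) (lift ord_max y) = lift ord_max (lift j y).
      by apply: val_inj; move: (ltn_ord y) (ltn_ord j); rewrite /= /bump; lia.
    by rewrite split_lift_max cyc_lift /=; tauto.
  have -> : lift (lift ord_max j) ord_max = ord_max.
    by apply: val_inj; move: (ltn_ord j); rewrite /= /bump; lia.
  by rewrite split_max cyc_id /=; have := wire_dgraph1; tauto.
- rewrite loops_tr loops_union card_void addn0; apply/eqP;
    rewrite -[X in X == _]addn0 eqn_add2l eq_sym eqb0.
  apply/asboolP; rewrite wire_cast wire_union /=.
  by rewrite split_max split_lift_max.
Qed.

Lemma PGr_unitr_in k l (i : 'I_k.+1) (p : PGr X k.+1 l) :
    ptr (lift ord_max i) ord_max (castP (addn1 k.+1, addn1 l) (hcat p (trap1 (PGr X)))) =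
    actr p (cyc i ord_max).
Proof.
move: p => /=; apply: pgr_lin_ext => [||D].
- apply: (comp_linear _ (@pgr_tr_linear _ _ _ _ _ _)).
  exact: (comp_linear (@pgr_hcat_linearl _ _ _ _ _ _ _) (@castP_linear _ (PGr X) _ _ _ _ _)).
- exact: pgr_actr_linear.
rewrite pgr_actrE !pgr_hcatE castP_cl pgr_trE; apply/esym.
apply: (@pgr_cl_wire _ _ _ _ (dgraph_actr D (cyc i ord_max))
  (dgraph_tr _ _ (dgraph_cast (addn1 k.+1) (addn1 l) (dgraph_union D (dgraph1 X)))) inl) => //.
- by exists (fun x : gV D + void => match x with inr v => match v with end | inl v => v end)
    => [v|[v|[]]].
- move=> s t; rewrite wire_actr wire_tr !wire_cast !wire_union /=.
  rewrite split_max split_lift_max /=.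
  have tE : @usplit (gV D) [finS of void] l 1
    (imap (cast_ord (esym (addn1 l))) (imap (lift ord_max) (wmap inl t))) = inl t.
    by case: t => [[v n]|x] //=; rewrite split_lift_max.
  rewrite [usplit (imap _ (imap _ (wmap inl t)))]tE; case: s => [[v n]|x] /=; first by tauto.
  case: (unliftP ord_max x) => [y ->|->].
    have -> : lift (lift ord_max i) (lift ord_max y) = lift ord_max (lift i y).
      by apply: val_inj; move: (ltn_ord y) (ltn_ord i); rewrite /= /bump; lia.
    by rewrite split_lift_max cyc_lift /=; tauto.
  have -> : lift (lift ord_max i) ord_max = ord_max.
    by apply: val_inj; move: (ltn_ord i); rewrite /= /bump; lia.
  by rewrite split_max cyc_id /=; have := wire_dgraph1; tauto.
- rewrite loops_tr loops_union card_void addn0; apply/eqP;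
    rewrite -[X in X == _]addn0 eqn_add2l eq_sym eqb0.
  apply/asboolP; rewrite wire_cast wire_union /=.
  by rewrite split_max split_lift_max.
Qed.

Lemma PGr_trap : is_trap (PGr X).
Proof.
(* Reads the explicit indices of the four axioms as numbers before any trace, which is the form of
   [PGr_ptr_ptr]. *)
have liftE n (i : 'I_n.+2) (i' : 'I_n.+1) :
    if (i' < i)%N then lift i i' = inord i' /\ lift (inord i' : 'I_n.+2)
      (inord i.-1 : 'I_n.+1) = i
    else lift i i' = inord i'.+1 /\ lift (inord i'.+1 : 'I_n.+2) (inord i : 'I_n.+1) = i.
  by move: (ltn_ord i) (ltn_ord i') => *; case: ifP => h; split; apply: val_inj;
    rewrite /= ?inordK /bump; lia.
split.
- exact: PGr_ssmod.
- exact: pgr_hcat_linearl.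
- exact: pgr_hcat_linearr.
- exact: pgr_tr_linear.
- exact: PGr_hcatA.
- exact: PGr_hcat0p.
- exact: PGr_hcatp0.
- exact: PGr_hcat_equiv.
- exact: PGr_hcatC.
- move=> k l i j i' j' p hi hj; have := liftE _ i i'; have := liftE _ j j'.
  by rewrite hi hj => -[e1 e2] [e3 e4]; exact: PGr_ptr_ptr.
- move=> k l i j i' j' p hi hj; have := liftE _ i i'; have := liftE _ j j'.
  by rewrite [(i' < i)%N]ltnNge hi hj => -[e1 e2] [e3 e4]; exact: PGr_ptr_ptr.
- move=> k l i j i' j' p hi hj; have := liftE _ i i'; have := liftE _ j j'.
  by rewrite hi [(j' < j)%N]ltnNge hj => -[e1 e2] [e3 e4]; exact: PGr_ptr_ptr.
- move=> k l i j i' j' p hi hj; have := liftE _ i i'; have := liftE _ j j'.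
  by rewrite [(i' < i)%N]ltnNge hi [(j' < j)%N]ltnNge hj => -[e1 e2] [e3 e4];
    exact: PGr_ptr_ptr.
- exact: PGr_ptr_equiv.
- exact: PGr_ptr_hcatl.
- exact: PGr_ptr_hcatr.
- exact: PGr_unitl_out.
- exact: PGr_unitl_in.
- exact: PGr_unitr_out.
- exact: PGr_unitr_in.
Qed.
End PGrPtr.

(** * The universal property *)

Section ValueMorphism.
Variables (K : fieldType) (X : ssdata K) (P : trap K).
Variable phi : forall k l : nat, X k l -> P k l.
Hypothesis phi_linear : forall k l, linear (@phi k l).

Let hP := trapP P.
Let val_cl := pgr_val_cl phi_linear.

Lemma pgr_val_linear k l : linear (@pgr_val K X P phi k l).
Proof. exact/pgr_ext_linear/dval_compatible. Qed.

Lemma pgr_val_trap : trap_morphism (@pgr_val K X P phi).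
Proof.
split.
- split.
  + exact: pgr_val_linear.
  + move=> k l s; apply: pgr_lin_ext => [||D].
    * exact: comp_linear (@pgr_actl_linear K X k l s) (@pgr_val_linear k l).
    * exact: comp_linear (@pgr_val_linear k l) (actl_linear (trap_ssmod hP) s).
    by rewrite [actl s _]pgr_actlE !val_cl dval_actl.
  + move=> k l x t; move: x; apply: pgr_lin_ext => [||D].
    * exact: comp_linear (@pgr_actr_linear K X k l t) (@pgr_val_linear k l).
    * exact: comp_linear (@pgr_val_linear k l) (actr_linear (trap_ssmod hP) t).
    by rewrite [actr _ t]pgr_actrE !val_cl dval_actr.
- move=> k l k' l' p p'; move: p; apply: pgr_lin_ext => [||D].
  + exact: comp_linear (@pgr_hcat_linearl K X k l k' l' p') (@pgr_val_linear _ _).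
  + exact: comp_linear (@pgr_val_linear k l) (hcat_linearl hP _).
  move: p'; apply: pgr_lin_ext => [||D'].
  + exact: comp_linear (@pgr_hcat_linearr K X k l k' l' _) (@pgr_val_linear _ _).
  + exact: comp_linear (@pgr_val_linear _ _) (hcat_linearr hP _).
  by rewrite [hcat _ _]pgr_hcatE !val_cl dval_union.
- move=> k l i j; apply: pgr_lin_ext => [||D].
  + exact: comp_linear (@pgr_tr_linear K X k l i j) (@pgr_val_linear _ _).
  + exact: comp_linear (@pgr_val_linear _ _) (ptr_linear hP i j).
  by rewrite [ptr i j _]pgr_trE !val_cl dval_tr.
- by rewrite [trap0 _]/(pgr_cl _) val_cl dval_dgraph0.
- by rewrite [trap1 _]/(pgr_cl _) val_cl dval_dgraph1.
Qed.

Lemma pgr_val_iota k l (x : X k l) : pgr_val phi (pgr_iota x) = phi x.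
Proof. by rewrite val_cl dval_corolla. Qed.
End ValueMorphism.

(* Wires are the graph of a bijection, so an inclusion is an equality. *)
Lemma wire_sub (V : finS) (ain aout : V -> nat) k l (G G' : pgraph ain aout k l) :
  (forall s t, wire G s t -> wire G' s t) -> forall s t, wire G s t <-> wire G' s t.
Proof.
move=> sub s t; split=> [|w']; first exact: sub.
have [t' w] := wire_total G (wire_source w').
by rewrite (wire_fun w' (sub _ _ w)).
Qed.

(** * Cutting open internal edges and loops *)

Section Uncut.
Variables (V : finS) (ain aout : V -> nat) (k l : nat) (G : pgraph ain aout k l).

Definition bnew A n (f : A <~> 'I_n) : option A <~> 'I_n.+1 := binv (bunlift ord0) \b bopt f.

Section Edge.
Variable e : gE G.

(** The new outer end, labelled [None], takes the place of [e] at its vertex, so cutting changes no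
    rank. *)
Definition bopen (A : finS) : rest e + option A <~> gE G + A :=
  bsum (binv (brest e)) (bid A) \b binv (boptsum _ _) \b bsumo _ _.

Definition open_edge : pgraph ain aout k.+1 l.+1 :=
  @rewire V ain aout k l k.+1 l.+1 G (rest e) [finS of option (gI G)] [finS of option (gO G)]
   (gIO G) (gL G) _ _ _ _ (fw_bij (bopen (gI G))) (fw_bij (bopen (gO G)))
   (fw_bij (bnew (balpha G) \b boptsum (gI G) (gIO G)))
   (fw_bij (bnew (bbeta G) \b boptsum (gO G) (gIO G))).

Lemma open_edge_tr s t : wire G s t <-> wire (pgraph_tr open_edge ord0 ord0) s t.
Proof.
apply: wire_sub => {}s {}t w; apply/wire_tr; case: w => [x|x|x|x] /=.
(* The wire of [e] is the only one that passes through the glued pair. *)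
- have [->|xe] := eqVneq x e; [right; split|left].
  + by have := wireO (G := open_edge) None; rewrite posS_rewire.
  + by have := wireI (G := open_edge) None; rewrite posT_rewire.
  + by have := wireE (G := open_edge) (exist _ x xe); rewrite posS_rewire posT_rewire.
- by left; have := wireI (G := open_edge) (Some x); rewrite posT_rewire.
- by left; have := wireO (G := open_edge) (Some x); rewrite posS_rewire.
- by left; have := wireIO (G := open_edge) x.
Qed.

Lemma open_edge_loops : #|{: gL G}| = #|{: gL (pgraph_tr open_edge ord0 ord0)}|.
Proof.
rewrite loops_tr [X in (_ + nat_of_bool X)%N](_ : _ = false) ?addn0 //.
by apply/asboolP => w; have := wire_fun w (wireI (G := open_edge) None).
Qed.
End Edge.

Section Loop.
Variable u : gL G.

(** The loop becomes an input-output edge numbered 0 on both sides: gluing it to itself recreates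
    the loop and touches no other wire. *)
Definition open_loop : pgraph ain aout k.+1 l.+1 :=
  @rewire V ain aout k l k.+1 l.+1 G (gE G) (gI G) (gO G) [finS of option (gIO G)] (rest u)
   _ _ _ _ (bij_id _) (bij_id _)
   (fw_bij (bnew (balpha G) \b bsumo (gI G) (gIO G)))
   (fw_bij (bnew (bbeta G) \b bsumo (gO G) (gIO G))).

Lemma open_loop_tr s t : wire G s t <-> wire (pgraph_tr open_loop ord0 ord0) s t.
Proof.
apply: wire_sub => {}s {}t w; apply/wire_tr; left; case: w => [x|x|x|x] /=.
- by have := wireE (G := open_loop) x; rewrite posS_rewire posT_rewire.
- by have := wireI (G := open_loop) x; rewrite posT_rewire.
- by have := wireO (G := open_loop) x; rewrite posS_rewire.
- exact: (wireIO (G := open_loop) (Some x)).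
Qed.

Lemma open_loop_loops : #|{: gL G}| = #|{: gL (pgraph_tr open_loop ord0 ord0)}|.
Proof.
rewrite loops_tr [X in (_ + nat_of_bool X)%N](_ : _ = true) ?addn1; last first.
  by apply/asboolP; exact: (wireIO (G := open_loop) None).
by rewrite (bij_eq_card (fw_bij (brest u))) card_option.
Qed.
End Loop.
End Uncut.

Lemma card_bij (A B : finType) : #|A| = #|B| -> exists f : A <~> B, True.
Proof. by move=> e; exists (binv (brank B) \b (bcast e \b brank A)). Qed.

Definition bvoidr A C (h : C <~> void) : C + A <~> A := bsumv A h \b bsumC C A.

Lemma bvoidrK A C (h : C <~> void) u : inr (bvoidr A h u) = u.
Proof. by case: u => [c|//]; case: (h c). Qed.

(** * Generation by corollas and strands, and uniqueness *)

Section Generation.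
Variables (K : fieldType) (X : ssdata K).

Definition renum k l k' l' (f : 'I_k <~> 'I_k') (g : 'I_l <~> 'I_l') (D : dgraph X k l) :
  dgraph X k' l' :=
  DGraph (dec D) (rewire (gL D) (bij_id _) (bij_id _) (bij_comp (fw_bij f) (alpha_bij D))
    (bij_comp (fw_bij g) (beta_bij D))).

Lemma pgr_cl_renum k l k' l' (f : 'I_k <~> 'I_k') (g : 'I_l <~> 'I_l') (D : dgraph X k l) :
  pgr_cl (renum f g D) = relab (P := Trap (PGr_trap X)) f g (pgr_cl D).
Proof.
have e := bij_ord f; have e' := bij_ord g; subst k' l'.
rewrite relab_self [actr _ _]pgr_actrE [actl _ _]pgr_actlE.
apply: pgr_cl_wire_id => // s t; rewrite wire_actl wire_actr.
have fE x : (perm_of_bij f)^-1%g x = bw f x.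
  by apply: (@perm_inj _ (perm_of_bij f)); rewrite permKV permE bwK.
have gE x : (perm_of_bij g)^-1%g x = bw g x.
  by apply: (@perm_inj _ (perm_of_bij g)); rewrite permKV permE bwK.
have -> : imap (perm_of_bij f)^-1%g s = imap (bw f) s by case: s => //= x; rewrite fE.
have -> : imap (perm_of_bij g)^-1%g t = imap (bw g) t by case: t => //= x; rewrite gE.
rewrite -[s in X in X <-> _](imapK (bwK f)) -[t in X in X <-> _](imapK (bwK g)).
by apply: wire_renumber => //; exact: fw_inj.
Qed.

Section EdgeFree.
Variables (k l k' l' : nat) (D : dgraph X k l) (D' : dgraph X k' l').
Variable fV : gV D <~> gV D'.
Hypothesis fdec : forall v, decv (fV v) = decv v.
Variables (hE : gE D <~> void) (hE' : gE D' <~> void) (hL : gL D <~> void)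
  (hL' : gL D' <~> void).
Variable fIO : gIO D <~> gIO D'.

(** With no internal edge, the inputs and outputs attached to vertices are exactly the slots, so a
    matching of decorated vertices matches them rank by rank; [f] and [g] absorb whatever outer
    numbering results. *)
Lemma edge_free_iso : exists f g, inhabited (diso (renum f g D) D').
Proof.
have ei v : gin D' (fV v) = gin D v := congr1 (fun u => (tag u).1) (fdec v).
have eo v : gout D' (fV v) = gout D v := congr1 (fun u => (tag u).2) (fdec v).
pose uI := binv (btgt D') \b (bslot ei \b btgt D).
pose uO := binv (bsrc D') \b (bslot eo \b bsrc D).
pose fI := bvoidr _ hE' \b (uI \b binv (bvoidr _ hE)).
pose fO := bvoidr _ hE' \b (uO \b binv (bvoidr _ hE)).
pose fE := binv hE' \b hE; pose fL := binv hL' \b hL.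
have uIE e : sum_map fE fI e = uI e.
  by case: e => [x|x]; [case: (hE x) | rewrite -[LHS]/(inr (bvoidr _ hE' (uI (inr x))))
    bvoidrK].
have uOE e : sum_map fE fO e = uO e.
  by case: e => [x|x]; [case: (hE x) | rewrite -[LHS]/(inr (bvoidr _ hE' (uO (inr x))))
    bvoidrK].
have uIs e : (tgt D' (uI e), posT (uI e)) = (fV (tgt D e), posT e).
  by rewrite -btgtE -[uI e]/(bw (btgt D') (bslot ei (btgt D e))) bwK bslotE.
have uOs e : (src D' (uO e), posS (uO e)) = (fV (src D e), posS e).
  by rewrite -bsrcE -[uO e]/(bw (bsrc D') (bslot eo (bsrc D e))) bwK bslotE.
exists (balpha D' \b (bsum fI fIO \b binv (balpha D))),
  (bbeta D' \b (bsum fO fIO \b binv (bbeta D))).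
constructor; apply: (@DIso _ _ _ _ (renum _ _ D) D' fV fE fI fO fIO fL); try exact: fw_bij.
- by move=> e; rewrite uOE; have [] := uOs e.
- by move=> e; rewrite uIE; have [] := uIs e.
- by move=> e; rewrite -[RHS]/(alpha D' (bsum fI fIO (bw (balpha D) (balpha D e)))) fwK.
- by move=> e; rewrite -[RHS]/(beta D' (bsum fO fIO (bw (bbeta D) (bbeta D e)))) fwK.
- move=> e e'; rewrite !uIE (posE (rinP D')) -[RHS]/(rin D e e') (posE (rinP D)).
  have [-> p1] := uIs e; have [-> p2] := uIs e'; rewrite (inj_eq (fw_inj fV)).
  by move: p1 p2; rewrite /posT => -> ->.
- move=> e e'; rewrite !uOE (posE (routP D')) -[RHS]/(rout D e e') (posE (routP D)).
  have [-> p1] := uOs e; have [-> p2] := uOs e'; rewrite (inj_eq (fw_inj fV)).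
  by move: p1 p2; rewrite /posS => -> ->.
- exact: fdec.
Qed.
End EdgeFree.

Section Agree.
Variables (P : trap K) (Phi Psi : forall k l, PGr X k l -> P k l).
Hypotheses (hPhi : trap_morphism Phi) (hPsi : trap_morphism Psi).
Hypothesis iotaE : forall k l (x : X k l), Phi (pgr_iota x) = Psi (pgr_iota x).

Let agree k l (D : dgraph X k l) := Phi (pgr_cl D : PGr X k l) = Psi (pgr_cl D).

Lemma agree_renum k l k' l' (f : 'I_k <~> 'I_k') (g : 'I_l <~> 'I_l') (D : dgraph X k l) :
  agree D -> agree (renum f g D).
Proof.
move=> h; rewrite /agree pgr_cl_renum; have e := bij_ord f; have e' := bij_ord g; subst k' l'.
have [[_ aP bP] _ _ _ _] := hPhi; have [[_ aQ bQ] _ _ _ _] := hPsi.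
by rewrite relab_self aP aQ bP bQ h.
Qed.

Lemma agree_union k l k' l' (D : dgraph X k l) (D' : dgraph X k' l') :
  agree D -> agree D' -> agree (dgraph_union D D').
Proof.
move=> h h'; rewrite /agree -pgr_hcatE.
by rewrite (trm_hcat hPhi) (trm_hcat hPsi) h h'.
Qed.

Lemma agree_tr k l i j (D : dgraph X k.+1 l.+1) : agree D -> agree (dgraph_tr i j D).
Proof.
move=> h; rewrite /agree -pgr_trE.
by rewrite (trm_ptr hPhi) (trm_ptr hPsi) h.
Qed.

Lemma agree_strands n : exists k l (D : dgraph X k l),
  [/\ agree D, #|{: gV D}| = 0%N, #|{: gE D}| = 0%N, #|{: gL D}| = 0%N & #|{: gIO D}| = n].
Proof.
elim: n => [|n [k [l [D [h v0 e0 l0 n0]]]]].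
  exists 0%N, 0%N, (dgraph0 X); rewrite !card_void; split=> //.
  by rewrite /agree (trm0 hPhi) (trm0 hPsi).
exists (1 + k)%N, (1 + l)%N, (dgraph_union (dgraph1 X) D); split.
- by apply: agree_union => //; rewrite /agree (trm1 hPhi) (trm1 hPsi).
- by rewrite card_sum card_void.
- by rewrite card_sum card_void.
- by rewrite card_sum card_void.
- by rewrite card_sum card_unit n0.
Qed.

(** The [r] strands are united with the corolla of each vertex, one vertex at a time. The numbers of
    inputs and outputs are left open: the renumbering given by [edge_free_iso] identifies them
    afterwards. *)
Lemma agree_vertices (V : finS) (m n : V -> nat) (x : forall v, X (m v) (n v)) r :
  exists k l (D : dgraph X k l) (f : gV D <~> V),
  [/\ agree D, #|{: gE D}| = 0%N, #|{: gL D}| = 0%N, #|{: gIO D}| = r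
    & forall v, decv v = existT (fun n : nat * nat => X n.1 n.2 : Type) (m (f v), n (f v))
      (x (f v))].
Proof.
move: {2}(#|{: V}|) (erefl #|{: V}|) => c; elim: c V m n x => [|c IH] V m n x cV.
  have [k [l [D [h v0 e0 l0 n0]]]] := agree_strands r.
  have [f _] : exists f : gV D <~> V, True by apply: card_bij; rewrite v0 cV.
  exists k, l, D, f; split=> // v.
  by have := card0_eq v0 v.
have [v _] : exists v, v \in {: V} by apply/card_gt0P; rewrite cV.
have cR : #|{: rest v}| = c.
  by have := bij_eq_card (fw_bij (brest v)); rewrite card_option cV => -[].
have [k [l [D [f [h e0 l0 n0 dE]]]]] := IH (rest v) (fun w => m (val w)) (fun w => n (val w))
  (fun w => x (val w)) cR.
exists (m v + k)%N, (n v + l)%N, (dgraph_union (dgraph_corolla (x v)) D).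
exists (binv (brest v) \b (bopt f \b bunitsum (gV D))).
split; try by rewrite card_sum card_void.
- by apply: agree_union => //; exact: iotaE.
- by move=> [[]|w] //; have := dE w.
Qed.

Lemma card0_bij (A : finType) : #|A| = 0%N -> exists h : A <~> void, True.
Proof. by move=> A0; apply: card_bij; rewrite A0 card_void. Qed.

Lemma agree_edge_free k l (D : dgraph X k l) :
  #|{: gE D}| = 0%N -> #|{: gL D}| = 0%N -> agree D.
Proof.
move=> e0 l0; have [k' [l' [D' [f [h e0' l0' n0 dE]]]]] := agree_vertices (dec D) #|{: gIO D}|.
have [hE _] := card0_bij e0; have [hL _] := card0_bij l0.
have [hE' _] := card0_bij e0'; have [hL' _] := card0_bij l0'.
have [fIO _] := card_bij n0.
have [F [G [i]]] := @edge_free_iso _ _ _ _ D' D f (fun v => esym (dE v)) hE' hE hL' hL fIO.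
by rewrite /agree -(pgr_cl_iso i); exact: agree_renum.
Qed.

Lemma agree_all k l (D : dgraph X k l) : agree D.
Proof.
move: {2}(#|{: gE D}| + #|{: gL D}|)%N (erefl (#|{: gE D}| + #|{: gL D}|)%N) => c.
elim: c k l D => [|c IH] k l D cD.
  by apply: agree_edge_free; apply/eqP; move/eqP: cD; rewrite addn_eq0 => /andP [].
have [e0|/card_gt0P [e _]] := posnP #|{: gE D}|.
  have [u _] : exists u, u \in {: gL D} by apply/card_gt0P; move: cD; rewrite e0 add0n => ->.
  have -> : agree D = agree (dgraph_tr ord0 ord0 (DGraph (dec D) (open_loop u))).
    rewrite /agree; congr (Phi _ = Psi _); case: (D) u => V ai ao d G u;
      by apply: pgr_cl_wire_id; [exact: open_loop_tr | exact: open_loop_loops].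
  apply/agree_tr/IH; move: cD; rewrite (bij_eq_card (fw_bij (brest u))) card_option.
  by rewrite addnS => -[].
have -> : agree D = agree (dgraph_tr ord0 ord0 (DGraph (dec D) (open_edge e))).
  rewrite /agree; congr (Phi _ = Psi _); case: (D) e => V ai ao d G e;
    by apply: pgr_cl_wire_id; [exact: open_edge_tr | exact: open_edge_loops].
apply/agree_tr/IH; move: cD; rewrite (bij_eq_card (fw_bij (brest e))) card_option.
by rewrite addSn => -[].
Qed.

Lemma trap_morphism_ext k l (x : PGr X k l) : Phi x = Psi x.
Proof.
move: x; apply: pgr_lin_ext => [||D]; last exact: agree_all.
- exact: ssm_linear (trm_ss hPhi) k l.
- exact: ssm_linear (trm_ss hPsi) k l.
Qed.
End Agree.
End Generation.

Theorem theorem5p19 (K : fieldType) (X : ssmod K) (P : trap K)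
    (phi : forall k l : nat, X k l -> P k l) (hphi : ss_morphism phi) :
  is_trap (PGr X) /\
  exists! Phi : forall k l : nat, PGr X k l -> P k l,
    trap_morphism Phi /\
    forall (k l : nat) (x : X k l), Phi k l (pgr_iota x) = phi k l x.
Proof.
split; first exact: PGr_trap.
have phi_linear := ssm_linear hphi.
exists (@pgr_val K X P phi); split.
  by split; [exact: pgr_val_trap | move=> k l x; exact: pgr_val_iota].
move=> Phi [hPhi PhiE]; apply: functional_extensionality_dep => k.
apply: functional_extensionality_dep => l; apply: functional_extensionality_dep => x.
apply: (trap_morphism_ext (pgr_val_trap phi_linear) hPhi) => {}k {}l {}x.
by rewrite PhiE pgr_val_iota.
Qed.
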